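(* Let $0<a<b$, $\alpha>0$, $\mu>0$, let $\Omega=\{\mathbf{x}\in\mathbb{R}^2: a<|\mathbf{x}|<b\}$, put $\sigma=b/a>1$ and $$\mu_c=\frac{a\alpha\left(1+3\sigma^4-4\sigma^2-4\sigma^4\log\sigma\right)}{2\left(\sigma^4-1-4\sigma^4\log\sigma\right)}>0 .$$ If $\mu>\mu_c$, then the steady state $(\mathbf{u},P)=(\mathbf{0},p_0)$ ($p_0$ constant) of the incompressible Navier–Stokes equations in $\Omega$ with viscosity $\mu$, under the mixed boundary conditions (BC) and average condition (AV) of the context, is linearly stable; if $\mu<\mu_c$, it is linearly unstable.
   Context: Notation: $B(0,r)$ is the open disc of radius $r$ centred at the origin, $\mathbf{n}$ is the outward unit normal on $\partial\Omega$, $\tau$ is a unit tangent vector to the circles centred at $0$, and $\nabla\times\mathbf{v}=\partial_xv_2-\partial_yv_1$. Boundary conditions (BC) for a velocity–pressure pair $(\mathbf{v},q)$: $\mathbf{v}\cdot\mathbf{n}=0$ on $|\mathbf{x}|=a$; $\mathbf{v}\cdot\mathbf{n}=0$ and $\nabla\times\mathbf{v}=0$ on $|\mathbf{x}|=b$; and $\big[(-q\mathbf{I}+\mu(\nabla\mathbf{v}+(\nabla\mathbf{v})^{T}))\mathbf{n}\big]\cdot\tau=\alpha\,\mathbf{v}\cdot\tau$ on $|\mathbf{x}|=a$. (In polar coordinates the last condition is $\partial_rv_\theta=(\frac1a-\frac{\alpha}{\mu})v_\theta$ at $r=a$.) Average condition (AV): $\int_{\partial B(0,r)}\mathbf{v}\cdot\tau\,ds=0$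 for all $a\le r\le b$. Linearization at $(\mathbf{0},p_0)$: $\partial_t\mathbf{v}=\mu\Delta\mathbf{v}-\nabla q$, $\nabla\cdot\mathbf{v}=0$ in $\Omega$, with (BC), (AV). The associated eigenvalue problem is $\mu\Delta\mathbf{v}-\nabla q=\lambda\mathbf{v}$, $\nabla\cdot\mathbf{v}=0$ in $\Omega$, with (BC), (AV), $\mathbf v\neq 0$; its eigenvalues are real. The steady state is linearly stable if the largest eigenvalue $\lambda$ is negative and linearly unstable if the largest eigenvalue is positive. *)

(* Defs.v *)
From Stdlib Require Import Reals.
From Coquelicot Require Import Coquelicot.
Open Scope R_scope.

(** Fields on the plane are total functions; only their values on (a
    neighbourhood of) the closed annulus are ever constrained. *)
Definition scalar_field := R -> R -> R.
Definition vector_field := R -> R -> R * R.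

Definition comp1 (v : vector_field) : scalar_field := fun x y => fst (v x y).
Definition comp2 (v : vector_field) : scalar_field := fun x y => snd (v x y).

Definition dot (p q : R * R) : R := fst p * fst q + snd p * snd q.

Definition dx (f : scalar_field) : scalar_field :=
  fun x y => Derive (fun t => f t y) x.
Definition dy (f : scalar_field) : scalar_field :=
  fun x y => Derive (fun t => f x t) y.

Definition laplacian (f : scalar_field) : scalar_field :=
  fun x y => dx (dx f) x y + dy (dy f) x y.
Definition divergence (v : vector_field) : scalar_field :=
  fun x y => dx (comp1 v) x y + dy (comp2 v) x y.
Definition curl (v : vector_field) : scalar_field :=
  fun x y => dx (comp2 v) x y - dy (comp1 v) x y.
(** (v . grad) f *)
Definition advect (v : vector_field) (f : scalar_field) : scalar_field :=
  fun x y => comp1 v x y * dx f x y + comp2 v x y * dy f x y.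

Definition radius (x y : R) : R := sqrt (x ^ 2 + y ^ 2).

Definition annulus (a b x y : R) : Prop := a < radius x y < b.
Definition closed_annulus (a b x y : R) : Prop := a <= radius x y <= b.

(** Unit tangent to the circles centred at the origin (counterclockwise). *)
Definition tau (x y : R) : R * R := (- y / radius x y, x / radius x y).

(** Outward unit normal of the annulus: it points to the origin on the inner
    circle and away from it on the outer one. *)
Definition normal_inner (x y : R) : R * R :=
  (- x / radius x y, - y / radius x y).
Definition normal_outer (x y : R) : R * R :=
  (x / radius x y, y / radius x y).

(** The vector (-q I + mu (grad v + (grad v)^T)) n at the point (x, y). *)
Definition traction (mu : R) (v : vector_field) (q : scalar_field)
    (x y : R) (n : R * R) : R * R :=
  let s11 := - q x y + mu * (2 * dx (comp1 v) x y) in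
  let s12 := mu * (dy (comp1 v) x y + dx (comp2 v) x y) in
  let s22 := - q x y + mu * (2 * dy (comp2 v) x y) in
  (s11 * fst n + s12 * snd n, s12 * fst n + s22 * snd n).

(** C^k up to the boundary: every point of the closed annulus has a
    neighbourhood on which all partial derivatives of order at most k exist
    and are continuous. *)
Definition Ck_closed (a b : R) (k : nat) (f : scalar_field) : Prop :=
  forall x y, closed_annulus a b x y ->
    locally_2d (fun x' y' => ex_diff_n f k x' y') x y.

Definition regular (a b : R) (v : vector_field) (q : scalar_field) : Prop :=
  Ck_closed a b 2 (comp1 v) /\ Ck_closed a b 2 (comp2 v) /\ Ck_closed a b 1 q.

Definition incompressible (a b : R) (v : vector_field) : Prop :=
  forall x y, annulus a b x y -> divergence v x y = 0.

Definition boundary_conditions (a b alpha mu : R)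
    (v : vector_field) (q : scalar_field) : Prop :=
  (forall x y, radius x y = a ->
     dot (v x y) (normal_inner x y) = 0 /\
     dot (traction mu v q x y (normal_inner x y)) (tau x y)
       = alpha * dot (v x y) (tau x y)) /\
  (forall x y, radius x y = b ->
     dot (v x y) (normal_outer x y) = 0 /\ curl v x y = 0).

(** The line integral is taken along the arc-length element ds = r dt. *)
Definition circulation (v : vector_field) (r : R) : R :=
  RInt (fun t => dot (v (r * cos t) (r * sin t))
                     (tau (r * cos t) (r * sin t)) * r) 0 (2 * PI).

Definition average_condition (a b : R) (v : vector_field) : Prop :=
  forall r, a <= r <= b -> circulation v r = 0.

(** Steady incompressible Navier-Stokes: (u . grad) u = mu Lap u - grad P. *)
Definition steady_state (a b alpha mu : R)
    (u : vector_field) (P : scalar_field) : Prop :=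
  regular a b u P /\
  (forall x y, annulus a b x y ->
     advect u (comp1 u) x y = mu * laplacian (comp1 u) x y - dx P x y /\
     advect u (comp2 u) x y = mu * laplacian (comp2 u) x y - dy P x y) /\
  incompressible a b u /\
  boundary_conditions a b alpha mu u P /\
  average_condition a b u.

Definition rest_velocity : vector_field := fun _ _ => (0, 0).
Definition constant_pressure (p0 : R) : scalar_field := fun _ _ => p0.

(** Eigenvalues of the linearization at [(rest_velocity, constant_pressure p0)].
    The linearized equations do not depend on p0, and the convective term
    contributes nothing to them.  The eigenvalues of this self-adjoint problem
    are real, so real eigenpairs suffice. *)
Definition rest_eigenvalue (a b alpha mu lambda : R) : Prop :=
  exists (v : vector_field) (q : scalar_field),
    regular a b v q /\
    (forall x y, annulus a b x y ->
       mu * laplacian (comp1 v) x y - dx q x y = lambda * comp1 v x y /\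
       mu * laplacian (comp2 v) x y - dy q x y = lambda * comp2 v x y) /\
    incompressible a b v /\
    boundary_conditions a b alpha mu v q /\
    average_condition a b v /\
    (exists x y, annulus a b x y /\ v x y <> (0, 0)).

Definition largest_rest_eigenvalue (a b alpha mu lambda : R) : Prop :=
  rest_eigenvalue a b alpha mu lambda /\
  forall lambda', rest_eigenvalue a b alpha mu lambda' -> lambda' <= lambda.

Definition rest_linearly_stable (a b alpha mu : R) : Prop :=
  exists lambda, largest_rest_eigenvalue a b alpha mu lambda /\ lambda < 0.

Definition rest_linearly_unstable (a b alpha mu : R) : Prop :=
  exists lambda, largest_rest_eigenvalue a b alpha mu lambda /\ 0 < lambda.

Definition mu_crit (a b alpha : R) : R :=
  let sigma := b / a in
  a * alpha * (1 + 3 * sigma ^ 4 - 4 * sigma ^ 2 - 4 * sigma ^ 4 * ln sigma)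
    / (2 * (sigma ^ 4 - 1 - 4 * sigma ^ 4 * ln sigma)).

(* Main.v *)
Require Import Defs.
From Stdlib Require Import Reals Ranalysis5 Lra Lia Psatz List.
From Coquelicot Require Import Coquelicot.
Open Scope R_scope.

(** Writing [v = grad^perp psi] and [w = Delta psi], the eigenvalue problem becomes [mu Delta w = lambda w]
    with [psi = 0] on both circles, [w = 0] on [|x| = b] and [w = (2/a - alpha/mu) d_r psi] on [|x| = a].
    It splits into angular modes [n >= 1]; the average condition removes [n = 0]. With [t = ln r] each
    mode is a linear system on [ln a, ln b]. Multiplying by [psi] gives, in each mode,
    [(lambda/mu) D = - S - (2/a - alpha/mu) (d_t psi)^2 / a] with [d_t psi] taken at [r = a], where [D] is
    the Dirichlet energy and [S] the enstrophy. The best constant in [(d_t psi)^2 <= H S] is attained when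
    [w] is the harmonic function of the mode [n = 1], and at [mu = mu_crit] the number [1 + (2/a - alpha/mu) H / a]
    vanishes. A cruder trace inequality gives [lambda/mu <= K - n^2 / (2 b^2)], so only finitely
    many modes compete near the supremum of the spectrum; the eigenvalues of a mode are the zeros
    of a continuous function of [lambda/mu], so the supremum is attained. Existence of an eigenvalue
    comes from sign changes of this function: it is oscillating at minus infinity, has the sign of
    [mu - mu_crit] at [0] for [n = 1], and is positive at plus infinity. *)

(** * Linear second-order equations *)

(** A largest eigenvalue must be exhibited with an eigenpair, in the stable case too, so existence,
    boundedness and attainment are all proved by elementary means. Two passages carry the weight.
    From a mode to a field, the angular factor is the polynomial Re (x + iy)^n times a function of
    ln r, so that no angle is chosen; the pressure is mu times a harmonic conjugate of w - kappa
    psi. If no mode has the eigenvalue lambda / mu, all coefficients of v vanish, and completeness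
    of the trigonometric system gives v = 0. The stream function is recovered as (w - harmonic part)
    / kappa, hence the maximal eigenvalue is shown to be non-zero before a field is built from it.
    The constant H is the integral of e^{2t} h^2 for the harmonic profile h equal to 1 at a and 0 at
    b; its closed form is the source of the logarithm in [mu_crit]. *)

Lemma continuous_pt (f : R -> R) (x : R) : continuous f x <-> continuity_pt f x.
Proof. now rewrite continuity_pt_filterlim. Qed.

Lemma is_derive_cont (f : R -> R) (x l : R) : is_derive f x l -> continuous f x.
Proof. intros H. apply (ex_derive_continuous f). now exists l. Qed.

Lemma is_RInt_FTC (F f : R -> R) (u v : R) :
  (forall s, Rmin u v <= s <= Rmax u v -> is_derive F s (f s)) ->
  (forall s, Rmin u v <= s <= Rmax u v -> continuous f s) ->
  is_RInt f u v (F v - F u).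
Proof. exact (@is_RInt_derive R_CompleteNormedModule F f u v). Qed.

Lemma exp_le_compat (x y : R) : x <= y -> exp x <= exp y.
Proof. intros [H| ->]; [left; now apply exp_increasing|lra]. Qed.

Lemma real_Rbar_mult (c : R) (l : Rbar) : real (Rbar_mult c l) = c * real l.
Proof.
destruct l as [l| |]; simpl; auto; destruct (Rle_dec 0 c) as [H|H]; simpl; try ring;
  destruct (Rle_lt_or_eq_dec 0 c H); simpl; ring.
Qed.

(** * Global solutions of y'' = Q y by Picard iteration *)

Section Picard.
Variables (Q : R -> R) (t0 y0 p0 : R).
Hypothesis HQ : forall t, continuous Q t.

Fixpoint picard (n : nat) : (R -> R) * (R -> R) :=
  match n with
  | O => ((fun _ => y0), (fun _ => p0))
  | S n => ((fun t => y0 + RInt (snd (picard n)) t0 t),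
            (fun t => p0 + RInt (fun s => Q s * fst (picard n) s) t0 t))
  end.

Lemma is_derive_RInt_cont (f : R -> R) (c t : R) :
  (forall s, continuous f s) -> is_derive (fun u => c + RInt f t0 u) t (f t).
Proof.
intros Hf.
replace (f t) with (0 + f t) by ring.
apply (is_derive_plus (fun _ => c) (RInt f t0)).
- exact (is_derive_const c t).
- apply is_derive_RInt with t0.
  + apply filter_forall; intros u. apply (@RInt_correct R_CompleteNormedModule).
    apply ex_RInt_continuous. intros z _. apply Hf.
  + apply Hf.
Qed.

Lemma picard_cont (n : nat) :
  (forall t, continuous (fst (picard n)) t) /\ (forall t, continuous (snd (picard n)) t).
Proof.
induction n as [|n [IH1 IH2]]; simpl.
- split; intros t; apply continuous_const.
- split; intros t.
  + eapply is_derive_cont, is_derive_RInt_cont. exact IH2.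
  + eapply is_derive_cont. apply (is_derive_RInt_cont (fun s => Q s * fst (picard n) s)).
    intros s. apply (continuous_mult Q); auto.
Qed.

Lemma picard_derive1 (n : nat) (t : R) :
  is_derive (fst (picard (S n))) t (snd (picard n) t).
Proof. apply is_derive_RInt_cont, picard_cont. Qed.

Lemma picard_derive2 (n : nat) (t : R) :
  is_derive (snd (picard (S n))) t (Q t * fst (picard n) t).
Proof.
apply (is_derive_RInt_cont (fun s => Q s * fst (picard n) s)).
intros s. apply (continuous_mult Q); auto. apply picard_cont.
Qed.

(** Twice the rate [M] in the exponential weight makes each integration a contraction by 1/2. *)
Lemma weighted_integral_bound (F f : R -> R) (M C t : R) :
  0 < M -> 0 <= C -> F t0 = 0 -> (forall s, is_derive F s (f s)) -> (forall s, continuous f s) ->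
  (forall s, Rabs (s - t0) <= Rabs (t - t0) -> Rabs (f s) <= M * (C * exp (2 * M * Rabs (s - t0)))) ->
  Rabs (F t) <= C / 2 * exp (2 * M * Rabs (t - t0)).
Proof.
intros HM HC H0 HF Hf Hb.
assert (Hi : is_RInt f t0 t (F t)).
{ replace (F t) with (F t - F t0) by (rewrite H0; ring).
  now apply is_RInt_FTC. }
destruct (Rle_lt_dec t0 t) as [Ht|Ht].
- assert (Hg : is_RInt (fun s => M * (C * exp (2 * M * (s - t0)))) t0 t
      (C / 2 * exp (2 * M * (t - t0)) - C / 2 * exp (2 * M * (t0 - t0)))).
  { apply (is_RInt_FTC (fun s => C / 2 * exp (2 * M * (s - t0)))).
    - intros s _. auto_derive; auto. unfold Rminus. field.
    - intros s _. apply (ex_derive_continuous (fun s => M * (C * exp (2 * M * (s - t0))))).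
      auto_derive; auto. }
  eapply Rle_trans.
  + apply (norm_RInt_le f _ t0 t (F t) _ Ht) with (2 := Hi) (3 := Hg).
    intros s [Hs1 Hs2]. change (norm (f s)) with (Rabs (f s)).
    rewrite <- (Rabs_pos_eq (s - t0)) by lra. apply Hb. rewrite !Rabs_pos_eq by lra. lra.
  + rewrite (Rabs_pos_eq (t - t0)) by lra.
    generalize (exp_pos (2 * M * (t0 - t0))). nra.
- assert (Hg : is_RInt (fun s => M * (C * exp (2 * M * (t0 - s)))) t t0
      (- C / 2 * exp (2 * M * (t0 - t0)) - - C / 2 * exp (2 * M * (t0 - t)))).
  { apply (is_RInt_FTC (fun s => - C / 2 * exp (2 * M * (t0 - s)))).
    - intros s _. auto_derive; auto. unfold Rminus. field.
    - intros s _. apply (ex_derive_continuous (fun s => M * (C * exp (2 * M * (t0 - s))))).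
      auto_derive; auto. }
  apply is_RInt_swap in Hi.
  assert (Ht' : t <= t0) by lra.
  eapply Rle_trans.
  + rewrite <- Rabs_Ropp.
    apply (norm_RInt_le f _ t t0 (opp (F t)) _ Ht') with (2 := Hi) (3 := Hg).
    intros s [Hs1 Hs2]. change (norm (f s)) with (Rabs (f s)).
    rewrite <- (Rabs_pos_eq (t0 - s)) by lra. rewrite Rabs_minus_sym. apply Hb.
    rewrite !(Rabs_minus_sym _ t0), !Rabs_pos_eq by lra. lra.
  + rewrite (Rabs_minus_sym t t0), (Rabs_pos_eq (t0 - t)) by lra.
    generalize (exp_pos (2 * M * (t0 - t0))). nra.
Qed.

(** With [1 <= M] one weight serves both equations, y' = p with coefficient 1 and p' = Q y with |Q|
    <= M. Each integration gains a factor 1/2 under this weight, hence the 2^n. *)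
Lemma picard_step (R0 M : R) (n : nat) (t : R) :
  1 <= M -> (forall s, Rabs (s - t0) <= R0 -> Rabs (Q s) <= M) -> Rabs (t - t0) <= R0 ->
  let C := (Rabs y0 + Rabs p0) / 2 ^ n in
  Rabs (fst (picard (S n)) t - fst (picard n) t) <= C * exp (2 * M * Rabs (t - t0)) /\
  Rabs (snd (picard (S n)) t - snd (picard n) t) <= C * exp (2 * M * Rabs (t - t0)).
Proof.
intros HM HQM. revert t.
induction n as [|n IH]; intros t Ht C.
- assert (HC : 0 <= C) by (unfold C; generalize (Rabs_pos y0) (Rabs_pos p0); simpl; lra).
  assert (He : forall s, 1 <= exp (2 * M * Rabs (s - t0))).
  { intros s. rewrite <- exp_0. apply exp_le_compat. generalize (Rabs_pos (s - t0)). nra. }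
  assert (Hh : C / 2 * exp (2 * M * Rabs (t - t0)) <= C * exp (2 * M * Rabs (t - t0))).
  { generalize (exp_pos (2 * M * Rabs (t - t0))). nra. }
  split; (eapply Rle_trans; [|exact Hh]).
  + apply (weighted_integral_bound (fun t => fst (picard 1) t - fst (picard 0) t) (fun t => snd (picard 0) t) M); auto; try lra.
    * simpl. rewrite RInt_point. unfold zero; simpl; ring.
    * intros s. simpl snd.
      replace p0 with (p0 - 0) by ring.
      apply (is_derive_minus (fst (picard 1)) (fst (picard 0))); [apply picard_derive1|].
      exact (is_derive_const y0 s).
    * intros s. apply (proj2 (picard_cont 0)).
    * intros s Hs. simpl snd. apply Rle_trans with (1 * (C * 1)).
      { unfold C. simpl. generalize (Rabs_pos y0). lra. }
      apply Rmult_le_compat; try lra. apply Rmult_le_compat; try lra. apply He.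
  + apply (weighted_integral_bound (fun t => snd (picard 1) t - snd (picard 0) t) (fun t => Q t * fst (picard 0) t) M); auto; try lra.
    * simpl. rewrite RInt_point. unfold zero; simpl; ring.
    * intros s.
      replace (Q s * fst (picard 0) s) with (Q s * fst (picard 0) s - 0) by ring.
      apply (is_derive_minus (snd (picard 1)) (snd (picard 0))); [apply picard_derive2|].
      exact (is_derive_const p0 s).
    * intros s. apply (continuous_mult Q); auto. apply (proj1 (picard_cont 0)).
    * intros s Hs. simpl fst. rewrite Rabs_mult.
      apply Rmult_le_compat; try apply Rabs_pos. apply HQM; lra.
      apply Rle_trans with (C * 1).
      { unfold C. simpl. generalize (Rabs_pos p0). lra. }
      apply Rmult_le_compat; try lra. apply He.
- assert (HC : 0 <= (Rabs y0 + Rabs p0) / 2 ^ n).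
  { apply Rmult_le_pos. generalize (Rabs_pos y0) (Rabs_pos p0); lra.
    left; apply Rinv_0_lt_compat, pow_lt; lra. }
  assert (HCC : C = (Rabs y0 + Rabs p0) / 2 ^ n / 2).
  { unfold C. simpl. field. apply pow_nonzero; lra. }
  rewrite HCC.
  split.
  + apply (weighted_integral_bound (fun t => fst (picard (S (S n))) t - fst (picard (S n)) t)
       (fun t => snd (picard (S n)) t - snd (picard n) t) M); auto; try lra.
    * simpl. rewrite !RInt_point. unfold zero; simpl; ring.
    * intros s. apply (is_derive_minus (fst (picard (S (S n)))) (fst (picard (S n)))); apply picard_derive1.
    * intros s. apply (continuous_minus (snd (picard (S n)))); apply picard_cont.
    * intros s Hs. apply Rle_trans with (1 * ((Rabs y0 + Rabs p0) / 2 ^ n * exp (2 * M * Rabs (s - t0)))).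
      { rewrite Rmult_1_l. apply IH. lra. }
      apply Rmult_le_compat_r; try lra. apply Rmult_le_pos; auto. left; apply exp_pos.
  + apply (weighted_integral_bound (fun t => snd (picard (S (S n))) t - snd (picard (S n)) t)
       (fun t => Q t * fst (picard (S n)) t - Q t * fst (picard n) t) M); auto; try lra.
    * simpl. rewrite !RInt_point. unfold zero; simpl; ring.
    * intros s. apply (is_derive_minus (snd (picard (S (S n)))) (snd (picard (S n)))); apply picard_derive2.
    * intros s. apply (continuous_minus (fun t => Q t * fst (picard (S n)) t)); apply (continuous_mult Q); auto; apply picard_cont.
    * intros s Hs. rewrite <- Rmult_minus_distr_l, Rabs_mult.
      apply Rmult_le_compat; try apply Rabs_pos. apply HQM; lra. apply IH; lra.
Qed.

Lemma geometric_CVU (fn : nat -> R -> R) (D : R -> Prop) (C : R) :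
  (forall n x, D x -> Rabs (fn (S n) x - fn n x) <= C / 2 ^ n) -> CVU_dom fn D.
Proof.
intros H. apply CVU_dom_cauchy. intros eps.
assert (Hk : forall k n x, D x -> Rabs (fn (n + k)%nat x - fn n x) <= 2 * C / 2 ^ n - 2 * C / 2 ^ (n + k)).
{ induction k as [|k IH]; intros n x Hx.
  - rewrite Nat.add_0_r, Rminus_diag, Rabs_R0. lra.
  - replace (n + S k)%nat with (S (n + k)) by lia.
    replace (fn (S (n + k)) x - fn n x) with ((fn (S (n + k)) x - fn (n + k)%nat x) + (fn (n + k)%nat x - fn n x)) by ring.
    eapply Rle_trans; [apply Rabs_triang|].
    specialize (IH n x Hx). specialize (H (n + k)%nat x Hx).
    assert (2 * C / 2 ^ (S (n + k)) = C / 2 ^ (n + k)) by (simpl; field; apply pow_nonzero; lra).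
    assert (2 * C / 2 ^ (n + k) = 2 * (C / 2 ^ (n + k))) by (field; apply pow_nonzero; lra).
    lra. }
(* Both indices are compared with [N], so each distance has to stay below eps / 2; the tail from [N]
   on is at most 2 C / 2^N. *)
destruct (pow_lt_1_zero (/ 2)) with (y := eps / (4 * (Rabs C + 1))) as [N HN].
- rewrite Rabs_pos_eq; lra.
- apply Rdiv_lt_0_compat. apply cond_pos. generalize (Rabs_pos C); lra.
- exists N. intros n m x Hx Hn Hm.
  assert (HNN := HN N (le_n N)). rewrite Rabs_pos_eq in HNN by (apply pow_le; lra).
  rewrite pow_inv in HNN.
  assert (Hb : forall j, (N <= j)%nat -> Rabs (fn j x - fn N x) <= 2 * C / 2 ^ N).
  { intros j Hj. replace j with (N + (j - N))%nat by lia.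
    eapply Rle_trans; [apply Hk; auto|].
    assert (0 <= C / 2 ^ (N + (j - N))).
    { eapply Rle_trans; [apply Rabs_pos|]. exact (H (N + (j - N))%nat x Hx). }
    lra. }
  assert (Hs : 2 * C / 2 ^ N < eps / 2).
  { apply Rle_lt_trans with (2 * (Rabs C + 1) * / 2 ^ N).
    - unfold Rdiv. apply Rmult_le_compat_r. left; apply Rinv_0_lt_compat, pow_lt; lra.
      generalize (Rle_abs C); lra.
    - apply Rlt_le_trans with (2 * (Rabs C + 1) * (eps / (4 * (Rabs C + 1)))).
      + apply Rmult_lt_compat_l; auto. generalize (Rabs_pos C); lra.
      + right. field. generalize (Rabs_pos C); lra. }
  replace (fn n x - fn m x) with ((fn n x - fn N x) - (fn m x - fn N x)) by ring.
  eapply Rle_lt_trans; [apply Rabs_triang|]. rewrite Rabs_Ropp.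
  generalize (Hb n Hn) (Hb m Hm). lra.
Qed.

Lemma picard_CVU (R0 : R) : 0 < R0 ->
  CVU_dom (fun n => fst (picard n)) (fun t => Rabs (t - t0) < R0) /\
  CVU_dom (fun n => snd (picard n)) (fun t => Rabs (t - t0) < R0).
Proof.
intros HR.
destruct (continuity_ab_maj (fun t => Rabs (Q t)) (t0 - R0) (t0 + R0)) as [tm [Htm _]].
{ lra. }
{ intros c _. apply continuous_pt, (continuous_comp Q Rabs); auto. apply continuous_Rabs. }
set (M := Rabs (Q tm) + 1).
assert (HM : 1 <= M) by (unfold M; generalize (Rabs_pos (Q tm)); lra).
assert (HQM : forall s, Rabs (s - t0) <= R0 -> Rabs (Q s) <= M).
{ intros s Hs. unfold M. apply Rabs_le_between in Hs. assert (Hs' := Htm s ltac:(lra)). simpl in Hs'. lra. }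
assert (HE : forall t n, Rabs (t - t0) < R0 ->
   (Rabs y0 + Rabs p0) / 2 ^ n * exp (2 * M * Rabs (t - t0)) <= (Rabs y0 + Rabs p0) * exp (2 * M * R0) / 2 ^ n).
{ intros t n Ht.
  replace ((Rabs y0 + Rabs p0) * exp (2 * M * R0) / 2 ^ n) with ((Rabs y0 + Rabs p0) / 2 ^ n * exp (2 * M * R0))
    by (field; apply pow_nonzero; lra).
  apply Rmult_le_compat_l.
  - apply Rmult_le_pos. generalize (Rabs_pos y0) (Rabs_pos p0); lra.
    left; apply Rinv_0_lt_compat, pow_lt; lra.
  - apply exp_le_compat. apply Rmult_le_compat_l; lra. }
split; apply geometric_CVU with ((Rabs y0 + Rabs p0) * exp (2 * M * R0)); intros n x Hx;
  (eapply Rle_trans; [|apply (HE x n Hx)]); apply (picard_step R0 M n x); auto; lra.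
Qed.

Definition ode_value (t : R) : R := Lim_seq (fun n => fst (picard n) t).
Definition ode_slope (t : R) : R := Lim_seq (fun n => snd (picard n) t).

(** The derivative of iterate [S n] is an expression in iterate [n], and both sequences converge
    uniformly on each bounded interval centred at [t0], so the limit can be differentiated termwise.
    The radius [R0] is chosen after [t], which makes the solution global. *)
Lemma linear_ode :
  (forall t, is_derive ode_value t (ode_slope t)) /\
  (forall t, is_derive ode_slope t (Q t * ode_value t)) /\
  ode_value t0 = y0 /\ ode_slope t0 = p0.
Proof.
assert (Hin : forall fn : nat -> R -> R, forall t, Lim_seq (fun n => fn (S n) t) = Lim_seq (fun n => fn n t)).
{ intros fn t. exact (Lim_seq_incr_1 (fun n => fn n t)). }
assert (Hop : forall R0, open (fun t => Rabs (t - t0) < R0)).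
{ intros R0 t Ht. assert (H : 0 < R0 - Rabs (t - t0)) by lra.
  exists (mkposreal _ H). intros u Hu. change (Rabs (u - t) < R0 - Rabs (t - t0)) in Hu.
  replace (u - t0) with ((u - t) + (t - t0)) by ring.
  eapply Rle_lt_trans; [apply Rabs_triang|]. lra. }
assert (Hco : forall R0, is_connected (fun t => Rabs (t - t0) < R0)).
{ intros R0 u v x Hu Hv Hx. apply Rabs_lt_between in Hu. apply Rabs_lt_between in Hv.
  apply Rabs_lt_between. lra. }
assert (HS : forall fn D, CVU_dom fn D -> CVU_dom (fun n => fn (S n)) D).
{ intros fn D H. apply CVU_dom_cauchy. apply CVU_dom_cauchy in H. intros eps.
  destruct (H eps) as [N HN]. exists N. intros; apply HN; auto. }
unfold ode_value, ode_slope.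
split; [|split; [|split]].
- intros t. set (R0 := Rabs (t - t0) + 1).
  assert (HR : 0 < R0) by (unfold R0; generalize (Rabs_pos (t - t0)); lra).
  destruct (picard_CVU R0 HR) as [HC1 HC2].
  apply (is_derive_ext (fun t => real (Lim_seq (fun n => fst (picard (S n)) t)))).
  { intros s. now rewrite (Hin (fun n => fst (picard n))). }
  replace (real (Lim_seq (fun n => snd (picard n) t))) with (real (Lim_seq (fun n => Derive (fst (picard (S n))) t))).
  2:{ f_equal. apply Lim_seq_ext. intros n. apply is_derive_unique, picard_derive1. }
  apply (CVU_Derive (fun n => fst (picard (S n))) (fun t => Rabs (t - t0) < R0)); auto.
  + apply (HS (fun n => fst (picard n))); auto.
  + intros n x _. eexists. apply picard_derive1.
  + intros n x _. apply continuous_pt. apply (continuous_ext (snd (picard n))).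
    intros s. symmetry. apply is_derive_unique, picard_derive1. apply picard_cont.
  + apply CVU_dom_cauchy. apply CVU_dom_cauchy in HC2. intros eps.
    destruct (HC2 eps) as [N HN]. exists N. intros n m x Hx Hn Hm.
    rewrite !(is_derive_unique _ _ _ (picard_derive1 _ _)). now apply HN.
  + unfold R0; lra.
- intros t. set (R0 := Rabs (t - t0) + 1).
  assert (HR : 0 < R0) by (unfold R0; generalize (Rabs_pos (t - t0)); lra).
  destruct (picard_CVU R0 HR) as [HC1 HC2].
  apply (is_derive_ext (fun t => real (Lim_seq (fun n => snd (picard (S n)) t)))).
  { intros s. now rewrite (Hin (fun n => snd (picard n))). }
  replace (Q t * real (Lim_seq (fun n => fst (picard n) t))) with (real (Lim_seq (fun n => Derive (snd (picard (S n))) t))).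
  2:{ rewrite (Lim_seq_ext _ (fun n => Q t * fst (picard n) t)).
      - now rewrite Lim_seq_scal_l, real_Rbar_mult.
      - intros n. apply is_derive_unique, picard_derive2. }
  apply (CVU_Derive (fun n => snd (picard (S n))) (fun t => Rabs (t - t0) < R0)); auto.
  + apply (HS (fun n => snd (picard n))); auto.
  + intros n x _. eexists. apply picard_derive2.
  + intros n x _. apply continuous_pt. apply (continuous_ext (fun s => Q s * fst (picard n) s)).
    intros s. symmetry. apply is_derive_unique, picard_derive2.
    apply (continuous_mult Q); auto. apply picard_cont.
  + destruct (continuity_ab_maj (fun t => Rabs (Q t)) (t0 - R0) (t0 + R0)) as [tm [Htm _]].
{ lra. }
    { intros c _. apply continuous_pt, (continuous_comp Q Rabs); auto. apply continuous_Rabs. }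
    set (M := Rabs (Q tm) + 1).
    assert (HM : 0 < M) by (unfold M; generalize (Rabs_pos (Q tm)); lra).
    apply CVU_dom_cauchy. apply CVU_dom_cauchy in HC1. intros eps.
    assert (He : 0 < eps / M) by (apply Rdiv_lt_0_compat; auto; apply cond_pos).
    destruct (HC1 (mkposreal _ He)) as [N HN]. exists N. intros n m x Hx Hn Hm.
    rewrite !(is_derive_unique _ _ _ (picard_derive2 _ _)).
    rewrite <- Rmult_minus_distr_l, Rabs_mult.
    specialize (HN n m x Hx Hn Hm). simpl in HN.
    assert (Rabs (Q x) <= M).
    { unfold M. apply Rabs_lt_between in Hx. assert (Hs' := Htm x ltac:(lra)). simpl in Hs'. lra. }
    apply Rle_lt_trans with (M * Rabs (fst (picard n) x - fst (picard m) x)).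
    apply Rmult_le_compat_r; auto. apply Rabs_pos.
    replace (pos eps) with (M * (eps / M)) by (field; lra).
    apply Rmult_lt_compat_l; auto.
  + unfold R0; lra.
- rewrite (Lim_seq_ext _ (fun _ => y0)); [now rewrite Lim_seq_const|].
  intros [|n]; simpl; auto. rewrite RInt_point. unfold zero; simpl; ring.
- rewrite (Lim_seq_ext _ (fun _ => p0)); [now rewrite Lim_seq_const|].
  intros [|n]; simpl; auto. rewrite RInt_point. unfold zero; simpl; ring.
Qed.
End Picard.

(** * Monotonicity and a backward Gronwall inequality *)

Lemma is_derive_nondecreasing (f df : R -> R) (u v : R) :
  u <= v -> (forall s, u <= s <= v -> is_derive f s (df s)) ->
  (forall s, u <= s <= v -> 0 <= df s) -> f u <= f v.
Proof.
intros Huv Hd Hb.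
destruct (MVT_gen f u v df) as [c [Hc1 Hc2]].
- intros s. rewrite Rmin_left, Rmax_right by lra. intros Hs. apply Hd; lra.
- intros s. rewrite Rmin_left, Rmax_right by lra. intros Hs.
  eapply continuous_pt, is_derive_cont, Hd; lra.
- rewrite Rmin_left, Rmax_right in Hc1 by lra. specialize (Hb c Hc1). nra.
Qed.

(** E exp (M s) is nondecreasing. The estimate runs from right to left because the solutions it
    serves are normalised at the outer circle, the right end of the interval. *)
Lemma gronwall_backward (E E' : R -> R) (u v M : R) :
  u <= v -> (forall s, u <= s <= v -> is_derive E s (E' s)) ->
  (forall s, u <= s <= v -> - M * E s <= E' s) -> E u <= E v * exp (M * (v - u)).
Proof.
intros Huv Hd Hb.
assert (H : E u * exp (M * u) <= E v * exp (M * v)).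
{ apply (is_derive_nondecreasing (fun s => E s * exp (M * s)) (fun s => (E' s + M * E s) * exp (M * s))); auto.
  - intros s Hs. evar_last.
    + apply (is_derive_mult E (fun s => exp (M * s)) s (E' s) (M * exp (M * s))).
      apply Hd; lra. auto_derive; auto; ring. intros; apply Rmult_comm.
    + unfold plus, mult; simpl; ring.
  - intros s Hs. apply Rmult_le_pos. specialize (Hb s Hs); lra. left; apply exp_pos. }
replace (M * (v - u)) with (M * v + - (M * u)) by ring. rewrite exp_plus, exp_Ropp.
apply Rmult_le_reg_r with (exp (M * u)); [apply exp_pos|].
eapply Rle_trans; [apply H|]. right. field. apply Rgt_not_eq, exp_pos.
Qed.

(** * Energy estimates for a single angular mode *)

Ltac derive_fields := auto_derive; [repeat split; eexists; eauto|..].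

Ltac rw_derive H :=
  match type of H with is_derive ?f ?x ?l =>
    rewrite ?(is_derive_unique f x l H : Derive (fun u => f u) x = l) end.

Lemma is_derive_constant (f df : R -> R) (u v : R) :
  u <= v -> (forall s, u <= s <= v -> is_derive f s (df s)) ->
  (forall s, u <= s <= v -> df s = 0) -> f u = f v.
Proof.
intros Huv Hd H0. apply Rle_antisym.
- apply (is_derive_nondecreasing f df); auto. intros s Hs; rewrite H0; auto; lra.
- apply Ropp_le_cancel, (is_derive_nondecreasing (fun s => - f s) (fun s => - df s)); auto.
  + intros s Hs. apply (is_derive_opp f s (df s)); auto.
  + intros s Hs; rewrite H0; auto; lra.
Qed.

Lemma clamp_cont (u v t : R) : continuous (fun s => Rmax u (Rmin v s)) t.
Proof.
apply continuous_pt. intros eps Heps. exists eps; split; auto.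
intros x [_ Hx]. simpl in *. unfold R_dist in *.
eapply Rle_lt_trans; [|exact Hx].
unfold Rmax, Rmin. repeat destruct Rle_dec; unfold Rabs; repeat destruct Rcase_abs; lra.
Qed.

Lemma clamp_id (u v s : R) : u <= s <= v -> Rmax u (Rmin v s) = s.
Proof. intros Hs. rewrite Rmin_right, Rmax_right; lra. Qed.

(** Two-sided differentiability at the endpoints is obtained by extending [phi] by constants. *)
Lemma antiderivative (phi : R -> R) (u v : R) :
  u <= v -> (forall t, u <= t <= v -> continuous phi t) ->
  exists F, F u = 0 /\ forall t, u <= t <= v -> is_derive F t (phi t).
Proof.
intros Huv Hphi. set (phi' := fun s => phi (Rmax u (Rmin v s))).
assert (Hc : forall s, continuous phi' s).
{ intros s. apply (continuous_comp (fun s => Rmax u (Rmin v s)) phi). apply clamp_cont.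
  apply Hphi. split. apply Rmax_l. apply Rmax_lub; auto. apply Rmin_l. }
exists (fun t => 0 + RInt phi' u t). split.
- rewrite RInt_point. unfold zero; simpl; ring.
- intros t Ht. replace (phi t) with (phi' t) by (unfold phi'; rewrite clamp_id; auto).
  now apply is_derive_RInt_cont.
Qed.

(** Without a strict increase, monotonicity would make F constant, and its derivative at the
    interior point [t] would be 0. *)
Lemma antiderivative_pos (F phi : R -> R) (u v t : R) :
  (forall s, u <= s <= v -> is_derive F s (phi s)) ->
  (forall s, u <= s <= v -> 0 <= phi s) -> u < t < v -> 0 < phi t -> F u < F v.
Proof.
intros Hd Hp Ht Hpt.
assert (Hm : forall x y, u <= x -> x <= y -> y <= v -> F x <= F y).
{ intros x y Hx Hxy Hy. apply (is_derive_nondecreasing F phi); auto; intros s Hs;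
  [apply Hd|apply Hp]; lra. }
destruct (Rle_lt_dec (F v) (F u)) as [H|H]; auto.
assert (HF : forall s, u <= s <= v -> F s = F u).
{ intros s Hs. generalize (Hm u s) (Hm s v). lra. }
assert (H0 : is_derive F t 0).
{ apply (is_derive_ext_loc (fun _ => F u)).
  - assert (Hr : 0 < Rmin (t - u) (v - t)) by (apply Rmin_pos; lra).
    exists (mkposreal _ Hr). intros y Hy. change (Rabs (y - t) < Rmin (t - u) (v - t)) in Hy.
    symmetry. apply HF. apply Rabs_lt_between in Hy.
    generalize (Rmin_l (t - u) (v - t)) (Rmin_r (t - u) (v - t)). lra.
  - exact (is_derive_const (F u) t). }
assert (Hu : phi t = 0).
{ rewrite <- (is_derive_unique _ _ _ (Hd t ltac:(lra))). apply (is_derive_unique _ _ _ H0). }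
lra.
Qed.

(** Gronwall for E = d^2 + e^2 + eps^2: the constant eps^2 absorbs the forcing through 2 e eta >= -
    (e^2 + eps^2), so that E' >= - (M + 2) E. With eps = 0 this is uniqueness; with eps proportional
    to the change of a parameter it is Lipschitz dependence. *)
Lemma linear_ode_bound (d e q eta : R -> R) (u v M eps : R) :
  (forall t, u <= t <= v -> is_derive d t (e t)) ->
  (forall t, u <= t <= v -> is_derive e t (q t * d t + eta t)) ->
  (forall t, u <= t <= v -> Rabs (q t) <= M) -> (forall t, u <= t <= v -> Rabs (eta t) <= eps) ->
  d v = 0 -> e v = 0 ->
  forall t, u <= t <= v -> d t ^ 2 + e t ^ 2 <= eps ^ 2 * exp ((M + 2) * (v - u)).
Proof.
intros Hd He Hq Heta Hdv Hev t Ht.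
assert (H : d t ^ 2 + e t ^ 2 + eps ^ 2 <= (d v ^ 2 + e v ^ 2 + eps ^ 2) * exp ((M + 2) * (v - t))).
{ apply (gronwall_backward (fun t => d t ^ 2 + e t ^ 2 + eps ^ 2)
     (fun t => 2 * d t * e t + 2 * e t * (q t * d t + eta t))); [lra| |].
  - intros s Hs. assert (Ds := Hd s ltac:(lra)). assert (Es := He s ltac:(lra)).
    derive_fields.
    rw_derive Ds; rw_derive Es. ring.
  - intros s Hs. specialize (Hq s ltac:(lra)). specialize (Heta s ltac:(lra)).
    apply Rabs_le_between in Hq. apply Rabs_le_between in Heta.
    assert (eta s ^ 2 <= eps ^ 2) by nra.
    assert (- M * (d s ^ 2 + e s ^ 2) <= 2 * q s * (d s * e s)).
    { assert (0 <= (M + q s) * (d s + e s) ^ 2) by (apply Rmult_le_pos; [lra|apply pow2_ge_0]).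
      assert (0 <= (M - q s) * (d s - e s) ^ 2) by (apply Rmult_le_pos; [lra|apply pow2_ge_0]).
      nra. }
    generalize (pow2_ge_0 (d s + e s)) (pow2_ge_0 (e s + eta s)) (pow2_ge_0 (d s)) (pow2_ge_0 (e s)).
    assert (0 <= M) by lra. nra. }
rewrite Hdv, Hev in H.
assert (0 <= M) by (specialize (Hq t Ht); generalize (Rabs_pos (q t)); lra).
assert (exp ((M + 2) * (v - t)) <= exp ((M + 2) * (v - u))).
{ apply exp_le_compat, Rmult_le_compat_l; lra. }
generalize (pow2_ge_0 eps). nra.
Qed.

Section Modes.
Variables a b : R.
Hypothesis Ha : 0 < a.
Hypothesis Hab : a < b.

Definition coef (nu kappa t : R) : R := nu ^ 2 + kappa * exp (2 * t).

(** In the variable [t = ln r], for the angular frequency [nu]: [f] is the stream function, [w] the vorticity,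
    [g] and [p] their derivatives; [kappa = lambda / mu] and [gam = (2/a - alpha/mu) / a]. *)
Definition is_mode (nu kappa gam : R) (f g w p : R -> R) : Prop :=
  (forall t, ln a <= t <= ln b ->
     is_derive f t (g t) /\ is_derive g t (nu ^ 2 * f t + exp (2 * t) * w t) /\
     is_derive w t (p t) /\ is_derive p t (coef nu kappa t * w t)) /\
  (f (ln a) = 0 /\ f (ln b) = 0) /\ (w (ln b) = 0 /\ w (ln a) = gam * g (ln a)) /\
  exists t, ln a < t < ln b /\ w t <> 0.

Definition mode_eigenvalue (nu kappa gam : R) : Prop :=
  exists f g w p, is_mode nu kappa gam f g w p.

Lemma ln_a_lt_ln_b : ln a < ln b.
Proof. apply ln_increasing; lra. Qed.

Lemma exp_2ln (x : R) : 0 < x -> exp (2 * ln x) = x ^ 2.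
Proof. intros Hx. replace (2 * ln x) with (ln x + ln x) by ring. rewrite exp_plus, exp_ln; auto; ring. Qed.

Lemma exp2_bounds (t : R) : ln a <= t <= ln b -> a ^ 2 <= exp (2 * t) <= b ^ 2.
Proof. intros Ht. rewrite <- !exp_2ln by lra. split; apply exp_le_compat; lra. Qed.

(** [D] is the Dirichlet energy of the stream function, [S] the enstrophy. *)
Definition are_energies (nu : R) (f g w D S : R -> R) : Prop :=
  D (ln a) = 0 /\ S (ln a) = 0 /\
  forall t, ln a <= t <= ln b ->
    is_derive D t (g t ^ 2 + nu ^ 2 * f t ^ 2) /\ is_derive S t (exp (2 * t) * w t ^ 2).

Section Energy.
Variables nu kappa gam : R.
Variables f g w p : R -> R.
Hypothesis Hmode : is_mode nu kappa gam f g w p.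

Let Df t (Ht : ln a <= t <= ln b) : is_derive f t (g t) := proj1 (proj1 Hmode t Ht).
Let Dg t (Ht : ln a <= t <= ln b) := proj1 (proj2 (proj1 Hmode t Ht)).
Let Dw t (Ht : ln a <= t <= ln b) : is_derive w t (p t) := proj1 (proj2 (proj2 (proj1 Hmode t Ht))).
Let Dp t (Ht : ln a <= t <= ln b) := proj2 (proj2 (proj2 (proj1 Hmode t Ht))).

Lemma mode_energies :
  exists D S : R -> R, are_energies nu f g w D S /\ 0 <= D (ln b) /\ 0 < S (ln b).
Proof.
assert (Hl := ln_a_lt_ln_b).
destruct (antiderivative (fun t => g t ^ 2 + nu ^ 2 * f t ^ 2) (ln a) (ln b)) as [D [HD0 HD]]; [lra| |].
{ intros t Ht. apply (ex_derive_continuous (fun t => g t ^ 2 + nu ^ 2 * f t ^ 2)).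
  auto_derive. repeat split; eexists; [apply Dg|apply Df]; auto. }
destruct (antiderivative (fun t => exp (2 * t) * w t ^ 2) (ln a) (ln b)) as [S [HS0 HS]]; [lra| |].
{ intros t Ht. apply (ex_derive_continuous (fun t => exp (2 * t) * w t ^ 2)).
  auto_derive. repeat split; eexists; apply Dw; auto. }
exists D, S. split; [split; [auto|split; auto]|split].
- rewrite <- HD0. apply (is_derive_nondecreasing D (fun t => g t ^ 2 + nu ^ 2 * f t ^ 2)); auto; try lra.
  intros s Hs. generalize (pow2_ge_0 (g s)) (pow2_ge_0 (nu * f s)). nra.
- pose proof Hmode as (_ & _ & _ & t & Ht & Hwt).
  rewrite <- HS0. apply (antiderivative_pos S (fun t => exp (2 * t) * w t ^ 2) _ _ t); auto.
  + intros s Hs. apply Rmult_le_pos. left; apply exp_pos. apply pow2_ge_0.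
  + apply Rmult_lt_0_compat. apply exp_pos. apply pow2_gt_0; auto.
Qed.

(** The combination f p - g w - kappa f g + kappa D + S is constant along the system. The boundary
    conditions reduce it to - gam g^2 at [ln a] and to kappa D + S at [ln b]. *)
Lemma mode_energy_identity (D S : R -> R) :
  are_energies nu f g w D S ->
  kappa * D (ln b) = - S (ln b) - gam * g (ln a) ^ 2.
Proof.
intros (HD0 & HS0 & H). assert (Hl := ln_a_lt_ln_b).
pose proof Hmode as (_ & [Hfa Hfb] & [Hwb Hwa] & _).
assert (HX := is_derive_constant
  (fun t => f t * p t - g t * w t - kappa * (f t * g t) + kappa * D t + S t) (fun _ => 0) (ln a) (ln b)).
simpl in HX. rewrite Hfa, Hfb, Hwa, Hwb, HD0, HS0 in HX.
enough (0 * p (ln a) - g (ln a) * (gam * g (ln a)) - kappa * (0 * g (ln a)) + kappa * 0 + 0 =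
     0 * p (ln b) - g (ln b) * 0 - kappa * (0 * g (ln b)) + kappa * D (ln b) + S (ln b)) by lra.
apply HX; auto; [lra|].
intros t Ht. destruct (H t Ht) as [HD HS].
assert (H1 := Df t Ht). assert (H2 := Dg t Ht). assert (H3 := Dw t Ht). assert (H4 := Dp t Ht).
derive_fields.
rw_derive H1; rw_derive H2; rw_derive H3; rw_derive H4; rw_derive HD; rw_derive HS.
unfold coef. ring.
Qed.

(** The cutoff (ln b - t) / L multiplies g^2 - nu^2 f^2 rather than g^2: the derivative of this
    difference is 2 g e^{2t} w, free of nu, so the constants are the same for all modes. *)
Lemma mode_trace_bound (D S : R -> R) (eps : R) :
  0 < eps -> are_energies nu f g w D S ->
  g (ln a) ^ 2 <= eps * S (ln b) + (/ (ln b - ln a) + b ^ 2 / eps) * D (ln b).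
Proof.
intros Heps (HD0 & HS0 & H). assert (Hl := ln_a_lt_ln_b).
pose proof Hmode as (_ & [Hfa Hfb] & [Hwb Hwa] & _).
set (L := ln b - ln a).
assert (HL : 0 < L) by (unfold L; lra).
assert (HX := is_derive_nondecreasing
  (fun t => (ln b - t) / L * (g t ^ 2 - nu ^ 2 * f t ^ 2) + eps * S t + (/ L + b ^ 2 / eps) * D t)
  (fun t => - / L * (g t ^ 2 - nu ^ 2 * f t ^ 2) + 2 * ((ln b - t) / L) * g t * exp (2 * t) * w t
      + eps * (exp (2 * t) * w t ^ 2) + (/ L + b ^ 2 / eps) * (g t ^ 2 + nu ^ 2 * f t ^ 2)) (ln a) (ln b)).
simpl in HX. rewrite Hfa, Hfb, HD0, HS0 in HX.
replace (g (ln a) ^ 2) with ((ln b - ln a) / L * (g (ln a) * (g (ln a) * 1) - nu * (nu * 1) * (0 * (0 * 1))) + eps * 0 +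
       (/ L + b * (b * 1) / eps) * 0) by (unfold L; field; lra).
replace (eps * S (ln b) + (/ L + b ^ 2 / eps) * D (ln b)) with
 ((ln b - ln b) / L * (g (ln b) * (g (ln b) * 1) - nu * (nu * 1) * (0 * (0 * 1))) + eps * S (ln b) +
       (/ L + b * (b * 1) / eps) * D (ln b)) by (field; lra).
apply HX; [lra| |].
- intros t Ht. destruct (H t Ht) as [HD HS].
  assert (H1 := Df t Ht). assert (H2 := Dg t Ht).
  derive_fields.
  rw_derive H1; rw_derive H2; rw_derive HD; rw_derive HS.
  field. lra.
- intros t Ht. assert (He := exp2_bounds t Ht).
  assert (HE : 0 <= exp (2 * t)) by (left; apply exp_pos).
  set (m := (ln b - t) / L).
  assert (Hm : 0 <= m <= 1).
  { unfold m. split. apply Rcomplements.Rdiv_le_0_compat; lra.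
    apply Rmult_le_reg_r with L; auto. unfold Rdiv. rewrite Rmult_assoc, Rinv_l by lra. unfold L; lra. }
  assert (Hi : 0 < / L) by now apply Rinv_0_lt_compat.
  assert (Hie : 0 < / eps) by now apply Rinv_0_lt_compat.
  assert (Hsq : 0 <= exp (2 * t) * (eps * w t ^ 2 + 2 * m * g t * w t + g t ^ 2 / eps)).
  { apply Rmult_le_pos; auto.
    replace (eps * w t ^ 2 + 2 * m * g t * w t + g t ^ 2 / eps) with
      (eps * (w t + m * g t / eps) ^ 2 + (1 - m ^ 2) * (g t ^ 2 / eps)) by (field; lra).
    assert (0 <= g t ^ 2 / eps) by (apply Rmult_le_pos; [apply pow2_ge_0|lra]).
    assert (0 <= (1 - m ^ 2) * (g t ^ 2 / eps)) by (apply Rmult_le_pos; nra).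
    assert (0 <= eps * (w t + m * g t / eps) ^ 2) by (apply Rmult_le_pos; [lra|apply pow2_ge_0]).
    lra. }
  assert (0 <= (b ^ 2 - exp (2 * t)) * (g t ^ 2 / eps)).
  { apply Rmult_le_pos; [lra|]. apply Rmult_le_pos; [apply pow2_ge_0|lra]. }
  assert (0 <= (2 * / L + b ^ 2 / eps) * (nu ^ 2 * f t ^ 2)).
  { assert (0 <= b ^ 2 / eps) by (apply Rmult_le_pos; [apply pow2_ge_0|lra]).
    apply Rmult_le_pos; [lra|]. rewrite <- Rpow_mult_distr. apply pow2_ge_0. }
  unfold Rdiv in *. lra.
Qed.

(** The added term 2 c f g vanishes at both ends and turns the derivative into e^{2t} (w + c f)^2 +
    c g^2 + c (nu^2 - c e^{2t}) f^2, which is non-negative since c b^2 = nu^2 and e^{2t} <= b^2. *)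
Lemma mode_poincare (D S : R -> R) :
  are_energies nu f g w D S ->
  nu ^ 2 / b ^ 2 * D (ln b) <= S (ln b).
Proof.
intros (HD0 & HS0 & H). assert (Hl := ln_a_lt_ln_b).
pose proof Hmode as (_ & [Hfa Hfb] & _).
set (c := nu ^ 2 / b ^ 2).
assert (HX := is_derive_nondecreasing
  (fun t => S t - c * D t + 2 * c * (f t * g t))
  (fun t => exp (2 * t) * w t ^ 2 + c * (g t ^ 2 + nu ^ 2 * f t ^ 2) + 2 * c * exp (2 * t) * f t * w t) (ln a) (ln b)).
simpl in HX. rewrite Hfa, Hfb, HD0, HS0 in HX.
enough (0 - c * 0 + 2 * c * (0 * g (ln a)) <= S (ln b) - c * D (ln b) + 2 * c * (0 * g (ln b))) by lra.
apply HX; [lra| |].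
- intros t Ht. destruct (H t Ht) as [HD HS].
  assert (H1 := Df t Ht). assert (H2 := Dg t Ht).
  derive_fields.
  rw_derive H1; rw_derive H2; rw_derive HD; rw_derive HS.
  ring.
- intros t Ht. assert (He := exp2_bounds t Ht).
  assert (HE : 0 <= exp (2 * t)) by (left; apply exp_pos).
  assert (Hc : 0 <= c) by (apply Rmult_le_pos; [apply pow2_ge_0|left; apply Rinv_0_lt_compat, pow_lt; lra]).
  assert (Hn : nu ^ 2 = c * b ^ 2) by (unfold c; field; lra).
  assert (0 <= c * ((b ^ 2 - exp (2 * t)) * (c * f t ^ 2))).
  { apply Rmult_le_pos; auto. apply Rmult_le_pos; [lra|].
    apply Rmult_le_pos; [auto|apply pow2_ge_0]. }
  assert (0 <= exp (2 * t) * (w t + c * f t) ^ 2) by (apply Rmult_le_pos; auto; apply pow2_ge_0).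
  assert (0 <= c * g t ^ 2) by (apply Rmult_le_pos; auto; apply pow2_ge_0).
  simpl (nu * (nu * 1)). replace (nu * (nu * 1)) with (c * b ^ 2) by (rewrite <- Hn; ring).
  lra.
Qed.

Definition mode_bound (G : R) : R := G * (/ (ln b - ln a) + 2 * G * b ^ 2).

(** With eps = 1 / (2 G) in the trace bound, the boundary term costs half of the enstrophy; the
    other half yields nu^2 / (2 b^2) through the Poincare inequality. *)
Lemma mode_upper_bound (G : R) :
  0 < G -> Rabs gam <= G -> kappa <= mode_bound G - nu ^ 2 / (2 * b ^ 2).
Proof.
intros HG Hgam.
destruct mode_energies as (D & S & H & HD & HS).
assert (Hid := mode_energy_identity D S H).
assert (Hp := mode_poincare D S H).
assert (Htr := mode_trace_bound D S (/ (2 * G)) ltac:(apply Rinv_0_lt_compat; lra) H).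
assert (Hg : - gam * g (ln a) ^ 2 <= G * g (ln a) ^ 2).
{ apply Rmult_le_compat_r. apply pow2_ge_0. apply Rabs_le_between in Hgam; lra. }
assert (Hg2 : G * g (ln a) ^ 2 <= S (ln b) / 2 + mode_bound G * D (ln b)).
{ unfold mode_bound. apply Rle_trans with (1 := Rmult_le_compat_l G _ _ (Rlt_le _ _ HG) Htr). right. field. split; [|lra].
  generalize ln_a_lt_ln_b; lra. }
assert (Hk : kappa * D (ln b) <= mode_bound G * D (ln b) - S (ln b) / 2) by lra.
assert (HDpos : 0 < D (ln b)).
{ destruct HD as [HD|HD]; auto. rewrite <- HD in Hk. lra. }
apply Rmult_le_reg_r with (D (ln b)); auto.
replace ((mode_bound G - nu ^ 2 / (2 * b ^ 2)) * D (ln b)) with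
  (mode_bound G * D (ln b) - nu ^ 2 / b ^ 2 * D (ln b) / 2) by (field; lra).
lra.
Qed.


End Energy.

(** The trace functional [f => f'(ln a)] for [f] vanishing at both ends is
    represented by pairing [f'' - f] with [- harm1]. *)
Definition harm1 (t : R) : R := (b * exp (- t) - exp t / b) / (b / a - a / b).
Definition harm1' (t : R) : R := (- b * exp (- t) - exp t / b) / (b / a - a / b).
(** Expanding e^{2t} (b e^{-t} - e^t / b)^2 leaves a constant b^2, whose primitive b^2 t becomes the
    logarithm in [mu_crit]. *)
Definition harm1_energy_primitive (t : R) : R :=
  (b ^ 2 * t - exp (2 * t) + exp (4 * t) / (4 * b ^ 2)) / (b / a - a / b) ^ 2.
Definition harm1_energy : R := harm1_energy_primitive (ln b) - harm1_energy_primitive (ln a).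

Lemma square_gap : 0 < b * b - a * a.
Proof. replace (b * b - a * a) with ((b - a) * (b + a)) by ring. apply Rmult_lt_0_compat; lra. Qed.

Lemma harm1_denom_pos : 0 < b / a - a / b.
Proof.
replace (b / a - a / b) with ((b - a) * (b + a) / (a * b)) by (field; lra).
apply Rdiv_lt_0_compat; apply Rmult_lt_0_compat; lra.
Qed.

Lemma harm1_a : harm1 (ln a) = 1.
Proof.
unfold harm1. rewrite exp_Ropp, exp_ln by lra. assert (Hsq := square_gap). field. repeat split; lra.
Qed.

Lemma harm1_b : harm1 (ln b) = 0.
Proof.
unfold harm1. rewrite exp_Ropp, exp_ln by lra. assert (Hsq := square_gap). field. repeat split; lra.
Qed.

Lemma is_derive_harm1 (t : R) : is_derive harm1 t (harm1' t).
Proof. unfold harm1, harm1'. assert (Hsq := square_gap). auto_derive; auto. field. repeat split; lra. Qed.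

Lemma is_derive_harm1' (t : R) : is_derive harm1' t (harm1 t).
Proof. unfold harm1, harm1'. assert (Hsq := square_gap). auto_derive; auto. field. repeat split; lra. Qed.

Lemma is_derive_harm1_energy_primitive (t : R) : is_derive harm1_energy_primitive t (exp (2 * t) * harm1 t ^ 2).
Proof.
unfold harm1, harm1_energy_primitive. generalize harm1_denom_pos; intros Hd. auto_derive; auto.
replace (exp (2 * t)) with (exp t ^ 2) by (simpl; rewrite Rmult_1_r, <- exp_plus; f_equal; ring).
replace (exp (4 * t)) with (exp t ^ 4) by (simpl; rewrite Rmult_1_r, <- !exp_plus; f_equal; ring).
rewrite exp_Ropp. assert (Hsq := square_gap). field. repeat split; try lra. apply Rgt_not_eq, exp_pos.
Qed.

Lemma harm1_energy_pos : 0 < harm1_energy.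
Proof.
assert (Hl := ln_a_lt_ln_b). unfold harm1_energy.
enough (harm1_energy_primitive (ln a) < harm1_energy_primitive (ln b)) by lra.
assert (Hnz : harm1 ((ln a + ln b) / 2) <> 0).
{ intros H. unfold harm1 in H. generalize harm1_denom_pos; intros Hd.
  set (t := (ln a + ln b) / 2) in *.
  apply (Rmult_eq_compat_r ((b / a - a / b) * (b * exp t))) in H.
  assert (Ht := exp_pos t).
  assert (Hlt : exp t < b).
  { rewrite <- (exp_ln b) by lra. apply exp_increasing. unfold t; lra. }
  replace ((b * exp (- t) - exp t / b) / (b / a - a / b) * ((b / a - a / b) * (b * exp t))) with
    (b ^ 2 - exp t ^ 2) in H.
  - nra.
  - rewrite exp_Ropp. assert (Hsq := square_gap). field. repeat split; lra. }
apply (antiderivative_pos harm1_energy_primitive (fun t => exp (2 * t) * harm1 t ^ 2) _ _ ((ln a + ln b) / 2)); [|  |lra|].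
- intros s _. apply is_derive_harm1_energy_primitive.
- intros s _. apply Rmult_le_pos. left; apply exp_pos. apply pow2_ge_0.
- apply Rmult_lt_0_compat. apply exp_pos. now apply pow2_gt_0.
Qed.

Section Stable.
Variables nu kappa gam : R.
Variables f g w p : R -> R.
Hypothesis Hmode : is_mode nu kappa gam f g w p.
Hypothesis Hnu : 1 <= nu.

(** Comparison with [nu = 1]: passing from [f'' - nu^2 f] to [f'' - f] can only decrease the
    weighted norm, by [2 (nu^2 - 1) int e^{-2t} (g - f)^2 + (nu^2 - 1)^2 int e^{-2t} f^2]. *)
Lemma mode_sharp_trace (D S : R -> R) :
  are_energies nu f g w D S ->
  g (ln a) ^ 2 <= harm1_energy * S (ln b).
Proof.
intros (HD0 & HS0 & H). assert (Hl := ln_a_lt_ln_b).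
pose proof Hmode as (Hode & [Hfa Hfb] & _).
(* [s] minimises S - 2 s g + s^2 H, with g taken at [ln a] and H = [harm1_energy]; non-negativity at
   the minimum is the claim. *)
set (s := g (ln a) / harm1_energy). set (c := nu ^ 2 - 1).
assert (Hc : 0 <= c) by (unfold c; nra).
assert (HH := harm1_energy_pos).
(* The term 2 c e^{-2t} f g vanishes at both ends; it completes the square of w + c e^{-2t} f + s
   harm1, that is of e^{-2t} (f'' - f) + s harm1. *)
assert (HX := is_derive_nondecreasing
  (fun t => S t + 2 * c * (exp (- (2 * t)) * (f t * g t)) + 2 * s * (g t * harm1 t - f t * harm1' t) + s ^ 2 * harm1_energy_primitive t)
  (fun t => exp (2 * t) * (w t + c * exp (- (2 * t)) * f t + s * harm1 t) ^ 2 +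
     c * exp (- (2 * t)) * (2 * (g t - f t) ^ 2 + c * f t ^ 2)) (ln a) (ln b)).
cbv beta in HX. rewrite Hfa, Hfb, HS0, harm1_a, harm1_b in HX.
assert (Hle : 0 <= S (ln b) - 2 * s * g (ln a) + s ^ 2 * harm1_energy).
{ unfold harm1_energy. enough (0 + 2 * c * (exp (- (2 * ln a)) * (0 * g (ln a))) + 2 * s * (g (ln a) * 1 - 0 * harm1' (ln a)) +
     s ^ 2 * harm1_energy_primitive (ln a) <=
     S (ln b) + 2 * c * (exp (- (2 * ln b)) * (0 * g (ln b))) + 2 * s * (g (ln b) * 0 - 0 * harm1' (ln b)) +
     s ^ 2 * harm1_energy_primitive (ln b)) by lra.
  apply HX; [lra| |].
  - intros t Ht. destruct (H t Ht) as [HD HS]. destruct (Hode t Ht) as (D1 & D2 & _).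
    assert (D3 := is_derive_harm1 t). assert (D4 := is_derive_harm1' t). assert (D5 := is_derive_harm1_energy_primitive t).
    derive_fields.
    rw_derive D1; rw_derive D2; rw_derive D3; rw_derive D4; rw_derive D5; rw_derive HS.
    rewrite !exp_Ropp. unfold c. field. apply Rgt_not_eq, exp_pos.
  - intros t Ht.
    apply Rplus_le_le_0_compat.
    + apply Rmult_le_pos; [left; apply exp_pos|apply pow2_ge_0].
    + apply Rmult_le_pos; [apply Rmult_le_pos; [auto|left; apply exp_pos]|].
      apply Rplus_le_le_0_compat; apply Rmult_le_pos; try lra; apply pow2_ge_0. }
replace (S (ln b) - 2 * s * g (ln a) + s ^ 2 * harm1_energy) with (S (ln b) - g (ln a) ^ 2 / harm1_energy) in Hle
  by (unfold s; field; lra).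
apply Rmult_le_reg_r with (/ harm1_energy). now apply Rinv_0_lt_compat.
replace (harm1_energy * S (ln b) * / harm1_energy) with (S (ln b)) by (field; lra). unfold Rdiv in Hle. lra.
Qed.

(** The bound is uniform in nu >= 1, so the supremum over all modes stays strictly negative. For gam
    >= 0 the boundary term has the favourable sign, which gives the 1 in the minimum; for gam < 0
    the sharp trace inequality replaces it by - gam H S. *)
Lemma mode_stable_bound :
  0 < 1 + gam * harm1_energy -> kappa <= - Rmin 1 (1 + gam * harm1_energy) / b ^ 2.
Proof.
intros Hst.
destruct (mode_energies _ _ _ _ _ _ _ Hmode) as (D & S & H & HD & HS).
assert (Hid := mode_energy_identity _ _ _ _ _ _ _ Hmode D S H).
assert (Hp := mode_poincare _ _ _ _ _ _ _ Hmode D S H).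
assert (Htr := mode_sharp_trace D S H).
set (dl := Rmin 1 (1 + gam * harm1_energy)).
assert (Hdl : 0 < dl) by (apply Rmin_pos; lra).
assert (Hk : kappa * D (ln b) <= - dl * S (ln b)).
{ destruct (Rle_lt_dec 0 gam) as [Hg|Hg].
  - assert (dl <= 1) by apply Rmin_l.
    generalize (pow2_ge_0 (g (ln a))). nra.
  - assert (dl <= 1 + gam * harm1_energy) by apply Rmin_r.
    assert (- gam * g (ln a) ^ 2 <= - gam * (harm1_energy * S (ln b))) by (apply Rmult_le_compat_l; lra).
    nra. }
assert (HDpos : 0 < D (ln b)).
{ destruct HD as [HD|HD]; auto. rewrite <- HD in Hk. nra. }
assert (Hb2 : 0 < / b ^ 2) by (apply Rinv_0_lt_compat, pow_lt; lra).
assert (Hp' : D (ln b) / b ^ 2 <= S (ln b)).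
{ eapply Rle_trans; [|exact Hp]. unfold Rdiv. rewrite (Rmult_comm (D _)). apply Rmult_le_compat_r; auto.
  replace (nu ^ 2 * / b ^ 2) with (/ b ^ 2 + (nu ^ 2 - 1) * / b ^ 2) by ring.
  assert (0 <= nu ^ 2 - 1) by nra. assert (0 <= (nu ^ 2 - 1) * / b ^ 2) by (apply Rmult_le_pos; lra). lra. }
apply Rmult_le_reg_r with (D (ln b)); auto.
apply Rle_trans with (1 := Hk).
replace (- dl / b ^ 2 * D (ln b)) with (- dl * (D (ln b) / b ^ 2)) by (field; lra).
nra.
Qed.
End Stable.
End Modes.

(** * The characteristic function of a mode and the spectrum *)

Lemma coef_cont (nu kappa t : R) : continuous (coef nu kappa) t.
Proof. apply (ex_derive_continuous (coef nu kappa)). unfold coef. auto_derive; auto. Qed.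

Lemma continuous_zero_right (f : R -> R) (u v : R) :
  u < v -> continuous f v -> (forall t, u < t < v -> f t = 0) -> f v = 0.
Proof.
intros Huv Hc H0. destruct (Req_dec (f v) 0) as [|Hne]; auto. exfalso.
assert (He : 0 < Rabs (f v)) by now apply Rabs_pos_lt.
destruct (Hc (ball (f v) (Rabs (f v)))) as [d Hd].
{ exists (mkposreal _ He). auto. }
set (t := v - Rmin (d / 2) ((v - u) / 2)).
assert (H1 : 0 < Rmin (d / 2) ((v - u) / 2)).
{ apply Rmin_pos; [|lra]. generalize (cond_pos d); lra. }
assert (H2 := Rmin_l (d / 2) ((v - u) / 2)). assert (H3 := Rmin_r (d / 2) ((v - u) / 2)).
assert (Ht : ball v d t).
{ change (Rabs (t - v) < d). unfold t. rewrite Rabs_left; generalize (cond_pos d); lra. }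
specialize (Hd t Ht). change (Rabs (f t - f v) < Rabs (f v)) in Hd.
rewrite H0 in Hd by (unfold t; lra). rewrite Rminus_0_l, Rabs_Ropp in Hd. lra.
Qed.

Lemma is_derive_interior_zero (f : R -> R) (u v t l : R) :
  (forall s, u < s < v -> f s = 0) -> u < t < v -> is_derive f t l -> l = 0.
Proof.
intros H0 Ht Hd.
rewrite <- (is_derive_unique _ _ _ Hd). apply is_derive_unique.
apply (is_derive_ext_loc (fun _ => 0)).
- assert (Hr : 0 < Rmin (t - u) (v - t)) by (apply Rmin_pos; lra).
  exists (mkposreal _ Hr). intros y Hy. change (Rabs (y - t) < Rmin (t - u) (v - t)) in Hy.
  symmetry. apply H0. apply Rabs_lt_between in Hy.
  generalize (Rmin_l (t - u) (v - t)) (Rmin_r (t - u) (v - t)). lra.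
- exact (is_derive_const 0 t).
Qed.

Section Characteristic.
Variables a b : R.
Hypothesis Ha : 0 < a.
Hypothesis Hab : a < b.

Let Hl : ln a < ln b := ln_a_lt_ln_b a b Ha Hab.

(** A quotient of hyperbolic sines: the solution of h'' = nu^2 h with values 1 at [ln a] and 0 at
    [ln b], the radial profile of a harmonic function of angular frequency nu. *)
Definition harm (nu t : R) : R :=
  (exp (nu * (ln b - t)) - exp (- (nu * (ln b - t)))) /
  (exp (nu * (ln b - ln a)) - exp (- (nu * (ln b - ln a)))).
Definition harm' (nu t : R) : R :=
  - nu * (exp (nu * (ln b - t)) + exp (- (nu * (ln b - t)))) /
  (exp (nu * (ln b - ln a)) - exp (- (nu * (ln b - ln a)))).

Lemma harm_denom_pos (nu : R) : 0 < nu ->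
  0 < exp (nu * (ln b - ln a)) - exp (- (nu * (ln b - ln a))).
Proof. intros Hnu. assert (0 < nu * (ln b - ln a)) by (apply Rmult_lt_0_compat; lra).
apply Rlt_0_minus, exp_increasing. lra. Qed.

Lemma harm_a (nu : R) : 0 < nu -> harm nu (ln a) = 1.
Proof. intros Hnu. assert (H := harm_denom_pos nu Hnu). unfold harm. field. lra. Qed.

Lemma harm_b (nu : R) : harm nu (ln b) = 0.
Proof. unfold harm. rewrite Rminus_diag, Rmult_0_r, Ropp_0. unfold Rdiv. ring. Qed.

Lemma is_derive_harm (nu t : R) : 0 < nu -> is_derive (harm nu) t (harm' nu t).
Proof.
intros Hnu. assert (H := harm_denom_pos nu Hnu). unfold harm, harm'.
auto_derive; auto. unfold Rminus. field. unfold Rminus in H. lra.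
Qed.

Lemma is_derive_harm' (nu t : R) : 0 < nu -> is_derive (harm' nu) t (nu ^ 2 * harm nu t).
Proof.
intros Hnu. assert (H := harm_denom_pos nu Hnu). unfold harm, harm'.
auto_derive; auto. unfold Rminus. field. unfold Rminus in H. lra.
Qed.

Lemma harm_1 (t : R) : harm 1 t = harm1 a b t.
Proof.
unfold harm, harm1. rewrite !Rmult_1_l. unfold Rminus.
rewrite !Ropp_plus_distr, !exp_plus, !Ropp_involutive, !exp_Ropp, !exp_ln by lra.
assert (Hsq := square_gap a b Ha Hab). field. repeat split; try lra. apply Rgt_not_eq, exp_pos.
Qed.

(** Shooting from the outer circle: the vorticity with value 0 and slope -1 at [ln b]. The vorticity
    of every mode is a multiple of it, so only the condition at [ln a] remains to be tested. *)
Definition fund (nu kappa : R) : R -> R := ode_value (coef nu kappa) (ln b) 0 (-1).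
Definition fund' (nu kappa : R) : R -> R := ode_slope (coef nu kappa) (ln b) 0 (-1).

Lemma is_derive_fund (nu kappa t : R) : is_derive (fund nu kappa) t (fund' nu kappa t).
Proof. apply linear_ode. intros; apply coef_cont. Qed.
Lemma is_derive_fund' (nu kappa t : R) :
  is_derive (fund' nu kappa) t (coef nu kappa t * fund nu kappa t).
Proof. apply linear_ode. intros; apply coef_cont. Qed.
Lemma fund_b (nu kappa : R) : fund nu kappa (ln b) = 0.
Proof. apply linear_ode. intros; apply coef_cont. Qed.
Lemma fund'_b (nu kappa : R) : fund' nu kappa (ln b) = -1.
Proof. apply linear_ode. intros; apply coef_cont. Qed.

Lemma coef_bound (nu kappa t : R) : ln a <= t <= ln b -> Rabs (coef nu kappa t) <= nu ^ 2 + Rabs kappa * b ^ 2.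
Proof.
intros Ht. assert (He := exp2_bounds a b Ha Hab t Ht). assert (Hp := exp_pos (2 * t)).
unfold coef. eapply Rle_trans; [apply Rabs_triang|].
rewrite (Rabs_pos_eq (nu ^ 2)) by apply pow2_ge_0. apply Rplus_le_compat_l.
rewrite Rabs_mult, (Rabs_pos_eq (exp _)) by lra. apply Rmult_le_compat_l; [apply Rabs_pos|lra].
Qed.

Lemma fund_unique (nu kappa c : R) (w p : R -> R) :
  (forall t, ln a <= t <= ln b -> is_derive w t (p t) /\ is_derive p t (coef nu kappa t * w t)) ->
  w (ln b) = 0 -> p (ln b) = - c ->
  forall t, ln a <= t <= ln b -> w t = c * fund nu kappa t /\ p t = c * fund' nu kappa t.
Proof.
intros Hw Hwb Hpb t Ht.
assert (H := linear_ode_bound (fun t => w t - c * fund nu kappa t) (fun t => p t - c * fund' nu kappa t)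
  (coef nu kappa) (fun _ => 0) (ln a) (ln b) (nu ^ 2 + Rabs kappa * b ^ 2) 0).
simpl in H. rewrite Hwb, Hpb, fund_b, fund'_b in H.
assert (HH : (w t - c * fund nu kappa t) ^ 2 + (p t - c * fund' nu kappa t) ^ 2 <= 0).
{ eapply Rle_trans; [apply H|]; auto; try ring.
  - intros s Hs. destruct (Hw s Hs) as [H1 H2]. assert (H3 := is_derive_fund nu kappa s).
    derive_fields. rw_derive H1; rw_derive H3. ring.
  - intros s Hs. destruct (Hw s Hs) as [H1 H2]. assert (H3 := is_derive_fund' nu kappa s).
    derive_fields. rw_derive H2; rw_derive H3. ring.
  - intros s Hs. now apply coef_bound.
  - intros s Hs. rewrite Rabs_R0. lra.
  - right; ring. }
generalize (pow2_ge_0 (w t - c * fund nu kappa t)) (pow2_ge_0 (p t - c * fund' nu kappa t)). intros H3 H4.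
assert (H5 : (w t - c * fund nu kappa t) ^ 2 = 0) by lra.
assert (H6 : (p t - c * fund' nu kappa t) ^ 2 = 0) by lra.
assert (H7 : forall x : R, x ^ 2 = 0 -> x = 0) by (intros x Hx; nra).
apply H7 in H5. apply H7 in H6. lra.
Qed.

Definition pairing (nu kappa : R) : R :=
  RInt (fun t => fund nu kappa t * harm nu t * exp (2 * t)) (ln a) (ln b).

(** The zeros in [kappa] of [charac nu gam] are the eigenvalues of [mode_eigenvalue]: the boundary
    condition at [ln a] is [w = gam f'], and [- f' (ln a)] is the pairing of [w] with [harm]. *)
Definition charac (nu gam kappa : R) : R := fund nu kappa (ln a) + gam * pairing nu kappa.

Lemma pairing_integrable (nu kappa : R) (u v : R) : 0 < nu ->
  ex_RInt (fun t => fund nu kappa t * harm nu t * exp (2 * t)) u v.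
Proof.
intros Hnu. apply (@ex_RInt_continuous R_CompleteNormedModule). intros t _.
apply (ex_derive_continuous (fun t => fund nu kappa t * harm nu t * exp (2 * t))).
assert (H1 := is_derive_fund nu kappa t). assert (H2 := is_derive_harm nu t Hnu).
derive_fields.
Qed.

Lemma pairing_primitive (nu kappa c : R) (F : R -> R) : 0 < nu ->
  (forall t, ln a <= t <= ln b -> is_derive F t (c * (fund nu kappa t * harm nu t * exp (2 * t)))) ->
  F (ln b) - F (ln a) = c * pairing nu kappa.
Proof.
intros Hnu HF.
set (phi := fun t => fund nu kappa t * harm nu t * exp (2 * t)) in HF.
assert (H : is_RInt (fun t => c * phi t) (ln a) (ln b) (F (ln b) - F (ln a))).
{ apply is_RInt_FTC; rewrite Rmin_left, Rmax_right by lra; auto.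
  intros t _. apply (ex_derive_continuous (fun t => c * phi t)). unfold phi.
  assert (H1 := is_derive_fund nu kappa t). assert (H2 := is_derive_harm nu t Hnu).
  derive_fields. }
rewrite <- (is_RInt_unique _ _ _ _ H).
apply (RInt_scal (V := R_CompleteNormedModule) phi). now apply pairing_integrable.
Qed.

(** The vorticity is c times [fund], and Green's identity with [harm] eliminates f, leaving c times
    the pairing equal to - g (ln a). Since w is not identically zero, c can be cancelled. *)
Lemma mode_charac (nu kappa gam : R) : 0 < nu ->
  mode_eigenvalue a b nu kappa gam -> charac nu gam kappa = 0.
Proof.
intros Hnu (f & g & w & p & Hode & [Hfa Hfb] & [Hwb Hwa] & t0 & Ht0 & Hne).
assert (Hw := fund_unique nu kappa (- p (ln b)) w p).
set (c := - p (ln b)) in *.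
assert (Hw' : forall t, ln a <= t <= ln b -> w t = c * fund nu kappa t).
{ intros t Ht. apply Hw; auto. intros s Hs. destruct (Hode s Hs) as (_ & _ & ? & ?); auto. unfold c; ring. }
assert (Hc : c <> 0).
{ intros H. apply Hne. rewrite Hw', H by lra. ring. }
assert (HP : c * pairing nu kappa = - g (ln a)).
{ rewrite <- (pairing_primitive nu kappa c (fun t => g t * harm nu t - f t * harm' nu t) Hnu).
  - rewrite harm_b, harm_a, Hfa, Hfb by auto. ring.
  - intros t Ht. destruct (Hode t Ht) as (D1 & D2 & _).
    assert (D3 := is_derive_harm nu t Hnu). assert (D4 := is_derive_harm' nu t Hnu).
    derive_fields. rw_derive D1; rw_derive D2; rw_derive D3; rw_derive D4. rewrite Hw' by auto. ring. }
apply Rmult_eq_reg_l with c; auto. unfold charac.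
rewrite Rmult_plus_distr_l, <- Hw' by lra.
replace (c * (gam * pairing nu kappa)) with (gam * (c * pairing nu kappa)) by ring.
rewrite HP, Hwa. ring.
Qed.

(** Otherwise [fund'] would vanish inside and, by continuity, at [ln b], where it is -1. *)
Lemma fund_nontrivial (nu kappa : R) : exists t, ln a < t < ln b /\ fund nu kappa t <> 0.
Proof.
destruct (Classical_Prop.classic (exists t, ln a < t < ln b /\ fund nu kappa t <> 0)) as [|Hn]; auto.
assert (H0 : forall t, ln a < t < ln b -> fund nu kappa t = 0).
{ intros t Ht. destruct (Req_dec (fund nu kappa t) 0); auto. exfalso; eauto. }
assert (H1 : fund' nu kappa (ln b) = 0).
{ apply (continuous_zero_right _ (ln a)); auto.
  - eapply is_derive_cont, is_derive_fund'.
  - intros t Ht. eapply is_derive_interior_zero; [exact H0|exact Ht|apply is_derive_fund]. }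
rewrite fund'_b in H1. lra.
Qed.

(** As the vorticity satisfies Delta w = kappa w, dividing it by kappa inverts the Laplacian; the
    harmonic correction restores the value 0 at [ln a]. Here kappa = 0 has to be excluded. *)
Definition stream (nu kappa t : R) : R :=
  (fund nu kappa t - fund nu kappa (ln a) * harm nu t) / kappa.
Definition stream' (nu kappa t : R) : R :=
  (fund' nu kappa t - fund nu kappa (ln a) * harm' nu t) / kappa.

Lemma is_derive_stream (nu kappa t : R) : 0 < nu -> kappa <> 0 ->
  is_derive (stream nu kappa) t (stream' nu kappa t).
Proof.
intros Hnu Hk. unfold stream, stream'.
assert (D1 := is_derive_fund nu kappa t). assert (D3 := is_derive_harm nu t Hnu).
derive_fields. rw_derive D1; rw_derive D3. field; auto.
Qed.

Lemma is_derive_stream' (nu kappa t : R) : 0 < nu -> kappa <> 0 ->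
  is_derive (stream' nu kappa) t (nu ^ 2 * stream nu kappa t + exp (2 * t) * fund nu kappa t).
Proof.
intros Hnu Hk. unfold stream, stream'.
assert (D1 := is_derive_fund' nu kappa t). assert (D3 := is_derive_harm' nu t Hnu).
derive_fields. rw_derive D1; rw_derive D3. unfold coef. field; auto.
Qed.

Lemma stream_a (nu kappa : R) : 0 < nu -> stream nu kappa (ln a) = 0.
Proof. intros Hnu. unfold stream. rewrite harm_a by auto. unfold Rdiv; ring. Qed.
Lemma stream_b (nu kappa : R) : stream nu kappa (ln b) = 0.
Proof. unfold stream. rewrite harm_b, fund_b. unfold Rdiv; ring. Qed.

Lemma stream'_a (nu kappa : R) : 0 < nu -> kappa <> 0 -> stream' nu kappa (ln a) = - pairing nu kappa.
Proof.
intros Hnu Hk.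
rewrite <- (Rmult_1_l (pairing nu kappa)).
rewrite <- (pairing_primitive nu kappa 1 (fun t => stream' nu kappa t * harm nu t - stream nu kappa t * harm' nu t) Hnu).
- rewrite harm_b, harm_a, stream_a, stream_b by auto. ring.
- intros t Ht.
  assert (D1 := is_derive_stream nu kappa t Hnu Hk). assert (D2 := is_derive_stream' nu kappa t Hnu Hk).
  assert (D3 := is_derive_harm nu t Hnu). assert (D4 := is_derive_harm' nu t Hnu).
  derive_fields. rw_derive D1; rw_derive D2; rw_derive D3; rw_derive D4. ring.
Qed.

Lemma charac_boundary (nu kappa gam : R) : 0 < nu -> kappa <> 0 -> charac nu gam kappa = 0 ->
  fund nu kappa (ln a) = gam * stream' nu kappa (ln a).
Proof. intros Hnu Hk H. rewrite stream'_a by auto. unfold charac in H. lra. Qed.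

Lemma charac_mode (nu kappa gam : R) : 0 < nu -> kappa <> 0 -> charac nu gam kappa = 0 ->
  mode_eigenvalue a b nu kappa gam.
Proof.
intros Hnu Hk H.
exists (stream nu kappa), (stream' nu kappa), (fund nu kappa), (fund' nu kappa).
split; [|split; [|split]].
- intros t Ht. split; [|split; [|split]].
  now apply is_derive_stream. now apply is_derive_stream'. apply is_derive_fund. apply is_derive_fund'.
- split. now apply stream_a. apply stream_b.
- split. apply fund_b. now apply charac_boundary.
- apply fund_nontrivial.
Qed.

(** The difference of the two solutions has zero data at [ln b] and solves the equation for [k] with
    forcing (k - k0) e^{2t} fund, where [fund] is taken at [k0]. *)
Lemma fund_lipschitz (nu k0 : R) : exists C, forall k, Rabs (k - k0) <= 1 ->
  forall t, ln a <= t <= ln b -> Rabs (fund nu k t - fund nu k0 t) <= C * Rabs (k - k0).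
Proof.
destruct (continuity_ab_maj (fun t => Rabs (fund nu k0 t)) (ln a) (ln b)) as [tm [Htm _]].
{ lra. }
{ intros c _. apply continuous_pt, (continuous_comp (fund nu k0) Rabs).
  eapply is_derive_cont, is_derive_fund. apply continuous_Rabs. }
set (Y := Rabs (fund nu k0 tm)) in *. cbv beta in Htm. fold Y in Htm.
set (M := nu ^ 2 + (Rabs k0 + 1) * b ^ 2).
assert (HY : 0 <= Y) by apply Rabs_pos.
set (X := exp ((M + 2) * (ln b - ln a))).
(* The estimate bounds a square by a multiple of X; X + 1 dominates the square root of X. *)
exists (b ^ 2 * Y * (X + 1)). intros k Hk t Ht.
assert (Hb2 : 0 < b ^ 2) by (apply pow_lt; lra).
assert (HX : 0 < X) by apply exp_pos.
set (dk := Rabs (k - k0)) in *. assert (Hdk : 0 <= dk) by apply Rabs_pos.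
assert (H := linear_ode_bound (fun t => fund nu k t - fund nu k0 t) (fun t => fund' nu k t - fund' nu k0 t)
  (coef nu k) (fun t => (k - k0) * exp (2 * t) * fund nu k0 t) (ln a) (ln b) M (dk * b ^ 2 * Y)).
cbv beta in H. rewrite !fund_b, !fund'_b in H.
assert (HH : (fund nu k t - fund nu k0 t) ^ 2 + (fund' nu k t - fund' nu k0 t) ^ 2 <= (dk * b ^ 2 * Y) ^ 2 * X).
{ apply H; auto; try ring.
  - intros s Hs. apply (is_derive_minus (fund nu k) (fund nu k0)); apply is_derive_fund.
  - intros s Hs. assert (D1 := is_derive_fund' nu k s). assert (D2 := is_derive_fund' nu k0 s).
    derive_fields. rw_derive D1; rw_derive D2. unfold coef. ring.
  - intros s Hs. eapply Rle_trans; [now apply coef_bound|]. unfold M. apply Rplus_le_compat_l, Rmult_le_compat_r; [lra|].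
    replace k with (k0 + (k - k0)) by ring. eapply Rle_trans; [apply Rabs_triang|]. fold dk; lra.
  - intros s Hs. assert (He := exp2_bounds a b Ha Hab s Hs). assert (Hp := exp_pos (2 * s)).
    rewrite !Rabs_mult. fold dk. rewrite (Rabs_pos_eq (exp _)) by lra.
    apply Rmult_le_compat; [apply Rmult_le_pos; lra|apply Rabs_pos| |now apply Htm].
    apply Rmult_le_compat_l; lra. }
set (A := dk * b ^ 2 * Y) in *.
assert (HA : 0 <= A) by (unfold A; repeat apply Rmult_le_pos; lra).
replace (b ^ 2 * Y * (X + 1) * dk) with (A * (X + 1)) by (unfold A; ring).
rewrite <- (Rabs_pos_eq (A * (X + 1))) by (apply Rmult_le_pos; lra).
apply Rsqr_le_abs_0. rewrite !Rsqr_pow2, Rpow_mult_distr.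
apply Rle_trans with (A ^ 2 * X).
- generalize (pow2_ge_0 (fund' nu k t - fund' nu k0 t)). lra.
- apply Rmult_le_compat_l. apply pow2_ge_0. nra.
Qed.

Lemma charac_continuous (nu gam k0 : R) : 0 < nu -> continuity_pt (charac nu gam) k0.
Proof.
intros Hnu.
destruct (fund_lipschitz nu k0) as [C HC].
destruct (continuity_ab_maj (fun t => Rabs (harm nu t)) (ln a) (ln b)) as [tm [Htm _]].
{ lra. }
{ intros c _. apply continuous_pt, (continuous_comp (harm nu) Rabs).
  eapply is_derive_cont, is_derive_harm; auto. apply continuous_Rabs. }
set (Y := Rabs (harm nu tm)) in *. cbv beta in Htm. fold Y in Htm.
assert (HY : 0 <= Y) by apply Rabs_pos.
assert (Hb2 : 0 < b ^ 2) by (apply pow_lt; lra).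
set (K := C + Rabs gam * ((ln b - ln a) * (C * Y * b ^ 2))).
assert (HK : forall k, Rabs (k - k0) <= 1 -> Rabs (charac nu gam k - charac nu gam k0) <= K * Rabs (k - k0)).
{ intros k Hk. specialize (HC k Hk).
  assert (HP : Rabs (pairing nu k - pairing nu k0) <= (ln b - ln a) * (C * Rabs (k - k0) * Y * b ^ 2)).
  { unfold pairing. change (RInt ?f ?u ?v - RInt ?g ?u ?v) with (minus (RInt f u v) (RInt g u v)).
    rewrite <- (RInt_minus (V := R_CompleteNormedModule)) by now apply pairing_integrable.
    apply abs_RInt_le_const; [lra| |].
    - apply (ex_RInt_minus (V := R_CompleteNormedModule)); now apply pairing_integrable.
    - intros t Ht. unfold minus, plus, opp; simpl.
      replace (fund nu k t * harm nu t * exp (2 * t) + - (fund nu k0 t * harm nu t * exp (2 * t))) with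
        ((fund nu k t - fund nu k0 t) * harm nu t * exp (2 * t)) by ring.
      assert (He := exp2_bounds a b Ha Hab t Ht). assert (Hp := exp_pos (2 * t)).
      rewrite !Rabs_mult, (Rabs_pos_eq (exp _)) by lra. simpl in He.
      repeat apply Rmult_le_compat; try apply Rabs_pos; auto; try lra.
      apply Rmult_le_pos; apply Rabs_pos. }
  unfold charac, K.
  replace (fund nu k (ln a) + gam * pairing nu k - (fund nu k0 (ln a) + gam * pairing nu k0)) with
    ((fund nu k (ln a) - fund nu k0 (ln a)) + gam * (pairing nu k - pairing nu k0)) by ring.
  eapply Rle_trans; [apply Rabs_triang|]. rewrite Rabs_mult.
  specialize (HC (ln a) ltac:(lra)).
  apply (Rmult_le_compat_l (Rabs gam)) in HP; [|apply Rabs_pos]. lra. }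
intros eps Heps.
assert (HK1 : 0 < Rabs K + 1) by (generalize (Rabs_pos K); lra).
exists (Rmin 1 (eps / (Rabs K + 1))). split.
- apply Rmin_pos; [lra|]. now apply Rdiv_lt_0_compat.
- intros k [_ Hk]. simpl in *. unfold R_dist in *.
  assert (H1 := Rmin_l 1 (eps / (Rabs K + 1))). assert (H2 := Rmin_r 1 (eps / (Rabs K + 1))).
  eapply Rle_lt_trans; [apply HK; lra|].
  apply Rle_lt_trans with ((Rabs K + 1) * Rabs (k - k0)).
  + apply Rmult_le_compat_r; [apply Rabs_pos|]. generalize (Rle_abs K); lra.
  + replace eps with ((Rabs K + 1) * (eps / (Rabs K + 1))) by (field; lra).
    apply Rmult_lt_compat_l; lra.
Qed.

(** * Sign of the first characteristic function for kappa >= 0 *)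

Lemma fund_1_0 (t : R) : ln a <= t <= ln b -> harm1 a b t = 2 / (b / a - a / b) * fund 1 0 t.
Proof.
intros Ht. apply (fund_unique 1 0 (2 / (b / a - a / b)) (harm1 a b) (harm1' a b)); auto.
- intros s _. split. now apply is_derive_harm1. evar_last. now apply is_derive_harm1'. unfold coef; ring.
- now apply harm1_b.
- unfold harm1'. rewrite exp_Ropp, exp_ln by lra.
  assert (Hsq := square_gap a b Ha Hab). field. repeat split; lra.
Qed.

(** At kappa = 0 the first vorticity profile is a multiple of [harm1], so the pairing becomes
    [harm1_energy]: the sign at 0 is that of the stability margin. *)
Lemma charac_1_0 (gam : R) : charac 1 gam 0 = (b / a - a / b) / 2 * (1 + gam * harm1_energy a b).
Proof.
assert (Hd := harm1_denom_pos a b Ha Hab). set (d := b / a - a / b) in *.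
assert (H1a : fund 1 0 (ln a) = d / 2).
{ assert (H := fund_1_0 (ln a) ltac:(lra)). rewrite harm1_a in H by auto. fold d in H.
  apply (Rmult_eq_reg_l (2 / d)). rewrite <- H. field; lra.
  apply Rgt_not_eq, Rdiv_lt_0_compat; lra. }
assert (HP : harm1_energy a b = 2 / d * pairing 1 0).
{ unfold harm1_energy. apply (pairing_primitive 1 0 (2 / d) (harm1_energy_primitive a b)); [lra|].
  intros t Ht. evar_last. now apply is_derive_harm1_energy_primitive.
  rewrite harm_1. rewrite (fund_1_0 t Ht) at 1. fold d.
  replace (harm1 a b t) with (2 / d * fund 1 0 t) by (unfold d; rewrite <- fund_1_0; auto). ring. }
unfold charac. rewrite HP, H1a. field. lra.
Qed.

(** For kappa >= 0 the coefficient is non-negative, so fund fund' increases to its value 0 at [ln b]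
    and fund^2 decreases; a zero at [ln a] would make [fund] vanish everywhere. *)
Lemma fund_a_neq_0 (nu kappa : R) : 0 <= kappa -> fund nu kappa (ln a) <> 0.
Proof.
intros Hk H0.
assert (Hc : forall t, 0 <= coef nu kappa t).
{ intros t. unfold coef. generalize (pow2_ge_0 nu) (exp_pos (2 * t)). nra. }
assert (Hyp : forall t, ln a <= t <= ln b -> fund nu kappa t * fund' nu kappa t <= 0).
{ intros t Ht. replace 0 with (fund nu kappa (ln b) * fund' nu kappa (ln b)) by (rewrite fund_b; ring).
  apply (is_derive_nondecreasing (fun t => fund nu kappa t * fund' nu kappa t)
    (fun t => fund' nu kappa t ^ 2 + coef nu kappa t * fund nu kappa t ^ 2)); [lra| |].
  - intros s _. assert (D1 := is_derive_fund nu kappa s). assert (D2 := is_derive_fund' nu kappa s).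
    derive_fields. rw_derive D1; rw_derive D2. ring.
  - intros s _. apply Rplus_le_le_0_compat. apply pow2_ge_0. apply Rmult_le_pos; auto. apply pow2_ge_0. }
destruct (fund_nontrivial nu kappa) as [t [Ht Hne]].
assert (HH : - fund nu kappa (ln a) ^ 2 <= - fund nu kappa t ^ 2).
{ apply (is_derive_nondecreasing (fun t => - fund nu kappa t ^ 2) (fun t => - (2 * (fund nu kappa t * fund' nu kappa t)))); [lra| |].
  - intros s _. assert (D1 := is_derive_fund nu kappa s).
    derive_fields. rw_derive D1. ring.
  - intros s Hs. specialize (Hyp s ltac:(lra)). lra. }
rewrite H0 in HH. assert (0 < fund nu kappa t ^ 2) by now apply pow2_gt_0. simpl in HH, H. lra.
Qed.

(** The value is positive at kappa = 0, continuous in kappa and never 0 for kappa >= 0. It equals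
    [charac] with gam = 0, whose continuity is already known. *)
Lemma fund_1_a_pos (kappa : R) : 0 <= kappa -> 0 < fund 1 kappa (ln a).
Proof.
intros Hk.
assert (Hch : forall k, charac 1 0 k = fund 1 k (ln a)) by (intros k; unfold charac; ring).
assert (H0 : 0 < charac 1 0 0).
{ rewrite charac_1_0. generalize (harm1_denom_pos a b Ha Hab). lra. }
destruct (Rlt_le_dec 0 (fund 1 kappa (ln a))) as [|Hle]; auto. exfalso.
assert (Hneq := fund_a_neq_0 1 kappa Hk).
assert (Hk' : 0 < kappa).
{ destruct Hk as [|Hk]; auto. subst. rewrite Hch in H0. lra. }
destruct (IVT_interv (fun k => - charac 1 0 k) 0 kappa) as [z [Hz Hz0]]; auto.
- intros k _. apply continuity_pt_opp, charac_continuous. lra.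
- lra.
- rewrite Hch. lra.
- apply (fund_a_neq_0 1 z); [lra|]. rewrite <- Hch. lra.
Qed.

(** Were [charac] <= 0 at a large k, shrinking the slip coefficient to - y / J, which is no larger
    than [gam] in absolute value, would make it vanish. Then k would be an eigenvalue for that
    coefficient, against the upper bound computed from |gam|. *)
Lemma charac_1_large (gam : R) : gam < 0 -> exists K, forall k, K < k -> 0 < charac 1 gam k.
Proof.
intros Hg. exists (Rmax 0 (mode_bound a b (- gam))). intros k Hk.
assert (Hk0 := Rmax_l 0 (mode_bound a b (- gam))). assert (Hk1 := Rmax_r 0 (mode_bound a b (- gam))).
assert (Hy := fund_1_a_pos k ltac:(lra)).
destruct (Rlt_le_dec 0 (charac 1 gam k)) as [|Hle]; auto. exfalso. unfold charac in Hle.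
set (J := pairing 1 k) in *. set (y := fund 1 k (ln a)) in *.
assert (HJ : 0 < J) by nra.
assert (Hm : mode_eigenvalue a b 1 k (- y / J)).
{ apply charac_mode; try lra. unfold charac. fold J y. field; lra. }
destruct Hm as (f & g & w & p & Hm).
assert (Hb := mode_upper_bound a b Ha Hab 1 k (- y / J) f g w p Hm (- gam) ltac:(lra)).
assert (0 < y / J) by now apply Rdiv_lt_0_compat.
assert (y / J <= - gam).
{ apply Rmult_le_reg_r with J; auto. replace (y / J * J) with y by (field; lra). lra. }
assert (Hr : Rabs (- y / J) <= - gam).
{ replace (- y / J) with (- (y / J)) by (field; lra). rewrite Rabs_Ropp, Rabs_pos_eq; lra. }
specialize (Hb Hr).
assert (0 < 1 ^ 2 / (2 * b ^ 2)).
{ apply Rdiv_lt_0_compat. lra. assert (0 < b ^ 2) by (apply pow_lt; lra). lra. }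
lra.
Qed.

(** * Oscillation of the first characteristic function as kappa tends to minus infinity *)

Section Oscillation.
Variables k kappa : R.
Hypothesis Hk : 1 <= k.
Hypothesis Hkappa : kappa = - k ^ 2.

(** Liouville's substitution: [z = sqrt r w] solves [z'' = (- k^2 + 3/4 r^-2) z] in [r = exp t]. *)
Let z (t : R) : R := exp (t / 2) * fund 1 kappa t.
(** The derivative of [z] in r, not in t: the factor e^{-t} of the change of variable is
    included. *)
Let z' (t : R) : R := exp (- (t / 2)) * (fund 1 kappa t / 2 + fund' 1 kappa t).

Lemma exp_halves (t : R) : exp t = exp (t / 2) ^ 2 /\ exp (2 * t) = exp (t / 2) ^ 4 /\
  exp (- (t / 2)) = / exp (t / 2) /\ exp (- t) = / exp (t / 2) ^ 2 /\ 0 < exp (t / 2).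
Proof.
split; [|split; [|split; [|split]]].
- simpl. rewrite Rmult_1_r, <- exp_plus. f_equal; field.
- simpl. rewrite Rmult_1_r, <- !exp_plus. f_equal; field.
- apply exp_Ropp.
- rewrite exp_Ropp. f_equal. simpl. rewrite Rmult_1_r, <- exp_plus. f_equal; field.
- apply exp_pos.
Qed.

(** The energy z'^2 + k^2 z^2 equals 1 / b at the outer circle and grows inwards by at most the
    exponential factor; the final 1 passes from x^2 to |x| through |x| <= x^2 + 1. *)
Let B : R := exp (/ a * (ln b - ln a)) / b + 1.

Lemma exp_opp_bound (t : R) : ln a <= t -> 0 < exp (- t) <= / a.
Proof.
intros Ht. split; [apply exp_pos|]. rewrite exp_Ropp. apply Rinv_le_contravar; auto.
rewrite <- (exp_ln a) at 1 by auto. now apply exp_le_compat.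
Qed.

(** Only the perturbation 3/4 r^-2 changes the energy z'^2 + k^2 z^2, hence at a rate independent of
    k. This gives z = O(1/k) with a fixed constant. *)
Lemma liouville_bound (t : R) : ln a <= t <= ln b -> Rabs (z' t) <= B /\ k * Rabs (z t) <= B.
Proof.
intros Ht.
assert (HE : z' t ^ 2 + k ^ 2 * z t ^ 2 <= exp (/ a * (ln b - ln a)) / b).
{ apply Rle_trans with ((z' (ln b) ^ 2 + k ^ 2 * z (ln b) ^ 2) * exp (/ a * (ln b - t))).
  - apply (gronwall_backward (fun t => z' t ^ 2 + k ^ 2 * z t ^ 2) (fun t => 3 / 2 * exp (- t) * (z' t * z t))); [lra| |].
    + intros s Hs. unfold z, z'.
      assert (D1 := is_derive_fund 1 kappa s). assert (D2 := is_derive_fund' 1 kappa s).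
      derive_fields. rw_derive D1; rw_derive D2. unfold coef.
      destruct (exp_halves s) as (E1 & E2 & E3 & E4 & E5). unfold Rdiv in *. rewrite ?E2, ?E3, ?E4, Hkappa. field. lra.
    + intros s Hs. destruct (exp_opp_bound s ltac:(lra)) as [He1 He2].
      assert (H2 : Rabs (z' s * z s) <= (z' s ^ 2 + k ^ 2 * z s ^ 2) / 2).
      { rewrite Rabs_mult. rewrite <- (pow2_abs (z' s)), <- (pow2_abs (z s)).
        assert (H1 := Rabs_pos (z' s)). assert (H2 := Rabs_pos (z s)).
        assert (0 <= (k ^ 2 - 1) * Rabs (z s) ^ 2) by (apply Rmult_le_pos; [nra|apply pow2_ge_0]).
        generalize (pow2_ge_0 (Rabs (z' s) - Rabs (z s))). nra. }
      assert (H3 : Rabs (3 / 2 * exp (- s) * (z' s * z s)) <= / a * (z' s ^ 2 + k ^ 2 * z s ^ 2)).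
      { rewrite Rabs_mult, Rabs_pos_eq by lra.
        apply Rle_trans with (3 / 2 * / a * ((z' s ^ 2 + k ^ 2 * z s ^ 2) / 2)).
        - apply Rmult_le_compat; try lra. apply Rabs_pos.
        - assert (0 <= / a * (z' s ^ 2 + k ^ 2 * z s ^ 2)); [|lra].
          apply Rmult_le_pos; [lra|]. generalize (pow2_ge_0 (z' s)) (pow2_ge_0 (k * z s)). nra. }
      apply Rabs_le_between in H3. lra.
  - unfold z, z'. rewrite fund_b, fund'_b.
    destruct (exp_halves (ln b)) as (E1 & _ & E3 & _ & E5). rewrite exp_ln in E1 by lra.
    rewrite E3.
    replace ((/ exp (ln b / 2) * (0 / 2 + -1)) ^ 2 + k ^ 2 * (exp (ln b / 2) * 0) ^ 2) with (/ b)
      by (set (u := exp (ln b / 2)) in *; rewrite E1; field; lra).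
    unfold Rdiv at 1. rewrite (Rmult_comm (exp _)). apply Rmult_le_compat_l.
    left; apply Rinv_0_lt_compat; lra.
    apply exp_le_compat. apply Rmult_le_compat_l; [left; now apply Rinv_0_lt_compat|lra]. }
assert (Hsq : forall x, x ^ 2 <= exp (/ a * (ln b - ln a)) / b -> Rabs x <= B).
{ intros x Hx. unfold B. rewrite <- pow2_abs in Hx. generalize (Rabs_pos x). nra. }
split; [|rewrite <- (Rabs_pos_eq k) by lra; rewrite <- Rabs_mult]; apply Hsq.
- generalize (pow2_ge_0 (k * z t)). nra.
- rewrite Rpow_mult_distr. generalize (pow2_ge_0 (z' t)). lra.
Qed.

(** Variation of constants: z' sin k(r - a) - k z cos k(r - a) has r-derivative 3/4 r^-2 z sin k(r -
    a), which is O(1/k). The condition on the sine turns the outer slope into the main term -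
    b^{-1/2}, so z (ln a) is negative for large k. *)
Lemma liouville_asymptotic : sin (k * (b - a)) = -1 ->
  k * z (ln a) <= - exp (- (ln b / 2)) + B * (ln b - ln a) / a / k.
Proof.
intros Hsin.
set (c := B / a / k).
assert (HX : - (z' (ln a) * sin (k * (exp (ln a) - a)) - k * z (ln a) * cos (k * (exp (ln a) - a))) + c * ln a <=
             - (z' (ln b) * sin (k * (exp (ln b) - a)) - k * z (ln b) * cos (k * (exp (ln b) - a))) + c * ln b).
{ apply (is_derive_nondecreasing
    (fun t => - (z' t * sin (k * (exp t - a)) - k * z t * cos (k * (exp t - a))) + c * t)
    (fun t => - (3 / 4 * exp (- t) * z t * sin (k * (exp t - a))) + c)); [lra| |].
  - intros s Hs. unfold z, z'.
    assert (D1 := is_derive_fund 1 kappa s). assert (D2 := is_derive_fund' 1 kappa s).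
    derive_fields. rw_derive D1; rw_derive D2. unfold coef.
    change (exp s + - a) with (exp s - a). set (sn := sin (k * (exp s - a))). set (cs := cos (k * (exp s - a))).
    destruct (exp_halves s) as (E1 & E2 & E3 & E4 & E5). unfold Rdiv in *. rewrite ?E2, ?E3, ?E4, ?E1, Hkappa. field. lra.
  - intros s Hs. destruct (exp_opp_bound s ltac:(lra)) as [He1 He2].
    destruct (liouville_bound s Hs) as [_ Hz].
    assert (Hz' : Rabs (z s) <= B / k).
    { apply Rmult_le_reg_l with k; [lra|]. replace (k * (B / k)) with B by (field; lra). lra. }
    assert (Hs1 : Rabs (sin (k * (exp s - a))) <= 1).
    { apply Rabs_le. generalize (SIN_bound (k * (exp s - a))). lra. }
    assert (HR : Rabs (3 / 4 * exp (- s) * z s * sin (k * (exp s - a))) <= 3 / 4 * / a * (B / k) * 1).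
    { rewrite !Rabs_mult. rewrite (Rabs_pos_eq (exp _)) by lra. rewrite (Rabs_pos_eq (3 / 4)) by lra.
      apply Rmult_le_compat; [|apply Rabs_pos| |lra].
      - apply Rmult_le_pos; [lra|apply Rabs_pos].
      - apply Rmult_le_compat; [lra|apply Rabs_pos|lra|lra]. }
    assert (0 <= / a * (B / k)).
    { apply Rmult_le_pos; [lra|]. eapply Rle_trans; [apply Rabs_pos|exact Hz']. }
    apply Rabs_le_between in HR. replace c with (/ a * (B / k)) by (unfold c; field; lra). lra. }
rewrite !exp_ln, Hsin in HX by lra.
rewrite Rminus_diag, Rmult_0_r, sin_0, cos_0 in HX.
replace (z (ln b)) with 0 in HX by (unfold z; rewrite fund_b; ring).
replace (z' (ln b)) with (- exp (- (ln b / 2))) in HX by (unfold z'; rewrite fund_b, fund'_b; field).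
replace (B * (ln b - ln a) / a / k) with (c * (ln b - ln a)) by (unfold c; field; lra).
lra.
Qed.

(** Green's identity between [fund] and [harm], with kappa = - k^2 taken out of the integral. The
    slip term gains a factor 1 / k^2 and is dominated by the leading term of order 1 / k. *)
Lemma charac_negative_formula (gam : R) :
  charac 1 gam kappa = fund 1 kappa (ln a) +
    gam / k ^ 2 * (fund' 1 kappa (ln a) - fund 1 kappa (ln a) * harm' 1 (ln a)).
Proof.
assert (HP := pairing_primitive 1 kappa kappa
  (fun t => fund' 1 kappa t * harm 1 t - fund 1 kappa t * harm' 1 t) ltac:(lra)).
cbv beta in HP. rewrite harm_b, harm_a, fund_b in HP by lra.
assert (HP' : fund' 1 kappa (ln a) - fund 1 kappa (ln a) * harm' 1 (ln a) = k ^ 2 * pairing 1 kappa).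
{ enough (0 - (fund' 1 kappa (ln a) - fund 1 kappa (ln a) * harm' 1 (ln a)) = kappa * pairing 1 kappa) by (rewrite Hkappa in * ; lra).
  rewrite <- HP; [ring|].
  intros t Ht. assert (D1 := is_derive_fund 1 kappa t). assert (D2 := is_derive_fund' 1 kappa t).
  assert (D3 := is_derive_harm 1 t ltac:(lra)). assert (D4 := is_derive_harm' 1 t ltac:(lra)).
  derive_fields. rw_derive D1; rw_derive D2; rw_derive D3; rw_derive D4. unfold coef. ring. }
rewrite HP'. unfold charac. field. lra.
Qed.

Lemma charac_oscillation_bound (gam : R) : sin (k * (b - a)) = -1 ->
  k * charac 1 gam kappa <= - exp (- (ln a / 2)) * exp (- (ln b / 2)) +
   (exp (- (ln a / 2)) * B * (ln b - ln a) / a +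
    Rabs gam * (exp (ln a / 2) * B + exp (- (ln a / 2)) * B * (/ 2 + Rabs (harm' 1 (ln a))))) / k.
Proof.
intros Hsin.
destruct (liouville_bound (ln a) ltac:(lra)) as [HB1 HB2].
assert (Has := liouville_asymptotic Hsin).
rewrite charac_negative_formula.
set (y := fund 1 kappa (ln a)). set (p := fund' 1 kappa (ln a)). set (h := harm' 1 (ln a)).
destruct (exp_halves (ln a)) as (_ & _ & E3 & _ & E5). rewrite E3. set (u := exp (ln a / 2)) in *.
assert (Hy : y = / u * z (ln a)) by (unfold z; fold y u; field; lra).
assert (Hp : p = u * z' (ln a) - y / 2) by (unfold z'; rewrite E3; fold y p u; field; lra).
assert (Hu : 0 < / u) by now apply Rinv_0_lt_compat.
assert (HzB : Rabs (z (ln a)) <= B).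
{ generalize (Rabs_pos (z (ln a))). nra. }
assert (HyB : Rabs y <= / u * B).
{ rewrite Hy, Rabs_mult, (Rabs_pos_eq (/ u)) by lra. apply Rmult_le_compat_l; lra. }
assert (Hph : Rabs (p - y * h) <= u * B + / u * B * (/ 2 + Rabs h)).
{ rewrite Hp. replace (u * z' (ln a) - y / 2 - y * h) with (u * z' (ln a) + - (y * (/ 2 + h))) by (field; lra).
  eapply Rle_trans; [apply Rabs_triang|]. rewrite Rabs_Ropp, !Rabs_mult, (Rabs_pos_eq u) by lra.
  apply Rplus_le_compat. apply Rmult_le_compat_l; lra.
  apply Rmult_le_compat; auto; try apply Rabs_pos.
  eapply Rle_trans; [apply Rabs_triang|]. rewrite (Rabs_pos_eq (/ 2)) by lra. lra. }
assert (Hik : 0 < / k) by (apply Rinv_0_lt_compat; lra).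
replace (k * (y + gam / k ^ 2 * (p - y * h))) with (/ u * (k * z (ln a)) + gam * (p - y * h) * / k) by (rewrite Hy; field; lra).
assert (H1 : / u * (k * z (ln a)) <= / u * (- exp (- (ln b / 2)) + B * (ln b - ln a) / a / k)).
{ apply Rmult_le_compat_l; lra. }
assert (H2 : gam * (p - y * h) * / k <= Rabs gam * (u * B + / u * B * (/ 2 + Rabs h)) * / k).
{ apply Rmult_le_compat_r; [lra|]. eapply Rle_trans; [apply Rle_abs|]. rewrite Rabs_mult.
  apply Rmult_le_compat_l; auto. apply Rabs_pos. }
replace (- / u * exp (- (ln b / 2)) + (/ u * B * (ln b - ln a) / a + Rabs gam * (u * B + / u * B * (/ 2 + Rabs h))) / k)
 with (/ u * (- exp (- (ln b / 2)) + B * (ln b - ln a) / a / k) + Rabs gam * (u * B + / u * B * (/ 2 + Rabs h)) * / k)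
 by (field; lra).
lra.
Qed.
End Oscillation.

Lemma charac_1_oscillation (gam : R) : exists kappa, kappa < 0 /\ charac 1 gam kappa < 0.
Proof.
set (B := exp (/ a * (ln b - ln a)) / b + 1).
set (c0 := exp (- (ln a / 2)) * exp (- (ln b / 2))).
set (C := exp (- (ln a / 2)) * B * (ln b - ln a) / a +
    Rabs gam * (exp (ln a / 2) * B + exp (- (ln a / 2)) * B * (/ 2 + Rabs (harm' 1 (ln a))))).
assert (Hc0 : 0 < c0) by (apply Rmult_lt_0_compat; apply exp_pos).
assert (HPI := PI_RGT_0).
(* Adding [m] full turns to 3 pi / 2 keeps the sine of k (b - a) at -1 and makes k > 1 + |C| / c0,
   so that the error C / k stays below the main term c0. *)
destruct (INR_unbounded ((b - a) * (1 + Rabs C / c0) / (2 * PI))) as [m Hm].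
set (k := (3 * (PI / 2) + 2 * INR m * PI) / (b - a)).
assert (Hk : 1 + Rabs C / c0 < k).
{ unfold k. apply Rmult_lt_reg_r with (b - a); [lra|].
  replace ((3 * (PI / 2) + 2 * INR m * PI) / (b - a) * (b - a)) with (3 * (PI / 2) + 2 * INR m * PI) by (field; lra).
  apply (Rmult_lt_compat_r (2 * PI)) in Hm; [|lra].
  replace ((b - a) * (1 + Rabs C / c0) / (2 * PI) * (2 * PI)) with ((1 + Rabs C / c0) * (b - a)) in Hm by (field; lra).
  lra. }
assert (HC0 : 0 <= Rabs C / c0).
{ apply Rmult_le_pos; [apply Rabs_pos|left; now apply Rinv_0_lt_compat]. }
assert (Hsin : sin (k * (b - a)) = -1).
{ unfold k. replace ((3 * (PI / 2) + 2 * INR m * PI) / (b - a) * (b - a)) with (3 * (PI / 2) + 2 * INR m * PI) by (field; lra).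
  rewrite sin_period. apply sin_3PI2. }
exists (- k ^ 2). split.
- assert (0 < k ^ 2) by (apply pow_lt; lra). lra.
- assert (H := charac_oscillation_bound k (- k ^ 2) ltac:(lra) eq_refl gam Hsin). fold B C in H.
  replace (- exp (- (ln a / 2)) * exp (- (ln b / 2))) with (- c0) in H by (unfold c0; ring).
  assert (HCk : C / k < c0).
  { apply Rle_lt_trans with (Rabs C / k).
    - apply Rmult_le_compat_r. left; apply Rinv_0_lt_compat; lra. apply Rle_abs.
    - apply Rmult_lt_reg_r with (k / c0). apply Rdiv_lt_0_compat; lra.
      replace (Rabs C / k * (k / c0)) with (Rabs C / c0) by (field; lra).
      replace (c0 * (k / c0)) with k by (field; lra). lra. }
  assert (k * charac 1 gam (- k ^ 2) < 0) by lra. nra.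
Qed.

(** * The union of the mode spectra and its supremum *)

Definition spectrum (gam kappa : R) : Prop :=
  exists n : nat, (1 <= n)%nat /\ mode_eigenvalue a b (INR n) kappa gam.

Lemma spectrum_upper_bound (gam : R) : exists K, forall n kappa, (1 <= n)%nat ->
  mode_eigenvalue a b (INR n) kappa gam -> kappa <= K - INR n ^ 2 / (2 * b ^ 2).
Proof.
exists (mode_bound a b (Rabs gam + 1)). intros n kappa Hn (f & g & w & p & Hm).
assert (HG := Rabs_pos gam).
apply (mode_upper_bound a b Ha Hab (INR n) kappa gam f g w p Hm); try lra.
Qed.

(** A finite intersection of neighbourhoods. The cap [d <= 1] later places the eigenvalues
    considered above s - 1, which limits their modes. *)
Lemma charac_nonzero_neighbourhood (gam s : R) (N : nat) :
  (forall n, (1 <= n <= N)%nat -> charac (INR n) gam s <> 0) ->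
  exists d, 0 < d <= 1 /\ forall n k, (1 <= n <= N)%nat -> Rabs (k - s) < d -> charac (INR n) gam k <> 0.
Proof.
induction N as [|N IH]; intros H.
- exists 1. split; [lra|]. intros n k Hn. lia.
- destruct IH as [d [Hd IH]]. { intros n Hn. apply H. lia. }
  assert (HN : 0 < INR (S N)) by (apply lt_0_INR; lia).
  assert (Hne := H (S N) ltac:(lia)).
  destruct (charac_continuous (INR (S N)) gam s HN (Rabs (charac (INR (S N)) gam s))) as [d' [Hd' Hc]].
  { now apply Rabs_pos_lt. }
  exists (Rmin d d'). split.
  { split. apply Rmin_pos; lra. eapply Rle_trans; [apply Rmin_l|lra]. }
  intros n k Hn Hk.
  destruct (Nat.eq_dec n (S N)) as [->|Hnn].
  + intros H0. destruct (Req_dec k s) as [->|Hks]; [contradiction|].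
    assert (Hk' : Rabs (k - s) < d') by (eapply Rlt_le_trans; [exact Hk|apply Rmin_r]).
    assert (Hc' : Rabs (charac (INR (S N)) gam k - charac (INR (S N)) gam s) < Rabs (charac (INR (S N)) gam s))
      by exact (Hc k (conj (conj I (not_eq_sym Hks)) Hk')).
    rewrite H0, Rminus_0_l, Rabs_Ropp in Hc'. lra.
  + apply IH; [lia|]. eapply Rlt_le_trans; [exact Hk|apply Rmin_l].
Qed.

Lemma spectrum_supremum (gam k0 : R) : spectrum gam k0 ->
  exists s, is_lub (spectrum gam) s /\ exists n, (1 <= n)%nat /\ charac (INR n) gam s = 0.
Proof.
intros Hk0.
destruct (spectrum_upper_bound gam) as [K HK].
assert (Hb2 : 0 < b ^ 2) by (apply pow_lt; lra).
destruct (completeness (spectrum gam)) as [s Hs].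
- exists K. intros k (n & Hn & Hm). specialize (HK n k Hn Hm).
  assert (0 <= INR n ^ 2 / (2 * b ^ 2)); [|lra].
  apply Rmult_le_pos. apply pow2_ge_0. left; apply Rinv_0_lt_compat; lra.
- now exists k0.
- exists s. split; auto.
  (* An eigenvalue of mode n above s - 1 satisfies n^2 <= 2 b^2 (K - s + 1), hence n <= N. *)
  destruct (INR_unbounded (2 * b ^ 2 * Rabs (K - s + 1) + 1)) as [N HN].
  destruct (Classical_Prop.classic (exists n, (1 <= n)%nat /\ charac (INR n) gam s = 0)) as [|Hno]; auto.
  exfalso.
  destruct (charac_nonzero_neighbourhood gam s N) as [d [Hd H]].
  { intros n Hn H0. apply Hno. exists n. split; [lia|auto]. }
  destruct Hs as [Hub Hlub].
  enough (s <= s - d) by lra.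
  apply Hlub. intros k Hk. destruct (Rle_lt_dec k (s - d)) as [|Hkd]; auto. exfalso.
  assert (Hks := Hub k Hk). destruct Hk as (n & Hn & Hm).
  assert (Hn' := le_INR _ _ Hn). simpl in Hn'.
  apply (H n k).
  + split; auto. apply INR_le. specialize (HK n k Hn Hm).
    assert (Hq : INR n ^ 2 / (2 * b ^ 2) <= K - s + 1) by lra.
    apply (Rmult_le_compat_r (2 * b ^ 2)) in Hq; [|lra].
    replace (INR n ^ 2 / (2 * b ^ 2) * (2 * b ^ 2)) with (INR n ^ 2) in Hq by (field; lra).
    assert (K - s + 1 <= Rabs (K - s + 1)) by apply Rle_abs. nra.
  + apply Rabs_def1; lra.
  + apply mode_charac; auto. lra.
Qed.

Lemma stable_spectrum (gam : R) : 0 < 1 + gam * harm1_energy a b ->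
  exists s n, s < 0 /\ is_lub (spectrum gam) s /\ (1 <= n)%nat /\ charac (INR n) gam s = 0.
Proof.
intros Hst.
assert (H0 : 0 < charac 1 gam 0).
{ rewrite charac_1_0. apply Rmult_lt_0_compat; auto. generalize (harm1_denom_pos a b Ha Hab). lra. }
destruct (charac_1_oscillation gam) as [k1 [Hk1 Hc1]].
destruct (IVT_interv (charac 1 gam) k1 0) as [k0 [Hk0 Hc0]]; auto.
{ intros; apply charac_continuous; lra. }
(* [charac] is positive at 0, so the zero lies elsewhere and a mode can be rebuilt from it. *)
assert (Hne : k0 <> 0) by (intros ->; lra).
assert (Hm : spectrum gam k0).
{ exists 1%nat. split; [lia|]. apply charac_mode; simpl; auto; lra. }
destruct (spectrum_supremum gam k0 Hm) as (s & Hs & n & Hn & Hc).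
exists s, n. split; [|auto].
set (dl := Rmin 1 (1 + gam * harm1_energy a b)).
assert (Hdl : 0 < dl / b ^ 2).
{ apply Rdiv_lt_0_compat. apply Rmin_pos; lra. apply pow_lt; lra. }
enough (s <= - dl / b ^ 2) by (unfold Rdiv in *; lra).
apply Hs. intros k (m & Hm1 & f & g & w & p & Hmm).
apply le_INR in Hm1. simpl in Hm1.
exact (mode_stable_bound a b Ha Hab (INR m) k gam f g w p Hmm Hm1 Hst).
Qed.

Lemma unstable_spectrum (gam : R) : 1 + gam * harm1_energy a b < 0 ->
  exists s n, 0 < s /\ is_lub (spectrum gam) s /\ (1 <= n)%nat /\ charac (INR n) gam s = 0.
Proof.
intros Hun.
assert (HH := harm1_energy_pos a b Ha Hab).
assert (H0 : charac 1 gam 0 < 0).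
{ rewrite charac_1_0. generalize (harm1_denom_pos a b Ha Hab). nra. }
destruct (charac_1_large gam ltac:(nra)) as [K HK].
set (k1 := Rmax 0 K + 1).
assert (Hk1 : 0 < k1 /\ K < k1) by (unfold k1; generalize (Rmax_l 0 K) (Rmax_r 0 K); lra).
destruct (IVT_interv (charac 1 gam) 0 k1) as [k0 [Hk0 Hc0]]; try lra.
{ intros; apply charac_continuous; lra. }
{ apply HK; lra. }
assert (Hne : k0 <> 0) by (intros ->; lra).
assert (Hm : spectrum gam k0).
{ exists 1%nat. split; [lia|]. apply charac_mode; simpl; auto; lra. }
destruct (spectrum_supremum gam k0 Hm) as (s & Hs & n & Hn & Hc).
exists s, n. split; [|auto].
assert (k0 <= s) by now apply Hs. lra.
Qed.

End Characteristic.

(** * Calculus on the punctured plane *)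

Definition punctured (x y : R) : Prop := 0 < x ^ 2 + y ^ 2.

Lemma sum_squares_cont (x y : R) : continuity_2d_pt (fun x y => x ^ 2 + y ^ 2) x y.
Proof.
apply (continuity_2d_pt_ext (fun x y => x * x + y * y)); [intros; ring|].
apply continuity_2d_pt_plus; apply continuity_2d_pt_mult;
  first [apply continuity_2d_pt_id1|apply continuity_2d_pt_id2].
Qed.

Lemma punctured_open (x y : R) : punctured x y -> locally_2d punctured x y.
Proof.
intros H. destruct (sum_squares_cont x y (mkposreal _ H)) as [d Hd].
exists d. intros u v Hu Hv. specialize (Hd u v Hu Hv). simpl in Hd.
apply Rabs_lt_between in Hd. unfold punctured in *. simpl in *. lra.
Qed.

(** The punctured plane is open and contains the closed annulus, so regularity on it includes
    regularity up to both circles. *)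
Definition smooth_to (k : nat) (f : R -> R -> R) : Prop :=
  forall x y, punctured x y -> ex_diff_n f k x y.

Lemma smooth_to_ext (k : nat) (f g : R -> R -> R) :
  (forall x y, punctured x y -> f x y = g x y) -> smooth_to k f -> smooth_to k g.
Proof.
intros H Hf x y Hxy. apply (ex_diff_n_ext_loc f); auto.
apply (locally_2d_impl punctured); [|now apply punctured_open].
apply locally_2d_forall. intros u v; apply H.
Qed.

Lemma smooth_to_le (k m : nat) (f : R -> R -> R) : (m <= k)%nat -> smooth_to k f -> smooth_to m f.
Proof. intros H Hf x y Hxy. apply (ex_diff_n_m k); auto. Qed.

Lemma smooth_to_cont (k : nat) (f : R -> R -> R) x y : smooth_to k f -> punctured x y -> continuity_2d_pt f x y.
Proof. intros Hf H. specialize (Hf x y H). destruct k; apply Hf. Qed.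

Lemma smooth_dx (k : nat) (f : R -> R -> R) : smooth_to (S k) f -> smooth_to k (dx f).
Proof. intros Hf x y H. apply (Hf x y H). Qed.
Lemma smooth_dy (k : nat) (f : R -> R -> R) : smooth_to (S k) f -> smooth_to k (dy f).
Proof. intros Hf x y H. apply (Hf x y H). Qed.

Lemma is_derive_dx (k : nat) (f : R -> R -> R) x y :
  smooth_to (S k) f -> punctured x y -> is_derive (fun t => f t y) x (dx f x y).
Proof. intros Hf H. apply Derive_correct. apply (Hf x y H). Qed.
Lemma is_derive_dy (k : nat) (f : R -> R -> R) x y :
  smooth_to (S k) f -> punctured x y -> is_derive (fun t => f x t) y (dy f x y).
Proof. intros Hf H. apply Derive_correct. apply (Hf x y H). Qed.

Lemma punctured_line_x x y : punctured x y -> locally x (fun t => punctured t y).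
Proof. intros H. apply (locally_2d_1d_const_y punctured), punctured_open; auto. Qed.
Lemma punctured_line_y x y : punctured x y -> locally y (fun t => punctured x t).
Proof. intros H. apply (locally_2d_1d_const_x punctured), punctured_open; auto. Qed.

Lemma dx_ext (f g : R -> R -> R) : (forall x y, punctured x y -> f x y = g x y) ->
  forall x y, punctured x y -> dx f x y = dx g x y.
Proof.
intros H x y Hxy. apply Derive_ext_loc. generalize (punctured_line_x x y Hxy).
apply filter_imp. intros t Ht; auto.
Qed.
Lemma dy_ext (f g : R -> R -> R) : (forall x y, punctured x y -> f x y = g x y) ->
  forall x y, punctured x y -> dy f x y = dy g x y.
Proof.
intros H x y Hxy. apply Derive_ext_loc. generalize (punctured_line_y x y Hxy).
apply filter_imp. intros t Ht; auto.
Qed.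

(** [ex_diff_n] speaks of [Derive]; explicit partial derivatives are passed to it by extensionality
    on an open set. *)
Lemma smooth_intro (k : nat) (f fx fy : R -> R -> R) :
  (forall x y, punctured x y -> continuity_2d_pt f x y) ->
  (forall x y, punctured x y -> is_derive (fun t => f t y) x (fx x y)) ->
  (forall x y, punctured x y -> is_derive (fun t => f x t) y (fy x y)) ->
  smooth_to k fx -> smooth_to k fy -> smooth_to (S k) f.
Proof.
intros Hc Hx Hy Hfx Hfy x y Hxy. split; [auto|split; [|split; [|split]]].
- eexists; auto.
- eexists; auto.
- apply (smooth_to_ext k fx (dx f)); auto. intros u v Huv. symmetry. apply is_derive_unique; auto.
- apply (smooth_to_ext k fy (dy f)); auto. intros u v Huv. symmetry. apply is_derive_unique; auto.
Qed.

Lemma smooth_const (k : nat) (c : R) : smooth_to k (fun _ _ => c).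
Proof.
revert c; induction k as [|k IH]; intros c.
- intros x y _. split; auto. apply continuity_2d_pt_const.
- apply (smooth_intro k _ (fun _ _ => 0) (fun _ _ => 0)); auto; intros x y _.
  + apply continuity_2d_pt_const.
  + exact (is_derive_const c x).
  + exact (is_derive_const c y).
Qed.

Lemma smooth_x (k : nat) : smooth_to k (fun x _ => x).
Proof.
destruct k as [|k].
- intros x y _. split; auto. apply continuity_2d_pt_id1.
- apply (smooth_intro k _ (fun _ _ => 1) (fun _ _ => 0)); try apply smooth_const; intros x y _.
  + apply continuity_2d_pt_id1.
  + exact (is_derive_id x).
  + exact (is_derive_const x y).
Qed.

Lemma smooth_y (k : nat) : smooth_to k (fun _ y => y).
Proof.
destruct k as [|k].
- intros x y _. split; auto. apply continuity_2d_pt_id2.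
- apply (smooth_intro k _ (fun _ _ => 0) (fun _ _ => 1)); try apply smooth_const; intros x y _.
  + apply continuity_2d_pt_id2.
  + exact (is_derive_const y x).
  + exact (is_derive_id y).
Qed.

Lemma smooth_plus (k : nat) (f g : R -> R -> R) :
  smooth_to k f -> smooth_to k g -> smooth_to k (fun x y => f x y + g x y).
Proof.
revert f g; induction k as [|k IH]; intros f g Hf Hg.
- intros x y H. split; auto. apply continuity_2d_pt_plus; eapply smooth_to_cont; eauto.
- apply (smooth_intro k _ (fun x y => dx f x y + dx g x y) (fun x y => dy f x y + dy g x y)).
  + intros x y H. apply continuity_2d_pt_plus; eapply smooth_to_cont; eauto.
  + intros x y H. apply (is_derive_plus (fun t => f t y) (fun t => g t y)); eapply is_derive_dx; eauto.
  + intros x y H. apply (is_derive_plus (fun t => f x t) (fun t => g x t)); eapply is_derive_dy; eauto.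
  + apply IH; apply smooth_dx; auto.
  + apply IH; apply smooth_dy; auto.
Qed.

Lemma smooth_mult (k : nat) (f g : R -> R -> R) :
  smooth_to k f -> smooth_to k g -> smooth_to k (fun x y => f x y * g x y).
Proof.
revert f g; induction k as [|k IH]; intros f g Hf Hg.
- intros x y H. split; auto. apply continuity_2d_pt_mult; eapply smooth_to_cont; eauto.
- assert (Hf' : smooth_to k f) by (apply (smooth_to_le (S k)); auto).
  assert (Hg' : smooth_to k g) by (apply (smooth_to_le (S k)); auto).
  apply (smooth_intro k _ (fun x y => dx f x y * g x y + f x y * dx g x y) (fun x y => dy f x y * g x y + f x y * dy g x y)).
  + intros x y H. apply continuity_2d_pt_mult; eapply smooth_to_cont; eauto.
  + intros x y H. apply (is_derive_mult (fun t => f t y) (fun t => g t y)); [eapply is_derive_dx|eapply is_derive_dx|intros; apply Rmult_comm]; eauto.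
  + intros x y H. apply (is_derive_mult (fun t => f x t) (fun t => g x t)); [eapply is_derive_dy|eapply is_derive_dy|intros; apply Rmult_comm]; eauto.
  + apply smooth_plus; apply IH; auto; apply smooth_dx; auto.
  + apply smooth_plus; apply IH; auto; apply smooth_dy; auto.
Qed.

Lemma smooth_inv_rho (k : nat) : smooth_to k (fun x y => / (x ^ 2 + y ^ 2)).
Proof.
assert (Hc : forall x y, punctured x y -> continuity_2d_pt (fun x y => / (x ^ 2 + y ^ 2)) x y).
{ intros x y H. apply (continuity_2d_pt_inv (fun x y => x ^ 2 + y ^ 2)). apply sum_squares_cont.
  apply Rgt_not_eq, H. }
induction k as [|k IH].
- intros x y H. split; auto.
- apply (smooth_intro k _ (fun x y => (-2 * x) * (/ (x ^ 2 + y ^ 2) * / (x ^ 2 + y ^ 2)))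
    (fun x y => (-2 * y) * (/ (x ^ 2 + y ^ 2) * / (x ^ 2 + y ^ 2)))); auto.
  + intros x y H. unfold punctured in H. auto_derive. simpl in *; lra. field. lra.
  + intros x y H. unfold punctured in H. auto_derive. simpl in *; lra. field. lra.
  + apply smooth_mult; [apply smooth_mult; [apply smooth_const|apply smooth_x]|apply smooth_mult; auto].
  + apply smooth_mult; [apply smooth_mult; [apply smooth_const|apply smooth_y]|apply smooth_mult; auto].
Qed.

(** * Radial profiles as functions of ln r *)

Fixpoint Ck_line (k : nat) (phi : R -> R) : Prop :=
  match k with
  | O => forall t, continuous phi t
  | S k => exists phi', (forall t, is_derive phi t (phi' t)) /\ Ck_line k phi'
  end.

Lemma Ck_line_S (k : nat) (phi : R -> R) : Ck_line (S k) phi -> Ck_line k phi.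
Proof.
revert phi; induction k as [|k IH]; intros phi (phi' & H1 & H2).
- intros t. eapply is_derive_cont; eauto.
- exists phi'. split; auto.
Qed.

Lemma Ck_line_cont (k : nat) (phi : R -> R) : Ck_line k phi -> forall t, continuous phi t.
Proof. destruct k; auto. intros (phi' & H1 & _) t. eapply is_derive_cont; eauto. Qed.

Lemma Ck_line_plus (k : nat) (f g : R -> R) : Ck_line k f -> Ck_line k g -> Ck_line k (fun t => f t + g t).
Proof.
revert f g; induction k as [|k IH]; intros f g.
- intros Hf Hg t. apply (continuous_plus f g); auto.
- intros (f' & Hf & Hf') (g' & Hg & Hg'). exists (fun t => f' t + g' t). split.
  + intros t. apply (is_derive_plus f g); auto.
  + apply IH; auto.
Qed.

Lemma Ck_line_mult (k : nat) (f g : R -> R) : Ck_line k f -> Ck_line k g -> Ck_line k (fun t => f t * g t).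
Proof.
revert f g; induction k as [|k IH]; intros f g.
- intros Hf Hg t. apply (continuous_mult f g); auto.
- intros Hf Hg. assert (Hf0 := Ck_line_S k f Hf). assert (Hg0 := Ck_line_S k g Hg).
  destruct Hf as (f' & Hf & Hf'). destruct Hg as (g' & Hg & Hg').
  exists (fun t => f' t * g t + f t * g' t). split.
  + intros t. apply (is_derive_mult f g); auto. intros; apply Rmult_comm.
  + apply Ck_line_plus; apply IH; auto.
Qed.

Lemma Ck_line_const (k : nat) (c : R) : Ck_line k (fun _ => c).
Proof.
revert c; induction k as [|k IH]; intros c.
- intros t. apply continuous_const.
- exists (fun _ => 0). split; auto. intros t. exact (is_derive_const c t).
Qed.

Lemma Ck_line_exp (k : nat) (c : R) : Ck_line k (fun t => exp (c * t)).
Proof.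
induction k as [|k IH].
- intros t. apply (ex_derive_continuous (fun t => exp (c * t))). auto_derive; auto.
- exists (fun t => c * exp (c * t)). split.
  + intros t. auto_derive; auto. ring.
  + apply Ck_line_mult; auto. apply Ck_line_const.
Qed.

(** [log_radius = ln r]; a function of [r] is written as a function of [ln r]. *)
Definition log_radius (x y : R) : R := ln (x ^ 2 + y ^ 2) / 2.

Lemma log_radius_cont x y : punctured x y -> continuity_2d_pt log_radius x y.
Proof.
intros H. apply (continuity_1d_2d_pt_comp (fun s => ln s / 2) (fun x y => x ^ 2 + y ^ 2)).
- apply continuous_pt, (ex_derive_continuous (fun s => ln s / 2)). auto_derive. exact H.
- apply sum_squares_cont.
Qed.

Lemma log_radius_dx x y : punctured x y -> is_derive (fun t => log_radius t y) x (x * / (x ^ 2 + y ^ 2)).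
Proof.
intros H. unfold log_radius, punctured in *. auto_derive. simpl in *; lra. field. lra.
Qed.
Lemma log_radius_dy x y : punctured x y -> is_derive (fun t => log_radius x t) y (y * / (x ^ 2 + y ^ 2)).
Proof.
intros H. unfold log_radius, punctured in *. auto_derive. simpl in *; lra. field. lra.
Qed.

Lemma radial_dx (phi : R -> R) (l : R) x y : punctured x y -> is_derive phi (log_radius x y) l ->
  is_derive (fun t => phi (log_radius t y)) x (l * (x * / (x ^ 2 + y ^ 2))).
Proof.
intros H Hp. rewrite Rmult_comm.
apply (is_derive_comp phi (fun t => log_radius t y)); auto. now apply log_radius_dx.
Qed.
Lemma radial_dy (phi : R -> R) (l : R) x y : punctured x y -> is_derive phi (log_radius x y) l ->
  is_derive (fun t => phi (log_radius x t)) y (l * (y * / (x ^ 2 + y ^ 2))).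
Proof.
intros H Hp. rewrite Rmult_comm.
apply (is_derive_comp phi (fun t => log_radius x t)); auto. now apply log_radius_dy.
Qed.

Lemma smooth_radial (k : nat) (phi : R -> R) : Ck_line k phi -> smooth_to k (fun x y => phi (log_radius x y)).
Proof.
assert (Hc : forall phi, (forall t, continuous phi t) ->
  forall x y, punctured x y -> continuity_2d_pt (fun x y => phi (log_radius x y)) x y).
{ intros f Hf x y H. apply (continuity_1d_2d_pt_comp f log_radius). now apply continuous_pt. now apply log_radius_cont. }
revert phi; induction k as [|k IH]; intros phi Hphi.
- intros x y H. split; auto.
- assert (Hc0 := Ck_line_cont _ _ Hphi). destruct Hphi as (phi' & H1 & H2).
  apply (smooth_intro k _ (fun x y => phi' (log_radius x y) * (x * / (x ^ 2 + y ^ 2)))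
     (fun x y => phi' (log_radius x y) * (y * / (x ^ 2 + y ^ 2)))); auto.
  + intros x y H. now apply radial_dx.
  + intros x y H. now apply radial_dy.
  + apply smooth_mult; [now apply IH|]. apply smooth_mult. apply smooth_x. apply smooth_inv_rho.
  + apply smooth_mult; [now apply IH|]. apply smooth_mult. apply smooth_y. apply smooth_inv_rho.
Qed.

(** The powers (x + iy)^n as polynomials: they give r^n cos (n theta) and r^n sin (n theta) without
    choosing an angle, hence with no singular ray. *)
Fixpoint cpow (n : nat) (x y : R) : R * R :=
  match n with
  | O => (1, 0)
  | S m => (x * fst (cpow m x y) - y * snd (cpow m x y), x * snd (cpow m x y) + y * fst (cpow m x y))
  end.
Definition re_pow (n : nat) (x y : R) : R := fst (cpow n x y).
Definition im_pow (n : nat) (x y : R) : R := snd (cpow n x y).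

Lemma re_pow_S n x y : re_pow (S n) x y = x * re_pow n x y - y * im_pow n x y.
Proof. reflexivity. Qed.
Lemma im_pow_S n x y : im_pow (S n) x y = x * im_pow n x y + y * re_pow n x y.
Proof. reflexivity. Qed.

(** The complex derivative n z^{n-1} with the Cauchy-Riemann equations. For n = 0 the factor [INR 0]
    makes the value of [pred 0] harmless. *)
Lemma pow_derivatives (n : nat) (x y : R) :
  is_derive (fun t => re_pow n t y) x (INR n * re_pow (pred n) x y) /\
  is_derive (fun t => im_pow n t y) x (INR n * im_pow (pred n) x y) /\
  is_derive (fun t => re_pow n x t) y (- INR n * im_pow (pred n) x y) /\
  is_derive (fun t => im_pow n x t) y (INR n * re_pow (pred n) x y).
Proof.
induction n as [|n (IH1 & IH2 & IH3 & IH4)].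
- simpl INR. rewrite Ropp_0, !Rmult_0_l. unfold re_pow, im_pow; simpl.
  split; [|split; [|split]].
  exact (is_derive_const 1 x). exact (is_derive_const 0 x). exact (is_derive_const 1 y). exact (is_derive_const 0 y).
- assert (Hp : forall f : nat -> R -> R -> R, INR n * f (pred n) x y =
     match n with O => 0 | S m => INR n * f m x y end).
  { intros f. destruct n; simpl; ring. }
  rewrite S_INR. simpl pred.
  split; [|split; [|split]].
  + apply (is_derive_ext (fun t => t * re_pow n t y - y * im_pow n t y)); [reflexivity|].
    derive_fields. rw_derive IH1; rw_derive IH2.
    destruct n as [|m]; [simpl; unfold re_pow, im_pow; simpl; ring|]. simpl pred. rewrite re_pow_S. ring.
  + apply (is_derive_ext (fun t => t * im_pow n t y + y * re_pow n t y)); [reflexivity|].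
    derive_fields. rw_derive IH1; rw_derive IH2.
    destruct n as [|m]; [simpl; unfold re_pow, im_pow; simpl; ring|]. simpl pred. rewrite im_pow_S. ring.
  + apply (is_derive_ext (fun t => x * re_pow n x t - t * im_pow n x t)); [reflexivity|].
    derive_fields. rw_derive IH3; rw_derive IH4.
    destruct n as [|m]; [simpl; unfold re_pow, im_pow; simpl; ring|]. simpl pred. rewrite im_pow_S. ring.
  + apply (is_derive_ext (fun t => x * im_pow n x t + t * re_pow n x t)); [reflexivity|].
    derive_fields. rw_derive IH3; rw_derive IH4.
    destruct n as [|m]; [simpl; unfold re_pow, im_pow; simpl; ring|]. simpl pred. rewrite re_pow_S. ring.
Qed.

Lemma smooth_pow (k n : nat) : smooth_to k (re_pow n) /\ smooth_to k (im_pow n).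
Proof.
induction n as [|n [IH1 IH2]].
- split; [exact (smooth_const k 1)|exact (smooth_const k 0)].
- split.
  + apply (smooth_to_ext k (fun x y => x * re_pow n x y + (-1) * (y * im_pow n x y))).
    intros x y _. rewrite re_pow_S; ring.
    apply smooth_plus. apply smooth_mult; auto; apply smooth_x.
    apply smooth_mult. apply smooth_const. apply smooth_mult; auto; apply smooth_y.
  + apply (smooth_to_ext k (fun x y => x * im_pow n x y + y * re_pow n x y)).
    intros x y _. rewrite im_pow_S; ring.
    apply smooth_plus; apply smooth_mult; auto. apply smooth_x. apply smooth_y.
Qed.

Lemma pow_polar (n : nat) (r t : R) :
  re_pow n (r * cos t) (r * sin t) = r ^ n * cos (INR n * t) /\
  im_pow n (r * cos t) (r * sin t) = r ^ n * sin (INR n * t).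
Proof.
induction n as [|n [IH1 IH2]].
- simpl INR. rewrite Rmult_0_l, cos_0, sin_0. unfold re_pow, im_pow; simpl. split; ring.
- rewrite re_pow_S, im_pow_S, IH1, IH2, S_INR, Rmult_plus_distr_r, Rmult_1_l, cos_plus, sin_plus.
  simpl; split; ring.
Qed.

Lemma dx_dy_comm (f : R -> R -> R) x y : smooth_to 2 f -> punctured x y -> dx (dy f) x y = dy (dx f) x y.
Proof.
intros Hf H. apply (Schwarz f).
- apply (locally_2d_impl punctured); [|now apply punctured_open].
  apply locally_2d_forall. intros u v Huv. destruct (Hf u v Huv) as (_ & H1 & H2 & (_ & _ & H3 & _) & (_ & H4 & _)).
  auto.
- destruct (Hf x y H) as (_ & _ & _ & _ & (_ & _ & _ & (H3 & _) & _)). exact H3.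
- destruct (Hf x y H) as (_ & _ & _ & (_ & _ & _ & _ & (H3 & _)) & _). exact H3.
Qed.

(** * From modes to eigenfields *)

Lemma dx_opp (f : R -> R -> R) x y : dx (fun x y => - f x y) x y = - dx f x y.
Proof. exact (Derive_opp (fun t => f t y) x). Qed.
Lemma dy_opp (f : R -> R -> R) x y : dy (fun x y => - f x y) x y = - dy f x y.
Proof. exact (Derive_opp (fun t => f x t) y). Qed.

Lemma laplacian_dx (f : R -> R -> R) x y : smooth_to 3 f -> punctured x y ->
  laplacian (dx f) x y = dx (laplacian f) x y.
Proof.
intros Hf H. unfold laplacian.
assert (Hfx : smooth_to 2 (dx f)) by now apply smooth_dx.
assert (Hfy : smooth_to 2 (dy f)) by now apply smooth_dy.
assert (E1 : dy (dy (dx f)) x y = dx (dy (dy f)) x y).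
{ rewrite (dx_dy_comm (dy f)) by auto. apply dy_ext; auto.
  intros u v Huv. symmetry. apply dx_dy_comm; auto. apply (smooth_to_le 3); auto. }
rewrite E1. symmetry.
apply (Derive_plus (fun t => dx (dx f) t y) (fun t => dy (dy f) t y)).
- eexists. apply (is_derive_dx 0 (dx (dx f))); auto. now apply smooth_dx.
- eexists. apply (is_derive_dx 0 (dy (dy f))); auto. now apply smooth_dy.
Qed.

Lemma laplacian_dy (f : R -> R -> R) x y : smooth_to 3 f -> punctured x y ->
  laplacian (dy f) x y = dy (laplacian f) x y.
Proof.
intros Hf H. unfold laplacian.
assert (Hfx : smooth_to 2 (dx f)) by now apply smooth_dx.
assert (Hfy : smooth_to 2 (dy f)) by now apply smooth_dy.
assert (E1 : dx (dx (dy f)) x y = dy (dx (dx f)) x y).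
{ rewrite <- (dx_dy_comm (dx f)) by auto. apply dx_ext; auto.
  intros u v Huv. apply dx_dy_comm; auto. apply (smooth_to_le 3); auto. }
rewrite E1. symmetry.
apply (Derive_plus (fun t => dx (dx f) x t) (fun t => dy (dy f) x t)).
- eexists. apply (is_derive_dy 0 (dx (dx f))); auto. now apply smooth_dx.
- eexists. apply (is_derive_dy 0 (dy (dy f))); auto. now apply smooth_dy.
Qed.

Lemma exp_log_radius x y : punctured x y -> exp (2 * log_radius x y) = x ^ 2 + y ^ 2.
Proof. intros H. unfold log_radius. replace (2 * (ln (x ^ 2 + y ^ 2) / 2)) with (ln (x ^ 2 + y ^ 2)) by field. now apply exp_ln. Qed.

Lemma log_radius_radius x y : punctured x y -> log_radius x y = ln (radius x y).
Proof.
intros H. unfold log_radius, radius.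
assert (Hs : 0 < sqrt (x ^ 2 + y ^ 2)) by now apply sqrt_lt_R0.
assert (E : ln (x ^ 2 + y ^ 2) = ln (sqrt (x ^ 2 + y ^ 2)) + ln (sqrt (x ^ 2 + y ^ 2))).
{ rewrite <- ln_mult by auto. now rewrite sqrt_sqrt by (left; exact H). }
rewrite E. field.
Qed.

Lemma radius_punctured x y : 0 < radius x y -> punctured x y.
Proof.
intros H. unfold punctured. destruct (Rlt_le_dec 0 (x ^ 2 + y ^ 2)) as [|Hle]; auto.
unfold radius in H. rewrite sqrt_neg_0 in H by auto. lra.
Qed.

Lemma radius_sqr x y : radius x y ^ 2 = x ^ 2 + y ^ 2.
Proof. unfold radius. apply pow2_sqrt. generalize (pow2_ge_0 x) (pow2_ge_0 y). lra. Qed.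

(** Both partial derivatives of [rfield] have this shape, so the four second derivatives are
    instances of one computation. *)
Lemma gradient_form_derive (j f i c g d : R -> R) (j1 f1 i1 c1 g1 d1 m x : R) :
  is_derive j x j1 -> is_derive f x f1 -> is_derive i x i1 -> is_derive c x c1 -> is_derive g x g1 -> is_derive d x d1 ->
  is_derive (fun t => f t * (j t * i t) * c t + g t * (m * d t)) x
    (f1 * (j x * i x) * c x + f x * (j1 * i x + j x * i1) * c x + f x * (j x * i x) * c1 + g1 * (m * d x) + g x * (m * d1)).
Proof.
intros H1 H2 H3 H4 H5 H6. derive_fields.
rw_derive H1; rw_derive H2; rw_derive H3; rw_derive H4; rw_derive H5; rw_derive H6. ring.
Qed.

Lemma inv_rho_dx x y : punctured x y ->
  is_derive (fun t => / (t ^ 2 + y ^ 2)) x (-2 * x * (/ (x ^ 2 + y ^ 2)) ^ 2).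
Proof. intros H. unfold punctured in H. auto_derive. simpl in *; lra. field. lra. Qed.
Lemma inv_rho_dy x y : punctured x y ->
  is_derive (fun t => / (x ^ 2 + t ^ 2)) y (-2 * y * (/ (x ^ 2 + y ^ 2)) ^ 2).
Proof. intros H. unfold punctured in H. auto_derive. simpl in *; lra. field. lra. Qed.

Section RadialProduct.
Variables (phi phi' phi'' : R -> R).
Hypothesis Hphi : forall t, is_derive phi t (phi' t).
Hypothesis Hphi' : forall t, is_derive phi' t (phi'' t).
Variable n : nat.

Definition rfield x y := phi (log_radius x y) * re_pow (S n) x y.
Definition ifield x y := phi (log_radius x y) * im_pow (S n) x y.
Local Notation P x y := (phi (log_radius x y)).
Local Notation P' x y := (phi' (log_radius x y)).
Local Notation P'' x y := (phi'' (log_radius x y)).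
Local Notation ir x y := (/ (x ^ 2 + y ^ 2)).
Local Notation N := (INR (S n)).

Lemma rfield_dx x y : punctured x y ->
  dx rfield x y = P' x y * (x * ir x y) * re_pow (S n) x y + P x y * (N * re_pow n x y).
Proof.
intros H. apply is_derive_unique.
apply (is_derive_mult (fun t => phi (log_radius t y)) (fun t => re_pow (S n) t y)).
- apply radial_dx; auto.
- apply (pow_derivatives (S n) x y).
- intros; apply Rmult_comm.
Qed.

Lemma rfield_dy x y : punctured x y ->
  dy rfield x y = P' x y * (y * ir x y) * re_pow (S n) x y + P x y * (- N * im_pow n x y).
Proof.
intros H. apply is_derive_unique.
apply (is_derive_mult (fun t => phi (log_radius x t)) (fun t => re_pow (S n) x t)).
- apply radial_dy; auto.
- apply (pow_derivatives (S n) x y).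
- intros; apply Rmult_comm.
Qed.

Lemma ifield_dx x y : punctured x y ->
  dx ifield x y = P' x y * (x * ir x y) * im_pow (S n) x y + P x y * (N * im_pow n x y).
Proof.
intros H. apply is_derive_unique.
apply (is_derive_mult (fun t => phi (log_radius t y)) (fun t => im_pow (S n) t y)).
- apply radial_dx; auto.
- apply (pow_derivatives (S n) x y).
- intros; apply Rmult_comm.
Qed.

Lemma ifield_dy x y : punctured x y ->
  dy ifield x y = P' x y * (y * ir x y) * im_pow (S n) x y + P x y * (N * re_pow n x y).
Proof.
intros H. apply is_derive_unique.
apply (is_derive_mult (fun t => phi (log_radius x t)) (fun t => im_pow (S n) x t)).
- apply radial_dy; auto.
- apply (pow_derivatives (S n) x y).
- intros; apply Rmult_comm.
Qed.

Lemma rfield_second x y : punctured x y ->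
  let C := re_pow (S n) x y in let C1 := N * re_pow n x y in let S1 := N * im_pow n x y in
  let C2 := N * (INR n * re_pow (pred n) x y) in let S2 := N * (INR n * im_pow (pred n) x y) in
  let i := ir x y in
  dx (dx rfield) x y = P'' x y * (x * i) ^ 2 * C + P' x y * (i - 2 * (x * i) ^ 2) * C + 2 * (P' x y * (x * i) * C1) + P x y * C2 /\
  dy (dy rfield) x y = P'' x y * (y * i) ^ 2 * C + P' x y * (i - 2 * (y * i) ^ 2) * C - 2 * (P' x y * (y * i) * S1) - P x y * C2 /\
  dx (dy rfield) x y = (P'' x y - 2 * P' x y) * (x * i) * (y * i) * C + P' x y * (y * i) * C1 - P' x y * (x * i) * S1 - P x y * S2 /\
  dy (dx rfield) x y = (P'' x y - 2 * P' x y) * (x * i) * (y * i) * C + P' x y * (y * i) * C1 - P' x y * (x * i) * S1 - P x y * S2.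
Proof.
intros H C C1 S1 C2 S2 i.
assert (Hne : x ^ 2 + y ^ 2 <> 0) by (apply Rgt_not_eq, H).
assert (Dxp := radial_dx phi _ x y H (Hphi _)). assert (Dyp := radial_dy phi _ x y H (Hphi _)).
assert (Dxp' := radial_dx phi' _ x y H (Hphi' _)). assert (Dyp' := radial_dy phi' _ x y H (Hphi' _)).
destruct (pow_derivatives (S n) x y) as (A1 & A2 & A3 & A4).
destruct (pow_derivatives n x y) as (B1 & B2 & B3 & B4).
cbv beta in *. change (pred (S n)) with n in *.
assert (Ix := inv_rho_dx x y H). assert (Iy := inv_rho_dy x y H).
assert (Hx := is_derive_id x : is_derive (fun t => t) x 1). assert (Hy := is_derive_id y : is_derive (fun t => t) y 1).
assert (Kx := is_derive_const y x : is_derive (fun _ => y) x 0). assert (Ky := is_derive_const x y : is_derive (fun _ => x) y 0).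
split; [|split; [|split]].
- rewrite (dx_ext _ _ rfield_dx x y H).
  etransitivity; [exact (is_derive_unique _ _ _ (gradient_form_derive _ _ _ _ _ _ _ _ _ _ _ _ N x Hx Dxp' Ix A1 Dxp B1))|].
  unfold C, C1, S1, C2, S2, i. field. auto.
- rewrite (dy_ext _ _ rfield_dy x y H).
  etransitivity; [exact (is_derive_unique _ _ _ (gradient_form_derive _ _ _ _ _ _ _ _ _ _ _ _ (- N) y Hy Dyp' Iy A3 Dyp B4))|].
  unfold C, C1, S1, C2, S2, i. field. auto.
- rewrite (dx_ext _ _ rfield_dy x y H).
  etransitivity; [exact (is_derive_unique _ _ _ (gradient_form_derive _ _ _ _ _ _ _ _ _ _ _ _ (- N) x Kx Dxp' Ix A1 Dxp B2))|].
  unfold C, C1, S1, C2, S2, i. field. auto.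
- rewrite (dy_ext _ _ rfield_dx x y H).
  etransitivity; [exact (is_derive_unique _ _ _ (gradient_form_derive _ _ _ _ _ _ _ _ _ _ _ _ N y Ky Dyp' Iy A3 Dyp B3))|].
  unfold C, C1, S1, C2, S2, i. field. auto.
Qed.

(** [r^2] times the shear [e_r . (grad v + grad v^T) e_theta] of [v = (- psi_y, psi_x)]. *)
Lemma rfield_shear x y : punctured x y -> P x y = 0 ->
  4 * x * y * dx (dy rfield) x y + (x ^ 2 - y ^ 2) * (dx (dx rfield) x y - dy (dy rfield) x y) =
  (P'' x y - 2 * P' x y + 2 * N * P' x y) * re_pow (S n) x y.
Proof.
intros H H0. destruct (rfield_second x y H) as (E1 & E2 & E3 & _). rewrite E1, E2, E3, H0.
assert (Hne : x ^ 2 + y ^ 2 <> 0) by (apply Rgt_not_eq, H).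
rewrite re_pow_S. field. auto.
Qed.

Lemma rfield_laplacian x y : punctured x y ->
  laplacian rfield x y = (P'' x y + 2 * N * P' x y) * ir x y * re_pow (S n) x y.
Proof.
intros H. unfold laplacian. destruct (rfield_second x y H) as (E1 & E2 & _). rewrite E1, E2.
assert (Hne : x ^ 2 + y ^ 2 <> 0) by (apply Rgt_not_eq, H).
rewrite re_pow_S. field. auto.
Qed.
End RadialProduct.

(** The Cauchy-Riemann equations in polar coordinates, after factoring out [exp (N t)]. *)
Lemma conjugate_fields (phi chi : R -> R) (n : nat) x y :
  (forall t, is_derive phi t (INR (S n) * (chi t - phi t))) ->
  (forall t, is_derive chi t (INR (S n) * (phi t - chi t))) -> punctured x y ->
  dx (ifield chi n) x y = - dy (rfield phi n) x y /\ dy (ifield chi n) x y = dx (rfield phi n) x y.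
Proof.
intros Hp Hc H.
rewrite (ifield_dx _ _ Hc n x y H), (ifield_dy _ _ Hc n x y H), (rfield_dx _ _ Hp n x y H), (rfield_dy _ _ Hp n x y H).
assert (Hne : x ^ 2 + y ^ 2 <> 0) by (apply Rgt_not_eq, H).
rewrite re_pow_S, im_pow_S. split; field; auto.
Qed.

Lemma RInt_cos_nat (n : nat) : RInt (fun t => cos (INR (S n) * t)) 0 (2 * PI) = 0.
Proof.
assert (Hn : INR (S n) <> 0) by (apply not_0_INR; lia).
rewrite (is_RInt_unique _ _ _ (sin (INR (S n) * (2 * PI)) / INR (S n) - sin (INR (S n) * 0) / INR (S n))).
- rewrite Rmult_0_r. replace (INR (S n) * (2 * PI)) with (0 + 2 * INR (S n) * PI) by ring.
  rewrite sin_period, sin_0. apply Rminus_diag.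
- apply (is_RInt_FTC (fun t => sin (INR (S n) * t) / INR (S n))).
  + intros t _. revert Hn. generalize (INR (S n)). intros m Hm. auto_derive; auto. field; auto.
  + intros t _. apply (ex_derive_continuous (fun t => cos (INR (S n) * t))). auto_derive; auto.
Qed.

Ltac as_real_eq := match goal with |- @eq _ ?u ?v => change (@eq R u v) end.

Lemma annulus_open (a b x y : R) : 0 < a -> annulus a b x y -> locally_2d (annulus a b) x y.
Proof.
intros Ha [H1 H2].
assert (Hc : continuity_2d_pt radius x y).
{ apply (continuity_1d_2d_pt_comp sqrt (fun x y => x ^ 2 + y ^ 2)).
  - apply continuous_pt, continuous_sqrt.
  - apply sum_squares_cont. }
assert (He : 0 < Rmin (radius x y - a) (b - radius x y)) by (apply Rmin_pos; lra).
destruct (Hc (mkposreal _ He)) as [d Hd]. exists d. intros u v Hu Hv.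
specialize (Hd u v Hu Hv). simpl in Hd. apply Rabs_lt_between in Hd.
generalize (Rmin_l (radius x y - a) (b - radius x y)) (Rmin_r (radius x y - a) (b - radius x y)).
unfold annulus. lra.
Qed.

Lemma exp_weight_derive (f : R -> R) (f1 m t : R) : is_derive f t f1 ->
  is_derive (fun t => f t * exp (- m * t)) t ((f1 - m * f t) * exp (- m * t)).
Proof. intros H. derive_fields. rw_derive H. ring. Qed.

Section Eigenfield.
Variables a b alpha mu kappa : R.
Hypothesis Ha : 0 < a.
Hypothesis Hab : a < b.
Hypothesis Hmu : 0 < mu.
Hypothesis Hkappa : kappa <> 0.
Variable n : nat.
Definition slip_coef (a alpha mu : R) : R := (2 / a - alpha / mu) / a.
Local Notation nu := (INR (S n)).
Hypothesis Hchar : charac a b nu (slip_coef a alpha mu) kappa = 0.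

Let Hnu : 0 < nu.
Proof. apply lt_0_INR; lia. Qed.

(** The weight e^{- nu t} cancels the factor r^n carried by [re_pow], so that [rfield psi n] is the
    stream profile times the cosine of the angular mode. *)
Let psi (t : R) : R := stream a b nu kappa t * exp (- nu * t).
Let psi' (t : R) : R := (stream' a b nu kappa t - nu * stream a b nu kappa t) * exp (- nu * t).
Let psi'' (t : R) : R := (nu ^ 2 * stream a b nu kappa t + exp (2 * t) * fund b nu kappa t
   - 2 * nu * stream' a b nu kappa t + nu ^ 2 * stream a b nu kappa t) * exp (- nu * t).
Let om (t : R) : R := fund b nu kappa t * exp (- nu * t).
Let c0 : R := fund b nu kappa (ln a).
(** [eta] carries the harmonic function w - kappa psi and [pr] its harmonic conjugate, obtained as
    h' / nu from the profile h; mu times the conjugate is the pressure. *)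
Let eta (t : R) : R := c0 * (harm a b nu t * exp (- nu * t)).
Let pr (t : R) : R := c0 * (harm' a b nu t / nu * exp (- nu * t)).

Let Dpsi t : is_derive psi t (psi' t).
Proof. apply (exp_weight_derive (stream a b nu kappa)). now apply is_derive_stream. Qed.
Let Dpsi' t : is_derive psi' t (psi'' t).
Proof.
unfold psi''. evar_last.
- apply (exp_weight_derive (fun t => stream' a b nu kappa t - nu * stream a b nu kappa t)).
  apply (is_derive_minus (stream' a b nu kappa) (fun t => nu * stream a b nu kappa t)).
  + now apply is_derive_stream'.
  + apply (is_derive_scal (stream a b nu kappa)). now apply is_derive_stream.
- as_real_eq. change (minus ?x ?y) with (x - y). change (scal nu ?x) with (nu * x). ring.
Qed.
Let Deta t : is_derive eta t (nu * (pr t - eta t)).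
Proof.
unfold pr, eta. evar_last.
- apply (is_derive_scal (fun t => harm a b nu t * exp (- nu * t))).
  apply (exp_weight_derive (harm a b nu)). now apply is_derive_harm.
- as_real_eq. change (scal c0 ?x) with (c0 * x). field. lra.
Qed.
Let Dpr t : is_derive pr t (nu * (eta t - pr t)).
Proof.
unfold pr, eta. evar_last.
- apply (is_derive_scal (fun t => harm' a b nu t / nu * exp (- nu * t))).
  apply (exp_weight_derive (fun t => harm' a b nu t / nu)).
  apply (is_derive_ext (fun t => / nu * harm' a b nu t)). { intros; unfold Rdiv; apply Rmult_comm. }
  apply (is_derive_scal (harm' a b nu)). now apply is_derive_harm'.
- as_real_eq. change (scal c0 ?x) with (c0 * x). field. lra.
Qed.

Lemma Ck_line_ext (k : nat) (f g : R -> R) : (forall t, f t = g t) -> Ck_line k f -> Ck_line k g.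
Proof.
destruct k as [|k]; simpl.
- intros H Hf t. apply (continuous_ext f); auto.
- intros H (f' & H1 & H2). exists f'. split; auto. intros t. apply (is_derive_ext f); auto.
Qed.

Lemma Ck_line_fund (k : nat) (m l : R) : Ck_line k (fund b m l) /\ Ck_line k (fund' b m l).
Proof.
induction k as [|k [IH1 IH2]].
- split; intros t; eapply is_derive_cont; [apply is_derive_fund|apply is_derive_fund'].
- split.
  + exists (fund' b m l). split; auto. intros; apply is_derive_fund.
  + exists (fun t => coef m l t * fund b m l t). split. intros; apply is_derive_fund'.
    apply Ck_line_mult; auto. unfold coef. apply Ck_line_plus. apply Ck_line_const. apply Ck_line_mult. apply Ck_line_const. apply Ck_line_exp.
Qed.

Lemma Ck_line_harm (k : nat) (m : R) : 0 < m -> Ck_line k (harm a b m) /\ Ck_line k (harm' a b m).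
Proof.
intros Hm. induction k as [|k [IH1 IH2]].
- split; intros t; eapply is_derive_cont; [apply is_derive_harm|apply is_derive_harm']; auto.
- split.
  + exists (harm' a b m). split; auto. intros; now apply is_derive_harm.
  + exists (fun t => m ^ 2 * harm a b m t). split. intros; now apply is_derive_harm'.
    apply Ck_line_mult; auto. apply Ck_line_const.
Qed.

Let Spsi k : smooth_to k (rfield psi n).
Proof.
apply smooth_mult; [|apply smooth_pow].
apply (smooth_radial k psi). unfold psi, stream.
apply Ck_line_mult; [|apply Ck_line_exp].
apply (Ck_line_ext k (fun t => / kappa * (fund b nu kappa t + (- c0) * harm a b nu t))).
{ intros t. unfold c0. field. auto. }
apply Ck_line_mult. apply Ck_line_const. apply Ck_line_plus. apply Ck_line_fund. apply Ck_line_mult. apply Ck_line_const. now apply Ck_line_harm.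
Qed.
Let Som k : smooth_to k (rfield om n).
Proof.
apply smooth_mult; [|apply smooth_pow].
apply (smooth_radial k om). unfold om.
apply Ck_line_mult; [|apply Ck_line_exp]. apply Ck_line_fund.
Qed.
Let Spr k : smooth_to k (ifield pr n).
Proof.
apply smooth_mult; [|apply smooth_pow].
apply (smooth_radial k pr). unfold pr.
apply Ck_line_mult. apply Ck_line_const.
apply Ck_line_mult; [|apply Ck_line_exp].
apply (Ck_line_ext k (fun t => / nu * harm' a b nu t)). intros t; field; lra.
apply Ck_line_mult. apply Ck_line_const. now apply Ck_line_harm.
Qed.

Lemma eigenfield_vorticity x y : punctured x y -> laplacian (rfield psi n) x y = rfield om n x y.
Proof.
intros H. rewrite (rfield_laplacian _ _ _ Dpsi Dpsi' n x y H).
unfold rfield, om, psi', psi''. rewrite exp_log_radius by auto.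
assert (Hne : x ^ 2 + y ^ 2 <> 0) by (apply Rgt_not_eq, H). field. auto.
Qed.

(** The definition of [stream] read backwards: the vorticity is kappa psi plus a harmonic function,
    whose rotated gradient is the gradient of its conjugate. *)
Lemma eigenfield_remainder x y : rfield om n x y = kappa * rfield psi n x y + rfield eta n x y.
Proof. unfold rfield, om, psi, eta, stream, c0. field. auto. Qed.

Definition eigen_velocity : vector_field := fun x y => (- dy (rfield psi n) x y, dx (rfield psi n) x y).
Definition eigen_pressure : scalar_field := fun x y => mu * ifield pr n x y.

(** The Laplacian commutes with the rotated gradient, so mu Delta v - mu kappa v is mu times the
    rotated gradient of the harmonic remainder, which Cauchy-Riemann identifies with the pressure
    gradient. *)
Lemma eigenfield_momentum x y : punctured x y ->
  mu * laplacian (comp1 eigen_velocity) x y - dx eigen_pressure x y = mu * kappa * comp1 eigen_velocity x y /\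
  mu * laplacian (comp2 eigen_velocity) x y - dy eigen_pressure x y = mu * kappa * comp2 eigen_velocity x y.
Proof.
intros H. destruct (conjugate_fields eta pr n x y Deta Dpr H) as [E1 E2].
assert (Hx : dx eigen_pressure x y = mu * dx (ifield pr n) x y) by exact (Derive_scal (fun t => ifield pr n t y) mu x).
assert (Hy : dy eigen_pressure x y = mu * dy (ifield pr n) x y) by exact (Derive_scal (fun t => ifield pr n x t) mu y).
assert (L1 : laplacian (comp1 eigen_velocity) x y = - dy (rfield om n) x y).
{ unfold comp1, eigen_velocity, laplacian; cbn [fst snd].
  change (dx (dx (fun x y => - dy (rfield psi n) x y)) x y + dy (dy (fun x y => - dy (rfield psi n) x y)) x y = - dy (rfield om n) x y).
  rewrite (dx_ext _ (fun x y => - dx (dy (rfield psi n)) x y)) by (auto; intros; apply dx_opp).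
  rewrite (dy_ext _ (fun x y => - dy (dy (rfield psi n)) x y)) by (auto; intros; apply dy_opp).
  rewrite dx_opp, dy_opp, <- Ropp_plus_distr. f_equal.
  change (laplacian (dy (rfield psi n)) x y = dy (rfield om n) x y).
  rewrite laplacian_dy by auto. apply dy_ext; auto. intros; now apply eigenfield_vorticity. }
assert (L2 : laplacian (comp2 eigen_velocity) x y = dx (rfield om n) x y).
{ change (laplacian (dx (rfield psi n)) x y = dx (rfield om n) x y).
  rewrite laplacian_dx by auto. apply dx_ext; auto. intros; now apply eigenfield_vorticity. }
assert (G1 : dx (rfield om n) x y = kappa * dx (rfield psi n) x y + dx (rfield eta n) x y).
{ apply is_derive_unique. apply (is_derive_ext (fun t => kappa * rfield psi n t y + rfield eta n t y)).
  intros t; now rewrite eigenfield_remainder.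
  apply (is_derive_plus (fun t => kappa * rfield psi n t y) (fun t => rfield eta n t y)).
  apply (is_derive_scal (fun t => rfield psi n t y)). now apply (is_derive_dx 0).
  apply Derive_correct. exists (nu * (pr (log_radius x y) - eta (log_radius x y)) * (x * / (x ^ 2 + y ^ 2)) * re_pow (S n) x y + eta (log_radius x y) * (nu * re_pow n x y)).
  apply (is_derive_mult (fun t => eta (log_radius t y)) (fun t => re_pow (S n) t y)).
  now apply radial_dx. apply (pow_derivatives (S n)). intros; apply Rmult_comm. }
assert (G2 : dy (rfield om n) x y = kappa * dy (rfield psi n) x y + dy (rfield eta n) x y).
{ apply is_derive_unique. apply (is_derive_ext (fun t => kappa * rfield psi n x t + rfield eta n x t)).
  intros t; now rewrite eigenfield_remainder.
  apply (is_derive_plus (fun t => kappa * rfield psi n x t) (fun t => rfield eta n x t)).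
  apply (is_derive_scal (fun t => rfield psi n x t)). now apply (is_derive_dy 0).
  apply Derive_correct. exists (nu * (pr (log_radius x y) - eta (log_radius x y)) * (y * / (x ^ 2 + y ^ 2)) * re_pow (S n) x y + eta (log_radius x y) * (- nu * im_pow n x y)).
  apply (is_derive_mult (fun t => eta (log_radius x t)) (fun t => re_pow (S n) x t)).
  now apply radial_dy. apply (pow_derivatives (S n)). intros; apply Rmult_comm. }
rewrite L1, L2, Hx, Hy, E1, E2, G1, G2.
unfold comp1, comp2, eigen_velocity; simpl fst; simpl snd. split; ring.
Qed.

Lemma smooth_Ck_closed (k : nat) (f : R -> R -> R) : smooth_to k f -> Ck_closed a b k f.
Proof.
intros Hf x y [Hr _]. apply (locally_2d_impl punctured).
- apply locally_2d_forall. exact Hf.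
- apply punctured_open, radius_punctured. lra.
Qed.

Lemma eigenfield_regular : regular a b eigen_velocity eigen_pressure.
Proof.
split; [|split]; apply smooth_Ck_closed.
- apply (smooth_to_ext 2 (fun x y => (-1) * dy (rfield psi n) x y)).
  + intros x y _. unfold comp1, eigen_velocity; simpl; ring.
  + apply smooth_mult. apply smooth_const. now apply smooth_dy.
- apply (smooth_dx 2 (rfield psi n)); auto.
- apply smooth_mult; auto. apply smooth_const.
Qed.

Lemma eigenfield_gradient x y : punctured x y ->
  dx (comp1 eigen_velocity) x y = - dx (dy (rfield psi n)) x y /\ dy (comp1 eigen_velocity) x y = - dy (dy (rfield psi n)) x y /\
  dx (comp2 eigen_velocity) x y = dx (dx (rfield psi n)) x y /\ dy (comp2 eigen_velocity) x y = dy (dx (rfield psi n)) x y.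
Proof.
intros H. split; [|split; [|split]]; try reflexivity.
- apply dx_opp.
- apply dy_opp.
Qed.

Lemma eigenfield_curl x y : punctured x y -> curl eigen_velocity x y = rfield om n x y.
Proof.
intros H. unfold curl. destruct (eigenfield_gradient x y H) as (_ & E2 & E3 & _). rewrite E2, E3.
rewrite <- eigenfield_vorticity by auto. unfold laplacian. ring.
Qed.

Lemma eigenfield_boundary : boundary_conditions a b alpha mu eigen_velocity eigen_pressure.
Proof.
split.
- intros x y Hr.
  assert (H : punctured x y) by (apply radius_punctured; lra).
  assert (Hl : log_radius x y = ln a) by (rewrite log_radius_radius, Hr; auto).
  assert (Hs := radius_sqr x y). rewrite Hr in Hs.
  assert (P0 : psi (ln a) = 0) by (unfold psi; rewrite stream_a by auto; ring).
  assert (Hne : a ^ 2 <> 0) by (apply Rgt_not_eq, pow_lt; auto).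
  unfold dot, normal_inner, tau, traction. rewrite Hr.
  destruct (eigenfield_gradient x y H) as (E1 & E2 & E3 & E4). rewrite E1, E2, E3, E4.
  assert (M := rfield_shear _ _ _ Dpsi Dpsi' n x y H). rewrite Hl, P0 in M. specialize (M eq_refl).
  rewrite (dx_dy_comm (rfield psi n)) in M |- * by auto.
  set (pxx := dx (dx (rfield psi n)) x y) in *. set (pyy := dy (dy (rfield psi n)) x y) in *.
  set (pxy := dy (dx (rfield psi n)) x y) in *.
  unfold eigen_velocity. cbn [fst snd].
  rewrite (rfield_dx _ _ Dpsi n x y H), (rfield_dy _ _ Dpsi n x y H), Hl, P0.
  rewrite <- Hs. split; [field; lra|].
  assert (Hbc := charac_boundary a b Ha Hab nu kappa (slip_coef a alpha mu) Hnu Hkappa Hchar).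
  (* With psi = 0 and w = g d_t psi at [ln a], where g is [slip_coef], the shear is (a^2 g - 2)
     psi'; the value of [slip_coef] makes mu (a^2 g - 2) equal to - alpha a. *)
  assert (Hp2 : psi'' (ln a) - 2 * psi' (ln a) + 2 * nu * psi' (ln a) = (a ^ 2 * slip_coef a alpha mu - 2) * psi' (ln a)).
  { unfold psi'', psi'. rewrite stream_a, exp_2ln, Hbc by auto. ring. }
  rewrite Hp2 in M. set (p := psi' (ln a)) in *. set (g := slip_coef a alpha mu) in *.
  assert (Hg : mu * (a ^ 2 * g - 2) = - alpha * a) by (unfold g, slip_coef; field; lra).
  set (C := re_pow (S n) x y) in *.
  transitivity (- mu / a ^ 2 * (4 * x * y * pxy + (x ^ 2 - y ^ 2) * (pxx - pyy))).
  { field. lra. }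
  rewrite M. replace (- mu / a ^ 2 * ((a ^ 2 * g - 2) * p * C)) with (- (mu * (a ^ 2 * g - 2)) * p * C / a ^ 2) by (field; lra).
  rewrite Hg.
  transitivity (alpha * p * C * (x ^ 2 + y ^ 2) / a ^ 3); [rewrite <- Hs|]; field; lra.
- intros x y Hr.
  assert (H : punctured x y) by (apply radius_punctured; lra).
  assert (Hl : log_radius x y = ln b) by (rewrite log_radius_radius, Hr; auto).
  assert (Hs := radius_sqr x y). rewrite Hr in Hs.
  assert (P0 : psi (ln b) = 0) by (unfold psi; rewrite stream_b by auto; ring).
  split.
  + unfold dot, normal_outer, eigen_velocity. simpl fst. simpl snd. rewrite Hr.
    rewrite (rfield_dx _ _ Dpsi n x y H), (rfield_dy _ _ Dpsi n x y H), Hl, P0.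
    rewrite <- Hs. field. lra.
  + rewrite eigenfield_curl by auto. unfold rfield, om. rewrite Hl, fund_b. ring.
Qed.

Lemma eigenfield_incompressible : incompressible a b eigen_velocity.
Proof.
intros x y [Hr _]. assert (H : punctured x y) by (apply radius_punctured; lra).
unfold divergence. destruct (eigenfield_gradient x y H) as (E1 & _ & _ & E4). rewrite E1, E4.
rewrite dx_dy_comm by auto. ring.
Qed.

Lemma polar_radius r t : 0 < r -> radius (r * cos t) (r * sin t) = r.
Proof.
intros Hr. unfold radius. replace ((r * cos t) ^ 2 + (r * sin t) ^ 2) with (r ^ 2).
- replace (r ^ 2) with (r * r) by ring. apply sqrt_square; lra.
- generalize (sin2_cos2 t). unfold Rsqr. intros H.
  replace ((r * cos t) ^ 2 + (r * sin t) ^ 2) with (r ^ 2 * (sin t * sin t + cos t * cos t)) by ring. rewrite H; ring.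
Qed.

Lemma eigenfield_average : average_condition a b eigen_velocity.
Proof.
intros r Hr. unfold circulation.
rewrite (RInt_ext _ (fun t => (psi' (ln r) + nu * psi (ln r)) * r ^ S n * cos (nu * t))).
- transitivity ((psi' (ln r) + nu * psi (ln r)) * r ^ S n * RInt (fun t => cos (nu * t)) 0 (2 * PI)).
  + apply (RInt_scal (V := R_CompleteNormedModule) (fun t => cos (nu * t))).
    apply (@ex_RInt_continuous R_CompleteNormedModule). intros t _.
    apply (ex_derive_continuous (fun t => cos (nu * t))). auto_derive; auto.
  + rewrite RInt_cos_nat. apply Rmult_0_r.
- intros t _. rewrite Rmult_assoc. destruct (pow_polar (S n) r t) as [<- _].
  assert (Hrad := polar_radius r t ltac:(lra)).
  set (x := r * cos t) in *. set (y := r * sin t) in *.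
  assert (H : punctured x y) by (apply radius_punctured; lra).
  assert (Hs := radius_sqr x y). rewrite Hrad in Hs.
  unfold dot, tau, eigen_velocity. simpl fst. simpl snd.
  rewrite (rfield_dx _ _ Dpsi n x y H), (rfield_dy _ _ Dpsi n x y H).
  rewrite log_radius_radius, Hrad by auto. rewrite re_pow_S.
  set (p := psi (ln r)). set (p' := psi' (ln r)).
  rewrite <- Hs.
  transitivity ((p' * ((x ^ 2 + y ^ 2) / r ^ 2) + nu * p) * (x * re_pow n x y - y * im_pow n x y)).
  + as_real_eq. field. lra.
  + rewrite <- Hs. as_real_eq. field. lra.
Qed.

(** A field vanishing on the open annulus has zero curl there, whereas on the positive x-axis this
    curl is [fund] times a positive factor. *)
Lemma eigenfield_nonzero : exists x y, annulus a b x y /\ eigen_velocity x y <> (0, 0).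
Proof.
destruct (Classical_Prop.classic (exists x y, annulus a b x y /\ eigen_velocity x y <> (0, 0))) as [|Hno]; auto.
exfalso.
assert (H0 : forall x y, annulus a b x y -> comp1 eigen_velocity x y = 0 /\ comp2 eigen_velocity x y = 0).
{ intros x y Hxy. destruct (Classical_Prop.classic (eigen_velocity x y = (0, 0))) as [He|He].
  - unfold comp1, comp2. rewrite He. simpl; auto.
  - exfalso. apply Hno. eauto. }
destruct (fund_nontrivial a b Ha Hab nu kappa) as [t [Ht Hft]].
set (x := exp t).
assert (Hx : a < x < b).
{ assert (exp (ln a) < x < exp (ln b)) by (split; apply exp_increasing; lra). rewrite !exp_ln in H by lra. auto. }
assert (Hann : forall u, a < u < b -> annulus a b u 0).
{ intros u Hu. unfold annulus. replace (radius u 0) with u; auto. unfold radius.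
  replace (u ^ 2 + 0 ^ 2) with (u * u) by ring. rewrite sqrt_square; lra. }
assert (Hp : punctured x 0) by (apply radius_punctured; generalize (proj1 (Hann x Hx)); lra).
assert (Hcurl : curl eigen_velocity x 0 = 0).
{ assert (Hloc := annulus_open a b x 0 Ha (Hann x Hx)). unfold curl.
  replace (dx (comp2 eigen_velocity) x 0) with 0.
  replace (dy (comp1 eigen_velocity) x 0) with 0; [ring|].
  - transitivity (Derive (fun _ => 0) 0); [symmetry; apply Derive_const|]. apply Derive_ext_loc.
    generalize (locally_2d_1d_const_x _ _ _ Hloc). apply filter_imp. intros u Hu. symmetry. now apply H0.
  - transitivity (Derive (fun _ => 0) x); [symmetry; apply Derive_const|]. apply Derive_ext_loc.
    generalize (locally_2d_1d_const_y _ _ _ Hloc). apply filter_imp. intros u Hu. symmetry. now apply H0. }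
rewrite eigenfield_curl in Hcurl by auto.
unfold rfield, om in Hcurl.
assert (Hr : radius x 0 = x).
{ unfold radius. replace (x ^ 2 + 0 ^ 2) with (x * x) by ring. apply sqrt_square; lra. }
rewrite log_radius_radius, Hr in Hcurl by auto.
replace (ln x) with t in Hcurl by (unfold x; now rewrite ln_exp).
assert (Hre : re_pow (S n) x 0 = x ^ S n).
{ generalize (proj1 (pow_polar (S n) x 0)). rewrite Rmult_0_r, sin_0, cos_0, Rmult_0_r, !Rmult_1_r. auto. }
rewrite Hre in Hcurl.
apply Rmult_integral in Hcurl. destruct Hcurl as [Hc|Hc].
- apply Rmult_integral in Hc. destruct Hc as [Hc|Hc]; [contradiction|].
  generalize (exp_pos (- nu * t)). lra.
- apply (pow_nonzero x (S n)); [lra|auto].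
Qed.

Lemma eigenvalue_of_charac : rest_eigenvalue a b alpha mu (mu * kappa).
Proof.
exists eigen_velocity, eigen_pressure. split; [apply eigenfield_regular|split; [|split; [|split; [|split]]]].
- intros x y [Hr _]. apply eigenfield_momentum. apply radius_punctured; lra.
- apply eigenfield_incompressible.
- apply eigenfield_boundary.
- apply eigenfield_average.
- apply eigenfield_nonzero.
Qed.
End Eigenfield.

(** * Completeness of the trigonometric system *)

Definition circle_int (f : R -> R) : R := RInt f 0 (2 * PI).

Lemma ex_RInt_everywhere (f : R -> R) (u v : R) : (forall t, continuous f t) -> ex_RInt f u v.
Proof. intros H. apply (@ex_RInt_continuous R_CompleteNormedModule). auto. Qed.

Lemma circle_int_plus (f g : R -> R) :
  (forall t, continuous f t) -> (forall t, continuous g t) ->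
  circle_int (fun t => f t + g t) = circle_int f + circle_int g.
Proof. intros Hf Hg. apply (RInt_plus (V := R_CompleteNormedModule) f g); now apply ex_RInt_everywhere. Qed.

Lemma circle_int_scal (c : R) (f : R -> R) :
  (forall t, continuous f t) -> circle_int (fun t => c * f t) = c * circle_int f.
Proof. intros Hf. apply (RInt_scal (V := R_CompleteNormedModule) f). now apply ex_RInt_everywhere. Qed.

Lemma circle_int_ext (f g : R -> R) : (forall t, f t = g t) -> circle_int f = circle_int g.
Proof. intros H. apply RInt_ext. auto. Qed.

Lemma cont_mult (f g : R -> R) : (forall t, continuous f t) -> (forall t, continuous g t) ->
  forall t, continuous (fun t => f t * g t) t.
Proof. intros Hf Hg t. apply (continuous_mult f g); auto. Qed.

Lemma cont_plus (f g : R -> R) : (forall t, continuous f t) -> (forall t, continuous g t) ->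
  forall t, continuous (fun t => f t + g t) t.
Proof. intros Hf Hg t. apply (continuous_plus f g); auto. Qed.

Lemma cont_cos_affine (m phi : R) : forall t, continuous (fun t => cos (m * t - phi)) t.
Proof. intros t. apply (ex_derive_continuous (fun t => cos (m * t - phi))). auto_derive; auto. Qed.

Lemma cont_sin_affine (m phi : R) : forall t, continuous (fun t => sin (m * t - phi)) t.
Proof. intros t. apply (ex_derive_continuous (fun t => sin (m * t - phi))). auto_derive; auto. Qed.

Lemma cont_const (c : R) : forall t, continuous (fun _ : R => c) t.
Proof. intros; apply continuous_const. Qed.
Lemma cont_cos : forall t, continuous cos t.
Proof. intros t. apply continuous_pt, continuity_cos. Qed.
Lemma cont_sin : forall t, continuous sin t.
Proof. intros t. apply continuous_pt, continuity_sin. Qed.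

Ltac prove_cont := cbv beta; lazymatch goal with
  | |- forall z, continuous (fun _ => ?c) z => apply (cont_const c)
  | |- forall z, continuous (fun z => @?f z + @?g z) z => apply (cont_plus f g); prove_cont
  | |- forall z, continuous (fun z => @?f z * @?g z) z => apply (cont_mult f g); prove_cont
  | |- forall z, continuous (fun z => cos (?k * z - ?l)) z => apply (cont_cos_affine k l)
  | |- forall z, continuous (fun z => sin (?k * z - ?l)) z => apply (cont_sin_affine k l)
  | |- forall z, continuous (fun z => cos z) z => apply cont_cos
  | |- forall z, continuous (fun z => sin z) z => apply cont_sin
  | |- _ => assumption
  end.

(** The free phase treats sines and cosines together and makes the class stable under multiplication
    by cos (t - t0). *)
Definition trig_orthogonal (g : R -> R) : Prop :=
  forall (n : nat) (phi : R), circle_int (fun t => g t * cos (INR n * t - phi)) = 0.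

(** The product-to-sum formula moves the frequency by one in both directions; frequency 0 is treated
    apart because it has no natural predecessor. *)
Lemma trig_orthogonal_kernel (g : R -> R) (c t0 : R) :
  (forall t, continuous g t) -> trig_orthogonal g ->
  trig_orthogonal (fun t => g t * (c + cos (1 * t - t0))).
Proof.
intros Hc Hg n phi.
destruct n as [|n].
- transitivity (circle_int (fun t => cos phi * (c * (g t * cos (INR 0 * t - 0))) + cos phi * (g t * cos (INR 1 * t - t0)))).
  + apply circle_int_ext. intros t. simpl INR. rewrite !Rmult_0_l, !Rminus_0_l, cos_neg, Ropp_0, cos_0. ring.
  + rewrite circle_int_plus, !circle_int_scal, !Hg by prove_cont. ring.
- transitivity (circle_int (fun t => c * (g t * cos (INR (S n) * t - phi)) +
     (1 / 2 * (g t * cos (INR (S (S n)) * t - (phi + t0))) + 1 / 2 * (g t * cos (INR n * t - (phi - t0)))))).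
  + apply circle_int_ext. intros t. rewrite !S_INR.
    replace ((INR n + 1 + 1) * t - (phi + t0)) with (((INR n + 1) * t - phi) + (1 * t - t0)) by ring.
    replace (INR n * t - (phi - t0)) with (((INR n + 1) * t - phi) - (1 * t - t0)) by ring.
    generalize ((INR n + 1) * t - phi) (1 * t - t0). intros u v.
    rewrite cos_plus, cos_minus. field.
  + rewrite !circle_int_plus, !circle_int_scal, !Hg by prove_cont. ring.
Qed.

Lemma trig_orthogonal_kernel_pow (g : R -> R) (c t0 : R) (N : nat) :
  (forall t, continuous g t) -> trig_orthogonal g ->
  circle_int (fun t => g t * (c + cos (1 * t - t0)) ^ N) = 0.
Proof.
intros Hc Hg.
assert (H : (forall t, continuous (fun t => g t * (c + cos (1 * t - t0)) ^ N) t) /\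
   trig_orthogonal (fun t => g t * (c + cos (1 * t - t0)) ^ N)).
{ induction N as [|N [IH1 IH2]].
  - split.
    + intros t. apply (continuous_ext g); auto. intros; simpl; ring.
    + intros n phi. rewrite <- (Hg n phi). apply circle_int_ext. intros; simpl; ring.
  - split.
    + intros t. apply (continuous_ext (fun t => g t * (c + cos (1 * t - t0)) ^ N * (c + cos (1 * t - t0)))).
      { intros; simpl; ring. }
      apply cont_mult; auto. apply cont_plus. intros; apply continuous_const. apply cont_cos_affine.
    + intros n phi. rewrite <- (trig_orthogonal_kernel _ c t0 IH1 IH2 n phi).
      apply circle_int_ext. intros; simpl; ring. }
rewrite <- (proj2 H 0%nat 0). apply circle_int_ext. intros t. simpl INR.
rewrite Rmult_0_l, Rminus_0_r, cos_0. ring.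
Qed.

Lemma cos_abs_ge (s d : R) : Rabs s <= d -> d <= PI -> cos d <= cos s.
Proof.
intros Hs Hd. assert (Hp := Rabs_pos s).
replace (cos s) with (cos (Rabs s)) by (unfold Rabs; destruct Rcase_abs; auto; apply cos_neg).
apply cos_decr_1; lra.
Qed.

Lemma cos_abs_le (s d : R) : 0 <= d -> d <= Rabs s -> Rabs s <= 2 * PI - d -> cos s <= cos d.
Proof.
intros Hd H1 H2.
replace (cos s) with (cos (Rabs s)) by (unfold Rabs; destruct Rcase_abs; auto; apply cos_neg).
destruct (Rle_lt_dec (Rabs s) PI).
- apply cos_decr_1; lra.
- replace (cos (Rabs s)) with (cos (2 * PI - Rabs s)).
  + apply cos_decr_1; lra.
  + rewrite cos_minus, cos_2PI, sin_2PI. ring.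
Qed.

Lemma RInt_lower_bound (f : R -> R) (u v m : R) : u <= v -> (forall t, continuous f t) ->
  (forall t, u <= t <= v -> m <= f t) -> m * (v - u) <= RInt f u v.
Proof.
intros Huv Hc Hm.
replace (m * (v - u)) with (RInt (fun _ => m) u v) by (rewrite RInt_const; apply Rmult_comm).
apply RInt_le; auto.
- apply ex_RInt_everywhere. intros; apply continuous_const.
- now apply ex_RInt_everywhere.
- intros x Hx. apply Hm. lra.
Qed.

(** The powers of [1 - cos d + cos (t - t0)], which exceeds 1 only for [|t - t0| < d], concentrate at [t0]. *)
Lemma trig_orthogonal_nonpos (g : R -> R) (t0 : R) :
  (forall t, continuous g t) -> trig_orthogonal g -> 0 < t0 < 2 * PI -> g t0 <= 0.
Proof.
intros Hc Hg Ht0. destruct (Rle_lt_dec (g t0) 0) as [|Hpos]; auto. exfalso.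
assert (HPI := PI_RGT_0). assert (HPI2 := PI2_1).
destruct (proj1 (continuous_pt g t0) (Hc t0) (g t0 / 2)) as [d0 [Hd0 Hnear]]; [lra|].
(* The window of half-width [d] stays in [0, 2 pi], keeps g above g(t0) / 2, and lies where the
   cosine of the distance decreases. *)
set (d := Rmin (d0 / 2) (Rmin 1 (Rmin t0 (2 * PI - t0)))).
assert (Hd : 0 < d) by (unfold d; repeat apply Rmin_pos; lra).
assert (Hd1 : d <= d0 / 2 /\ d <= 1 /\ d <= t0 /\ d <= 2 * PI - t0).
{ unfold d. generalize (Rmin_l (d0 / 2) (Rmin 1 (Rmin t0 (2 * PI - t0)))) (Rmin_r (d0 / 2) (Rmin 1 (Rmin t0 (2 * PI - t0))))
   (Rmin_l 1 (Rmin t0 (2 * PI - t0))) (Rmin_r 1 (Rmin t0 (2 * PI - t0))) (Rmin_l t0 (2 * PI - t0)) (Rmin_r t0 (2 * PI - t0)). lra. }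
assert (Hg2 : forall t, Rabs (t - t0) <= d -> g t0 / 2 <= g t).
{ intros t Ht. destruct (Req_dec t t0) as [->|Hne]; [lra|].
  assert (HH : Rabs (g t - g t0) < g t0 / 2).
  { apply (Hnear t). split; [split; [exact I|auto]|]. simpl. unfold R_dist. lra. }
  apply Rabs_lt_between in HH. lra. }
destruct (continuity_ab_maj (fun t => Rabs (g t)) 0 (2 * PI)) as [tm [Htm _]]; [lra| |].
{ intros c _. apply continuous_pt, (continuous_comp g Rabs); auto. apply continuous_Rabs. }
set (M := Rabs (g tm)) in *. cbv beta in Htm. fold M in Htm.
assert (HM : 0 <= M) by apply Rabs_pos.
set (eta := cos (d / 2) - cos d).
assert (Heta : 0 < eta) by (unfold eta; assert (cos d < cos (d / 2)) by (apply cos_decreasing_1; lra); lra).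
assert (HD : 0 < g t0 / 2 * (d * eta)) by (repeat apply Rmult_lt_0_compat; lra).
(* By Bernoulli, (1 + eta)^N >= 1 + N eta on the inner half of the window; this [N] makes its
   contribution exceed 2 pi M, the most that the rest can subtract. *)
destruct (INR_unbounded (2 * PI * M / (g t0 / 2 * (d * eta)))) as [N HN].
set (K := fun t => (1 - cos d) + cos (1 * t - t0)).
set (F := fun t => g t * K t ^ N).
assert (HF0 : circle_int F = 0) by (apply trig_orthogonal_kernel_pow; auto).
assert (HFc : forall t, continuous F t).
{ apply cont_mult; auto. intros t. apply (ex_derive_continuous (fun t => K t ^ N)). unfold K. auto_derive; auto. }
assert (Hout : forall t, 0 <= t <= 2 * PI -> d / 2 <= Rabs (t - t0) -> - M <= F t).
{ intros t Ht Hdt. unfold F. destruct (Rle_lt_dec (Rabs (t - t0)) d) as [Hin|Hin].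
  - apply Rle_trans with 0; [lra|]. apply Rmult_le_pos.
    + specialize (Hg2 t Hin). lra.
    + apply pow_le. unfold K. rewrite Rmult_1_l.
      generalize (cos_abs_ge (t - t0) d Hin). lra.
  - assert (HK : Rabs (K t) <= 1).
    { unfold K. rewrite Rmult_1_l. assert (H1 := cos_abs_le (t - t0) d ltac:(lra) ltac:(lra)).
      assert (H2 : Rabs (t - t0) <= 2 * PI - d) by (apply Rabs_le; lra).
      specialize (H1 H2). generalize (COS_bound (t - t0)) (COS_bound d). intros. apply Rabs_le. lra. }
    assert (HR : Rabs (g t * K t ^ N) <= M * 1).
    { rewrite Rabs_mult, <- RPow_abs. apply Rmult_le_compat; try apply Rabs_pos.
      - rewrite RPow_abs; apply Rabs_pos.
      - now apply Htm.
      - rewrite <- (pow1 N). apply pow_incr. split; [apply Rabs_pos|auto]. }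
    apply Rabs_le_between in HR. lra. }
assert (Hin : forall t, t0 - d / 2 <= t <= t0 + d / 2 -> g t0 / 2 * (1 + INR N * eta) <= F t).
{ intros t Ht. assert (Hdt : Rabs (t - t0) <= d / 2) by (apply Rabs_le; lra).
  unfold F. apply Rmult_le_compat; try lra.
  - generalize (pos_INR N). nra.
  - apply Hg2; lra.
  - apply Rle_trans with ((1 + eta) ^ N). now apply poly.
    apply pow_incr. split; [lra|]. unfold K, eta. rewrite Rmult_1_l.
    generalize (cos_abs_ge (t - t0) (d / 2) Hdt ltac:(lra)). lra. }
assert (H1 := RInt_lower_bound F 0 (t0 - d / 2) (- M) ltac:(lra) HFc).
assert (H2 := RInt_lower_bound F (t0 - d / 2) (t0 + d / 2) _ ltac:(lra) HFc Hin).
assert (H3 := RInt_lower_bound F (t0 + d / 2) (2 * PI) (- M) ltac:(lra) HFc).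
assert (HC1 := RInt_Chasles (V := R_CompleteNormedModule) F 0 (t0 - d / 2) (t0 + d / 2)
  (ex_RInt_everywhere _ _ _ HFc) (ex_RInt_everywhere _ _ _ HFc)).
assert (HC2 := RInt_Chasles (V := R_CompleteNormedModule) F 0 (t0 + d / 2) (2 * PI)
  (ex_RInt_everywhere _ _ _ HFc) (ex_RInt_everywhere _ _ _ HFc)).
change (RInt F 0 (t0 - d / 2) + RInt F (t0 - d / 2) (t0 + d / 2) = RInt F 0 (t0 + d / 2)) in HC1.
change (RInt F 0 (t0 + d / 2) + RInt F (t0 + d / 2) (2 * PI) = RInt F 0 (2 * PI)) in HC2.
unfold circle_int in HF0.
assert (H1' : - M * (t0 - d / 2 - 0) <= RInt F 0 (t0 - d / 2)).
{ apply H1. intros t Ht. apply Hout; [lra|]. rewrite Rabs_left1; lra. }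
assert (H3' : - M * (2 * PI - (t0 + d / 2)) <= RInt F (t0 + d / 2) (2 * PI)).
{ apply H3. intros t Ht. apply Hout; [lra|]. rewrite Rabs_pos_eq; lra. }
assert (HNd : 2 * PI * M < INR N * (g t0 / 2 * (d * eta))).
{ apply (Rmult_lt_compat_r (g t0 / 2 * (d * eta))) in HN; auto.
  replace (2 * PI * M / (g t0 / 2 * (d * eta)) * (g t0 / 2 * (d * eta))) with (2 * PI * M) in HN by (field; lra). auto. }
assert (0 <= M * d) by (apply Rmult_le_pos; lra).
assert (0 <= g t0 / 2 * d) by (apply Rmult_le_pos; lra).
nra.
Qed.

Lemma trig_complete (g : R -> R) (t0 : R) :
  (forall t, continuous g t) -> trig_orthogonal g -> 0 < t0 < 2 * PI -> g t0 = 0.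
Proof.
intros Hc Hg Ht0. apply Rle_antisym.
- now apply trig_orthogonal_nonpos.
- apply Ropp_le_cancel. rewrite Ropp_0.
  apply (trig_orthogonal_nonpos (fun t => - g t)); auto.
  + intros t. apply (continuous_opp g); auto.
  + intros n phi. rewrite <- (Rmult_0_r (-1)), <- (Hg n phi), <- circle_int_scal.
    * apply circle_int_ext; intros; ring.
    * apply cont_mult; auto. apply cont_cos_affine.
Qed.

(** * Angular Fourier coefficients of an eigenfield *)

Local Notation "f @[ r , t ]" := (f (r * cos t) (r * sin t))
  (at level 9, r at level 200, t at level 200, format "f  @[ r ,  t ]").

Definition C1_near (f : R -> R -> R) (x y : R) : Prop := locally_2d (fun u v => ex_diff_n f 1 u v) x y.

Lemma C1_near_open (f : R -> R -> R) x y : C1_near f x y -> locally_2d (C1_near f) x y.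
Proof. intros H. apply (locally_2d_impl_strong (fun u v => ex_diff_n f 1 u v)); auto. apply locally_2d_forall. auto. Qed.

Lemma C1_near_at (f : R -> R -> R) x y : C1_near f x y ->
  continuity_2d_pt f x y /\ continuity_2d_pt (dx f) x y /\ continuity_2d_pt (dy f) x y.
Proof. intros H. destruct (locally_2d_singleton _ _ _ H) as (H1 & _ & _ & (H2 & _) & (H3 & _)). auto. Qed.

Lemma C1_near_differentiable (f : R -> R -> R) x y : C1_near f x y ->
  differentiable_pt_lim f x y (dx f x y) (dy f x y).
Proof.
intros H. apply filterdiff_differentiable_pt_lim.
apply (is_derive_filterdiff f x y (dx f) (dy f x y)).
- apply locally_2d_locally in H. revert H. apply filter_imp. intros [u v] (_ & H1 & _). simpl in *. now apply Derive_correct.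
- destruct (locally_2d_singleton _ _ _ H) as (_ & _ & H2 & _). now apply Derive_correct.
- destruct (C1_near_at f x y H) as (_ & H2 & _). apply continuity_2d_pt_filterlim in H2. exact H2.
Qed.

Lemma polar_dr (f : R -> R -> R) r t : C1_near f (r * cos t) (r * sin t) ->
  is_derive (fun u => f @[u, t]) r
    ((dx f) @[r, t] * cos t + (dy f) @[r, t] * sin t).
Proof.
intros H. apply is_derive_Reals.
apply (derivable_pt_lim_comp_2d f (fun u => u * cos t) (fun u => u * sin t)).
- now apply C1_near_differentiable.
- apply is_derive_Reals. auto_derive; auto; ring.
- apply is_derive_Reals. auto_derive; auto; ring.
Qed.

Lemma polar_dt (f : R -> R -> R) r t : C1_near f (r * cos t) (r * sin t) ->
  is_derive (fun u => f @[r, u]) t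
    ((dx f) @[r, t] * (- r * sin t) + (dy f) @[r, t] * (r * cos t)).
Proof.
intros H. apply is_derive_Reals.
apply (derivable_pt_lim_comp_2d f (fun u => r * cos u) (fun u => r * sin u)).
- now apply C1_near_differentiable.
- apply is_derive_Reals. auto_derive; auto; ring.
- apply is_derive_Reals. auto_derive; auto; ring.
Qed.

Lemma polar_x_cont r t : continuity_2d_pt (fun u v => u * cos v) r t.
Proof.
apply continuity_2d_pt_mult. apply continuity_2d_pt_id1.
apply (continuity_1d_2d_pt_comp cos (fun _ v => v)). apply continuity_cos. apply continuity_2d_pt_id2.
Qed.
Lemma polar_y_cont r t : continuity_2d_pt (fun u v => u * sin v) r t.
Proof.
apply continuity_2d_pt_mult. apply continuity_2d_pt_id1.
apply (continuity_1d_2d_pt_comp sin (fun _ v => v)). apply continuity_sin. apply continuity_2d_pt_id2.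
Qed.

Lemma locally_2d_polar (P : R -> R -> Prop) r t :
  locally_2d P (r * cos t) (r * sin t) -> locally_2d (fun u v => P @[u, v]) r t.
Proof.
intros [d Hd].
apply (locally_2d_impl (fun u v => Rabs (u * cos v - r * cos t) < d /\ Rabs (u * sin v - r * sin t) < d)).
- apply locally_2d_forall. intros u v [H1 H2]. now apply Hd.
- apply locally_2d_and. apply (polar_x_cont r t d). apply (polar_y_cont r t d).
Qed.

Lemma continuity_2d_polar (f : R -> R -> R) r t : continuity_2d_pt f (r * cos t) (r * sin t) ->
  continuity_2d_pt (fun u v => f @[u, v]) r t.
Proof. intros H eps. exact (locally_2d_polar _ r t (H eps)). Qed.

Lemma continuity_2d_slice (f : R -> R -> R) r t : continuity_2d_pt f r t ->
  continuous (fun v => f r v) t /\ continuous (fun u => f u t) r.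
Proof.
intros H. split; apply continuous_pt; intros eps Heps; destruct (H (mkposreal _ Heps)) as [d Hd];
  (exists d; split; [apply cond_pos|]); intros v [_ Hv]; simpl in *; unfold R_dist in *; apply Hd; auto;
  rewrite Rminus_diag, Rabs_R0; apply cond_pos.
Qed.

Lemma polar_closed a b r t : 0 < a -> a <= r <= b -> closed_annulus a b (r * cos t) (r * sin t).
Proof. intros Ha Hr. unfold closed_annulus. rewrite polar_radius; lra. Qed.

Lemma cos_lipschitz u v : Rabs (cos u - cos v) <= Rabs (u - v) /\ Rabs (sin u - sin v) <= Rabs (u - v).
Proof.
split.
- destruct (MVT_gen cos v u (fun x => - sin x)) as [c [_ Hc]].
  + intros x _. auto_derive; auto; ring.
  + intros x _. apply continuity_cos.
  + rewrite Hc, Rabs_mult, Rabs_Ropp. rewrite <- (Rmult_1_l (Rabs (u - v))) at 2.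
    apply Rmult_le_compat_r. apply Rabs_pos. apply Rabs_le. generalize (SIN_bound c). lra.
- destruct (MVT_gen sin v u cos) as [c [_ Hc]].
  + intros x _. auto_derive; auto; ring.
  + intros x _. apply continuity_sin.
  + rewrite Hc, Rabs_mult. rewrite <- (Rmult_1_l (Rabs (u - v))) at 2.
    apply Rmult_le_compat_r. apply Rabs_pos. apply Rabs_le. generalize (COS_bound c). lra.
Qed.

(** Compactness of the circle: a local property along it persists on all nearby circles.
    Differentiation under the integral sign needs such uniformity in the angle. *)
Lemma circle_tube (P : R -> R -> Prop) r0 : 0 < r0 ->
  (forall t, locally_2d P (r0 * cos t) (r0 * sin t)) ->
  locally r0 (fun r => forall t, 0 <= t <= 2 * PI -> P @[r, t]).
Proof.
intros Hr0 H.
set (D := fun t => proj1_sig (locally_2d_ex_dec P _ _ (fun u v => Classical_Prop.classic (P u v)) (H t))).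
assert (HD : forall t u v, Rabs (u - r0 * cos t) < D t -> Rabs (v - r0 * sin t) < D t -> P u v).
{ intros t u v. unfold D. destruct (locally_2d_ex_dec _ _ _ _ _) as [d Hd]. simpl. apply Hd. }
(* Passing from the polar point (r0, s) to (r, t) moves each coordinate by at most |r - r0| + r0 |t
   - s|, hence the factor 1 + r0. *)
assert (Hpos : forall t, 0 < D t / (2 * (1 + r0))).
{ intros t. apply Rdiv_lt_0_compat. apply cond_pos. lra. }
destruct (compactness_value_1d 0 (2 * PI) (fun t => mkposreal _ (Hpos t))) as [d Hd].
exists d. intros r Hr t Ht. change (Rabs (r - r0) < d) in Hr.
destruct (Classical_Prop.classic (P @[r, t])) as [|Hn]; auto. exfalso.
apply (Hd t Ht). intros (s & Hs & Hts & Hds). apply Hn. simpl in Hts, Hds.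
destruct (cos_lipschitz t s) as [L1 L2].
assert (HDs : D s = D s / (2 * (1 + r0)) * (2 * (1 + r0)) :> R) by (field; lra).
assert (Hlip : forall c c', Rabs c <= 1 -> Rabs (c - c') <= Rabs (t - s) -> Rabs (r * c - r0 * c') < D s).
{ intros c c' Hc Hcc. replace (r * c - r0 * c') with ((r - r0) * c + r0 * (c - c')) by ring.
  eapply Rle_lt_trans; [apply Rabs_triang|]. rewrite !Rabs_mult, (Rabs_pos_eq r0) by lra.
  assert (Rabs (r - r0) * Rabs c <= Rabs (r - r0) * 1) by (apply Rmult_le_compat_l; auto; apply Rabs_pos).
  assert (r0 * Rabs (c - c') <= r0 * Rabs (t - s)) by (apply Rmult_le_compat_l; lra).
  assert (r0 * Rabs (t - s) <= r0 * (D s / (2 * (1 + r0)))) by (apply Rmult_le_compat_l; lra).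
  assert (Hps := Hpos s). rewrite HDs. nra. }
apply (HD s); apply Hlip; auto; apply Rabs_le.
generalize (COS_bound t); lra. generalize (SIN_bound t); lra.
Qed.

Definition fourier (f : R -> R -> R) (T : R -> R) (r : R) : R :=
  circle_int (fun t => f @[r, t] * T t).

Lemma fourier_derive (f : R -> R -> R) (T : R -> R) r0 : 0 < r0 ->
  (forall t, C1_near f (r0 * cos t) (r0 * sin t)) -> (forall t, continuous T t) ->
  is_derive (fourier f T) r0
    (circle_int (fun t => ((dx f) @[r0, t] * cos t + (dy f) @[r0, t] * sin t) * T t)).
Proof.
intros Hr0 Hf HT. assert (HPI := PI_RGT_0).
set (g := fun u v => f @[u, v] * T v).
assert (Hd : forall u v, C1_near f (u * cos v) (u * sin v) -> is_derive (fun z => g z v) u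
   (((dx f) @[u, v] * cos v + (dy f) @[u, v] * sin v) * T v)).
{ intros u v H. unfold g. rewrite Rmult_comm.
  apply (is_derive_ext (fun z => T v * f @[z, v])); [intros; apply Rmult_comm|].
  apply (is_derive_scal (fun z => f @[z, v])). now apply polar_dr. }
assert (Htube := circle_tube (C1_near f) r0 Hr0 (fun t => C1_near_open f _ _ (Hf t))).
unfold fourier, circle_int.
erewrite (RInt_ext _ (fun t => Derive (fun u => g u t) r0)).
- apply (is_derive_RInt_param g 0 (2 * PI) r0).
  + revert Htube. apply filter_imp. intros r Hr t Ht. rewrite Rmin_left, Rmax_right in Ht by lra.
    eexists. apply Hd. now apply Hr.
  + intros t _.
    apply (continuity_2d_pt_ext_loc (fun u v => ((dx f) @[u, v] * cos v + (dy f) @[u, v] * sin v) * T v)).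
    * apply (locally_2d_impl (fun u v => C1_near f (u * cos v) (u * sin v))).
      -- apply locally_2d_forall. intros u v H. symmetry. apply is_derive_unique. now apply Hd.
      -- apply (locally_2d_polar (C1_near f)). now apply C1_near_open.
    * destruct (C1_near_at f _ _ (Hf t)) as (_ & H1 & H2).
      apply continuity_2d_pt_mult; [|apply (continuity_1d_2d_pt_comp T (fun _ v => v)); [now apply continuous_pt|apply continuity_2d_pt_id2]].
      apply continuity_2d_pt_plus; apply continuity_2d_pt_mult.
      -- now apply (continuity_2d_polar (dx f)).
      -- apply (continuity_1d_2d_pt_comp cos (fun _ v => v)). apply continuity_cos. apply continuity_2d_pt_id2.
      -- now apply (continuity_2d_polar (dy f)).
      -- apply (continuity_1d_2d_pt_comp sin (fun _ v => v)). apply continuity_sin. apply continuity_2d_pt_id2.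
  + revert Htube. apply filter_imp. intros r Hr. apply (@ex_RInt_continuous R_CompleteNormedModule).
    intros t Ht. rewrite Rmin_left, Rmax_right in Ht by lra. unfold g.
    apply (continuous_mult (fun t => f @[r, t]) T); auto.
    destruct (C1_near_at f _ _ (Hr t Ht)) as (H1 & _).
    apply (continuity_2d_slice (fun u v => f @[u, v])). now apply continuity_2d_polar.
- intros t _. symmetry. apply is_derive_unique. now apply Hd.
Qed.

Lemma polar_continuous (f : R -> R -> R) r : (forall t, continuity_2d_pt f (r * cos t) (r * sin t)) ->
  forall t, continuous (fun t => f @[r, t]) t.
Proof.
intros H t. apply (continuity_2d_slice (fun u v => f @[u, v])). now apply continuity_2d_polar.
Qed.

(** The first integrand contains the angular derivative of f along the circle; periodicity removes
    the boundary terms. *)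
Lemma circle_by_parts (f : R -> R -> R) (T T' : R -> R) r :
  (forall t, C1_near f (r * cos t) (r * sin t)) ->
  (forall t, is_derive T t (T' t)) -> (forall t, continuous T' t) -> T 0 = T (2 * PI) ->
  circle_int (fun t => ((dx f) @[r, t] * (- r * sin t) + (dy f) @[r, t] * (r * cos t)) * T t)
   = - circle_int (fun t => f @[r, t] * T' t).
Proof.
intros Hf HT HT' Hper.
assert (HTc : forall t, continuous T t) by (intros t; eapply is_derive_cont; eauto).
assert (C0 := polar_continuous f r (fun t => proj1 (C1_near_at f _ _ (Hf t)))).
assert (C1 := polar_continuous (dx f) r (fun t => proj1 (proj2 (C1_near_at f _ _ (Hf t))))).
assert (C2 := polar_continuous (dy f) r (fun t => proj2 (proj2 (C1_near_at f _ _ (Hf t))))).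
assert (Cs : forall t, continuous (fun t => - r * sin t) t).
{ intros t; apply (ex_derive_continuous (fun t => - r * sin t)); auto_derive; auto. }
assert (Cc : forall t, continuous (fun t => r * cos t) t).
{ intros t; apply (ex_derive_continuous (fun t => r * cos t)); auto_derive; auto. }
enough (H : circle_int (fun t => ((dx f) @[r, t] * (- r * sin t) + (dy f) @[r, t] * (r * cos t)) * T t
    + f @[r, t] * T' t) = 0).
{ rewrite circle_int_plus in H; [lra| |].
  - apply cont_mult; auto. apply cont_plus; apply cont_mult; auto.
  - apply cont_mult; auto. }
unfold circle_int. rewrite (is_RInt_unique _ _ _ (f (r * cos (2 * PI)) (r * sin (2 * PI)) * T (2 * PI) - f @[r, 0] * T 0)).
- rewrite cos_2PI, sin_2PI, cos_0, sin_0, Hper. apply Rminus_diag.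
- apply (is_RInt_FTC (fun t => f @[r, t] * T t)).
  + intros t _. apply (is_derive_mult (fun t => f @[r, t]) T); auto.
    * now apply polar_dt.
    * intros; apply Rmult_comm.
  + intros t _. apply cont_plus; [|now apply cont_mult].
    apply cont_mult; auto. apply cont_plus; apply cont_mult; auto.
Qed.

(** Integrates a pointwise linear identity. The list of coefficients and integrands turns it into a
    linear relation between integrals that [lra] can combine with others. *)
Lemma circle_int_combination (l : list (R * (R -> R))) :
  (forall c f, In (c, f) l -> forall t, continuous f t) ->
  (forall t, fold_right (fun p acc => fst p * snd p t + acc) 0 l = 0) ->
  fold_right (fun p acc => fst p * circle_int (snd p) + acc) 0 l = 0.
Proof.
intros Hc H0.
assert (H : (forall t, continuous (fun t => fold_right (fun p acc => fst p * snd p t + acc) 0 l) t) /\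
  circle_int (fun t => fold_right (fun p acc => fst p * snd p t + acc) 0 l) =
  fold_right (fun p acc => fst p * circle_int (snd p) + acc) 0 l).
{ clear H0. induction l as [|[c f] l IH]; simpl.
  - split. intros; apply continuous_const. unfold circle_int. rewrite RInt_const. apply Rmult_0_r.
  - destruct IH as [IH1 IH2]. { intros c' f' Hin. apply (Hc c'). now right. }
    assert (Hf : forall t, continuous f t) by (apply (Hc c); now left).
    assert (Hcf : forall t, continuous (fun t => c * f t) t) by (apply cont_mult; auto; intros; apply continuous_const).
    split. now apply cont_plus.
    rewrite circle_int_plus by auto. rewrite circle_int_scal, IH2 by auto. reflexivity. }
rewrite <- (proj2 H). rewrite (circle_int_ext _ (fun _ => 0)) by auto.
unfold circle_int. rewrite RInt_const. apply Rmult_0_r.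
Qed.

Ltac prove_cont_list := let c := fresh in let f := fresh in let H := fresh in
  intros c f H; simpl in H; repeat destruct H as [H|H]; try contradiction;
  apply (f_equal snd) in H; cbn [snd] in H; rewrite <- H; clear H; prove_cont.

Lemma continuous_zero_left (f : R -> R) (u v : R) :
  u < v -> continuous f u -> (forall t, u < t < v -> f t = 0) -> f u = 0.
Proof.
intros Huv Hc H0.
rewrite <- (Ropp_involutive u).
apply (continuous_zero_right (fun t => f (- t)) (- v) (- u)); [lra| |].
- apply (continuous_comp Ropp f).
  + apply (ex_derive_continuous Ropp). auto_derive; auto.
  + now rewrite Ropp_involutive.
- intros t Ht. apply H0. lra.
Qed.

Lemma Ck_closed_dx a b k f : Ck_closed a b (S k) f -> Ck_closed a b k (dx f).
Proof.
intros H x y Hxy. apply (locally_2d_impl (fun u v => ex_diff_n f (S k) u v)); auto.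
apply locally_2d_forall. intros u v Huv. apply Huv.
Qed.
Lemma Ck_closed_dy a b k f : Ck_closed a b (S k) f -> Ck_closed a b k (dy f).
Proof.
intros H x y Hxy. apply (locally_2d_impl (fun u v => ex_diff_n f (S k) u v)); auto.
apply locally_2d_forall. intros u v Huv. apply Huv.
Qed.
Lemma Ck_closed_le a b k f : Ck_closed a b (S k) f -> Ck_closed a b k f.
Proof.
intros H x y Hxy. apply (locally_2d_impl (fun u v => ex_diff_n f (S k) u v)); auto.
apply locally_2d_forall. intros u v Huv. apply (ex_diff_n_m (S k)); auto.
Qed.

Lemma Ck_closed_Schwarz a b f x y : Ck_closed a b 2 f -> closed_annulus a b x y ->
  dx (dy f) x y = dy (dx f) x y.
Proof.
intros Hf H. specialize (Hf x y H). apply (Schwarz f).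
- revert Hf. apply locally_2d_impl, locally_2d_forall.
  intros u v (_ & H1 & H2 & (_ & _ & H3 & _) & (_ & H4 & _)). auto.
- destruct (locally_2d_singleton _ _ _ Hf) as (_ & _ & _ & _ & (_ & _ & _ & (H3 & _) & _)). exact H3.
- destruct (locally_2d_singleton _ _ _ Hf) as (_ & _ & _ & (_ & _ & _ & _ & (H3 & _)) & _). exact H3.
Qed.

(** * The first-order system for the Fourier coefficients on circles *)

Section PolarSystem.
Variables (a b mu lambda : R) (u1 u2 q : R -> R -> R).
Hypothesis Ha : 0 < a.
Hypothesis Hab : a < b.
Hypothesis Hmu : 0 < mu.
Hypothesis Hu1 : Ck_closed a b 2 u1.
Hypothesis Hu2 : Ck_closed a b 2 u2.
Hypothesis Hq : Ck_closed a b 1 q.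
Hypothesis Hdiv : forall x y, annulus a b x y -> dx u1 x y + dy u2 x y = 0.
Hypothesis Hmom : forall x y, annulus a b x y ->
  mu * laplacian u1 x y - dx q x y = lambda * u1 x y /\
  mu * laplacian u2 x y - dy q x y = lambda * u2 x y.

Lemma annulus_closed x y : annulus a b x y -> closed_annulus a b x y.
Proof. unfold annulus, closed_annulus. lra. Qed.

(** [Delta v = grad^perp (curl v)] for divergence-free [v]. *)
Lemma momentum_curl x y : annulus a b x y ->
  - mu * (dy (dx u2) x y - dy (dy u1) x y) - dx q x y = lambda * u1 x y /\
  mu * (dx (dx u2) x y - dx (dy u1) x y) - dy q x y = lambda * u2 x y.
Proof.
intros H. destruct (Hmom x y H) as [M1 M2]. unfold laplacian in M1, M2.
assert (Hloc := annulus_open a b x y Ha H).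
assert (E1 : dx (dx u1) x y = - dx (dy u2) x y).
{ rewrite <- dx_opp. apply Derive_ext_loc.
  generalize (locally_2d_1d_const_y _ _ _ Hloc). apply filter_imp.
  intros u Hu. specialize (Hdiv u y Hu). lra. }
assert (E2 : dy (dy u2) x y = - dy (dx u1) x y).
{ rewrite <- dy_opp. apply Derive_ext_loc.
  generalize (locally_2d_1d_const_x _ _ _ Hloc). apply filter_imp.
  intros u Hu. specialize (Hdiv x u Hu). lra. }
rewrite (Ck_closed_Schwarz a b u2) in E1 by (auto using annulus_closed).
rewrite <- (Ck_closed_Schwarz a b u1) in E2 by (auto using annulus_closed).
rewrite E1 in M1. rewrite E2 in M2. lra.
Qed.

(** The equations are given in the open annulus; continuity along rays carries them to both circles,
    since the mode system is required on the closed interval. *)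
Lemma polar_closure (g : R -> R -> R) :
  (forall r t, a <= r <= b -> continuity_2d_pt g (r * cos t) (r * sin t)) ->
  (forall x y, annulus a b x y -> g x y = 0) ->
  forall r t, a <= r <= b -> g @[r, t] = 0.
Proof.
intros Hc H0 r t Hr.
assert (Hin : forall s, a < s < b -> g @[s, t] = 0).
{ intros s Hs. apply H0. unfold annulus. rewrite polar_radius; lra. }
assert (Hcr : continuous (fun u => g @[u, t]) r).
{ apply (continuity_2d_slice (fun u v => g @[u, v])). apply continuity_2d_polar. auto. }
destruct (Req_dec r a) as [->|Hra].
- apply (continuous_zero_left (fun u => g @[u, t]) a b); auto.
- destruct (Req_dec r b) as [->|Hrb].
  + apply (continuous_zero_right (fun u => g @[u, t]) a b); auto.
  + apply Hin. lra.
Qed.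

Let near f (H : Ck_closed a b 1 f) r t (Hr : a <= r <= b) : C1_near f (r * cos t) (r * sin t).
Proof. exact (H _ _ (polar_closed a b r t Ha Hr)). Qed.

Let Hy1 := Ck_closed_dy a b 1 u1 Hu1.
Let Hx2 := Ck_closed_dx a b 1 u2 Hu2.
Let H1 := Ck_closed_le a b 1 u1 Hu1.
Let H2 := Ck_closed_le a b 1 u2 Hu2.

Lemma polar_identities r t : a <= r <= b ->
  let x := r * cos t in let y := r * sin t in
  dx u1 x y + dy u2 x y = 0 /\
  - mu * (dy (dx u2) x y - dy (dy u1) x y) - dx q x y - lambda * u1 x y = 0 /\
  mu * (dx (dx u2) x y - dx (dy u1) x y) - dy q x y - lambda * u2 x y = 0.
Proof.
intros Hr x y.
assert (C0 : forall f, Ck_closed a b 1 f -> forall r t, a <= r <= b ->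
   continuity_2d_pt f (r * cos t) (r * sin t) /\ continuity_2d_pt (dx f) (r * cos t) (r * sin t) /\
   continuity_2d_pt (dy f) (r * cos t) (r * sin t)).
{ intros f Hf s u Hs. apply C1_near_at. auto. }
split; [|split].
- apply (polar_closure (fun x y => dx u1 x y + dy u2 x y)); auto.
  intros s u Hs. apply continuity_2d_pt_plus. now apply (C0 u1). now apply (C0 u2).
- apply (polar_closure (fun x y => - mu * (dy (dx u2) x y - dy (dy u1) x y) - dx q x y - lambda * u1 x y)); auto.
  + intros s u Hs. repeat apply continuity_2d_pt_minus; try apply continuity_2d_pt_mult; try apply continuity_2d_pt_const.
    * apply continuity_2d_pt_minus. now apply (C0 (dx u2)). now apply (C0 (dy u1)).
    * now apply (C0 q).
    * now apply (C0 u1).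
  + intros u v Huv. generalize (proj1 (momentum_curl u v Huv)). lra.
- apply (polar_closure (fun x y => mu * (dx (dx u2) x y - dx (dy u1) x y) - dy q x y - lambda * u2 x y)); auto.
  + intros s u Hs. repeat apply continuity_2d_pt_minus; try apply continuity_2d_pt_mult; try apply continuity_2d_pt_const.
    * apply continuity_2d_pt_minus. now apply (C0 (dx u2)). now apply (C0 (dy u1)).
    * now apply (C0 q).
    * now apply (C0 u2).
  + intros u v Huv. generalize (proj2 (momentum_curl u v Huv)). lra.
Qed.

Variables (m phi : R).
Hypothesis Hper : forall ph, cos (m * (2 * PI) - ph) = cos ph /\ sin (m * (2 * PI) - ph) = - sin ph.
Local Notation c t := (cos (m * t - phi)).
Local Notation s t := (sin (m * t - phi)).

(** The components along e_r and e_theta are spelled out in Cartesian coordinates, on which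
    [fourier_derive] acts. Radial velocity and pressure are tested against the cosine, angular
    velocity and vorticity against the sine. *)
Definition rad_coef r := fourier u1 (fun t => cos t * c t) r + fourier u2 (fun t => sin t * c t) r.
Definition ang_coef r := fourier u1 (fun t => -1 * sin t * s t) r + fourier u2 (fun t => cos t * s t) r.
Definition vort_coef r := fourier (dx u2) (fun t => s t) r + fourier (dy u1) (fun t => -1 * s t) r.
Definition pres_coef r := fourier q (fun t => c t) r.

(** In order: incompressibility, the definition of the curl, the radial and the angular momentum
    equation. In each case [S1] integrates a pointwise identity between radial and angular
    derivatives, and [S2] rearranges what integration by parts produces. *)
Lemma fourier_system r : a <= r <= b ->
  is_derive rad_coef r ((- rad_coef r - m * ang_coef r) / r) /\
  is_derive ang_coef r ((r * vort_coef r - ang_coef r - m * rad_coef r) / r) /\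
  is_derive pres_coef r ((- lambda * r * rad_coef r - mu * m * vort_coef r) / r) /\
  is_derive vort_coef r ((lambda * r * ang_coef r - m * pres_coef r) / (mu * r)).
Proof.
intros Hr. assert (Hr0 : 0 < r) by lra.
assert (CX : forall f, Ck_closed a b 1 f ->
  (forall t, continuous (fun t => f @[r, t]) t) /\ (forall t, continuous (fun t => (dx f) @[r, t]) t) /\
  (forall t, continuous (fun t => (dy f) @[r, t]) t)).
{ intros f Hf. assert (HH : forall t, C1_near f (r * cos t) (r * sin t)) by auto.
  split; [|split]; apply polar_continuous; intros t; apply (C1_near_at f _ _ (HH t)). }
destruct (CX u1 H1) as (K1 & K1x & K1y). destruct (CX u2 H2) as (K2 & K2x & K2y).
destruct (CX q Hq) as (Kq & Kqx & Kqy).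
destruct (CX (dx u2) Hx2) as (_ & Kxx & Kxy). destruct (CX (dy u1) Hy1) as (_ & Kyx & Kyy).
assert (FD : forall f T, Ck_closed a b 1 f -> (forall t, continuous T t) ->
  is_derive (fourier f T) r
    (circle_int (fun t => ((dx f) @[r, t] * cos t + (dy f) @[r, t] * sin t) * T t))).
{ intros f T Hf HT. apply fourier_derive; auto. }
assert (BP : forall f T T', Ck_closed a b 1 f -> (forall t, is_derive T t (T' t)) -> (forall t, continuous T' t) -> T 0 = T (2 * PI) ->
  circle_int (fun t => ((dx f) @[r, t] * (- r * sin t) + (dy f) @[r, t] * (r * cos t)) * T t)
   = - circle_int (fun t => f @[r, t] * T' t)).
{ intros f T T' Hf HT HT' Hp. apply circle_by_parts; auto. }
assert (Hsc : forall t, sin t ^ 2 = 1 - cos t ^ 2).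
{ intros t. generalize (sin2_cos2 t). unfold Rsqr. intros; lra. }
assert (Pc : c 0 = c (2 * PI)) by (rewrite (proj1 (Hper phi)), Rmult_0_r, Rminus_0_l, cos_neg; auto).
assert (Ps : s 0 = s (2 * PI)) by (rewrite (proj2 (Hper phi)), Rmult_0_r, Rminus_0_l, sin_neg; auto).
assert (PID := fun t => polar_identities r t Hr). cbv zeta in PID.
split; [|split; [|split]].
- assert (B1 := BP u1 (fun t => -1 * sin t * c t) (fun t => -1 * cos t * c t + m * (sin t * s t)) H1
    ltac:(intros t; auto_derive; auto; unfold Rminus; ring) ltac:(prove_cont) ltac:(simpl; rewrite <- Pc, sin_0, sin_2PI; ring)).
  assert (B2 := BP u2 (fun t => cos t * c t) (fun t => -1 * sin t * c t + - m * (cos t * s t)) H2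
    ltac:(intros t; auto_derive; auto; unfold Rminus; ring) ltac:(prove_cont) ltac:(simpl; rewrite <- Pc, cos_0, cos_2PI; ring)).
  evar_last. { apply (is_derive_plus (fourier u1 (fun t => cos t * c t)) (fourier u2 (fun t => sin t * c t))); apply FD; auto; prove_cont. }
  as_real_eq. change (plus ?x ?y) with (x + y).
  match goal with |- circle_int ?f + circle_int ?g = _ => set (J1 := f); set (J2 := g) end.
  match type of B1 with circle_int ?f = - circle_int ?g => set (G1 := f) in *; set (T1 := g) in * end.
  match type of B2 with circle_int ?f = - circle_int ?g => set (G2 := f) in *; set (T2 := g) in * end.
  assert (S1 := circle_int_combination ((r, J1) :: (r, J2) :: (1, G1) :: (1, G2) :: nil)).
  simpl in S1. rewrite B1, B2 in S1.
  assert (S2 := circle_int_combination ((1, T1) :: (1, T2) ::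
    (1, fun t => u1 @[r, t] * (cos t * c t)) :: (1, fun t => u2 @[r, t] * (sin t * c t)) ::
    (m, fun t => u1 @[r, t] * (-1 * sin t * s t)) :: (m, fun t => u2 @[r, t] * (cos t * s t)) :: nil)).
  simpl in S2. unfold rad_coef, ang_coef, fourier.
  apply (Rmult_eq_reg_r r); [|lra].
  unfold Rdiv. rewrite (Rmult_assoc _ (/ r)), Rinv_l, Rmult_1_r by lra.
  specialize (S1 ltac:(unfold J1, J2, G1, G2; prove_cont_list)).
  specialize (S2 ltac:(unfold T1, T2; prove_cont_list)).
  specialize (S1 ltac:(intros t; unfold J1, J2, G1, G2; destruct (PID t) as (I1 & _);
    transitivity (r * ((dx u1) @[r, t] + (dy u2) @[r, t]) * c t * (sin t ^ 2 + cos t ^ 2));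
    [ring|rewrite I1; ring])).
  specialize (S2 ltac:(intros t; unfold T1, T2; ring)).
  lra.
- assert (B1 := BP u1 (fun t => cos t * s t) (fun t => -1 * sin t * s t + m * (cos t * c t)) H1
    ltac:(intros t; auto_derive; auto; unfold Rminus; ring) ltac:(prove_cont) ltac:(simpl; rewrite <- Ps, cos_0, cos_2PI; ring)).
  assert (B2 := BP u2 (fun t => sin t * s t) (fun t => cos t * s t + m * (sin t * c t)) H2
    ltac:(intros t; auto_derive; auto; unfold Rminus; ring) ltac:(prove_cont) ltac:(simpl; rewrite <- Ps, sin_0, sin_2PI; ring)).
  evar_last. { apply (is_derive_plus (fourier u1 (fun t => -1 * sin t * s t)) (fourier u2 (fun t => cos t * s t))); apply FD; auto; prove_cont. }
  as_real_eq. change (plus ?x ?y) with (x + y).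
  match goal with |- circle_int ?f + circle_int ?g = _ => set (J1 := f); set (J2 := g) end.
  match type of B1 with circle_int ?f = - circle_int ?g => set (G1 := f) in *; set (T1 := g) in * end.
  match type of B2 with circle_int ?f = - circle_int ?g => set (G2 := f) in *; set (T2 := g) in * end.
  assert (S1 := circle_int_combination ((r, J1) :: (r, J2) :: (-1, G1) :: (-1, G2) ::
    (- r, fun t => (dx u2) @[r, t] * s t) :: (- r, fun t => (dy u1) @[r, t] * (-1 * s t)) :: nil)).
  simpl in S1. rewrite B1, B2 in S1.
  assert (S2 := circle_int_combination ((1, T1) :: (1, T2) ::
    (-1, fun t => u1 @[r, t] * (-1 * sin t * s t)) :: (-1, fun t => u2 @[r, t] * (cos t * s t)) ::
    (- m, fun t => u1 @[r, t] * (cos t * c t)) :: (- m, fun t => u2 @[r, t] * (sin t * c t)) :: nil)).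
  simpl in S2. unfold rad_coef, ang_coef, vort_coef, fourier.
  apply (Rmult_eq_reg_r r); [|lra].
  unfold Rdiv. rewrite (Rmult_assoc _ (/ r)), Rinv_l, Rmult_1_r by lra.
  specialize (S1 ltac:(unfold J1, J2, G1, G2; prove_cont_list)).
  specialize (S2 ltac:(unfold T1, T2; prove_cont_list)).
  specialize (S1 ltac:(intros t; unfold J1, J2, G1, G2;
    transitivity (r * ((dx u2) @[r, t] - (dy u1) @[r, t]) * s t * (sin t ^ 2 + cos t ^ 2 - 1));
    [ring|rewrite Hsc; ring])).
  specialize (S2 ltac:(intros t; unfold T1, T2; ring)).
  lra.
- assert (B1 := BP (dx u2) (fun t => c t) (fun t => - m * s t) Hx2
    ltac:(intros t; auto_derive; auto; unfold Rminus; ring) ltac:(prove_cont) Pc).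
  assert (B2 := BP (dy u1) (fun t => -1 * c t) (fun t => m * s t) Hy1
    ltac:(intros t; auto_derive; auto; unfold Rminus; ring) ltac:(prove_cont) ltac:(simpl; rewrite <- Pc; ring)).
  evar_last. { apply FD; auto; prove_cont. }
  match goal with |- circle_int ?f = _ => set (J1 := f) end.
  match type of B1 with circle_int ?f = - circle_int ?g => set (G1 := f) in *; set (T1 := g) in * end.
  match type of B2 with circle_int ?f = - circle_int ?g => set (G2 := f) in *; set (T2 := g) in * end.
  assert (S1 := circle_int_combination ((r, J1) :: (mu, G1) :: (mu, G2) ::
    (lambda * r, fun t => u1 @[r, t] * (cos t * c t)) ::
    (lambda * r, fun t => u2 @[r, t] * (sin t * c t)) :: nil)).
  simpl in S1. rewrite B1, B2 in S1.
  assert (S2 := circle_int_combination ((mu, T1) :: (mu, T2) ::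
    (mu * m, fun t => (dx u2) @[r, t] * s t) :: (mu * m, fun t => (dy u1) @[r, t] * (-1 * s t)) :: nil)).
  simpl in S2. unfold rad_coef, vort_coef, fourier.
  apply (Rmult_eq_reg_r r); [|lra].
  unfold Rdiv. rewrite (Rmult_assoc _ (/ r)), Rinv_l, Rmult_1_r by lra.
  specialize (S1 ltac:(unfold J1, G1, G2; prove_cont_list)).
  specialize (S2 ltac:(unfold T1, T2; prove_cont_list)).
  specialize (S1 ltac:(intros t; unfold J1, G1, G2; destruct (PID t) as (_ & I2 & I3);
    match type of I2 with ?e2 = 0 => match type of I3 with ?e3 = 0 =>
      transitivity (r * c t * (- cos t * e2 - sin t * e3)); [ring|rewrite I2, I3; ring] end end)).
  specialize (S2 ltac:(intros t; unfold T1, T2; ring)).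
  lra.
- assert (B1 := BP q (fun t => s t) (fun t => m * c t) Hq
    ltac:(intros t; auto_derive; auto; unfold Rminus; ring) ltac:(prove_cont) Ps).
  evar_last. { apply (is_derive_plus (fourier (dx u2) (fun t => s t)) (fourier (dy u1) (fun t => -1 * s t))); apply FD; auto; prove_cont. }
  as_real_eq. change (plus ?x ?y) with (x + y).
  match goal with |- circle_int ?f + circle_int ?g = _ => set (J1 := f); set (J2 := g) end.
  match type of B1 with circle_int ?f = - circle_int ?g => set (G1 := f) in *; set (T1 := g) in * end.
  assert (S1 := circle_int_combination ((mu * r, J1) :: (mu * r, J2) :: (-1, G1) ::
    (- lambda * r, fun t => u1 @[r, t] * (-1 * sin t * s t)) ::
    (- lambda * r, fun t => u2 @[r, t] * (cos t * s t)) :: nil)).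
  simpl in S1. rewrite B1 in S1.
  assert (S2 := circle_int_combination ((1, T1) :: (- m, fun t => q @[r, t] * c t) :: nil)).
  simpl in S2. unfold ang_coef, pres_coef, fourier.
  apply (Rmult_eq_reg_r (mu * r)); [|apply Rgt_not_eq, Rmult_lt_0_compat; lra].
  unfold Rdiv. rewrite (Rmult_assoc _ (/ (mu * r))), Rinv_l, Rmult_1_r by (apply Rgt_not_eq, Rmult_lt_0_compat; lra).
  specialize (S1 ltac:(unfold J1, J2, G1; prove_cont_list)).
  specialize (S2 ltac:(unfold T1; prove_cont_list)).
  specialize (S1 ltac:(intros t; unfold J1, J2, G1; destruct (PID t) as (_ & I2 & I3);
    match type of I2 with ?e2 = 0 => match type of I3 with ?e3 = 0 =>
      transitivity (r * s t * (cos t * e3 - sin t * e2)); [ring|rewrite I2, I3; ring] end end)).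
  specialize (S2 ltac:(intros t; unfold T1; ring)).
  lra.
Qed.
End PolarSystem.

(** * From eigenfields to modes, and the theorem *)

Lemma polar_coordinates x y : 0 < radius x y ->
  exists t, 0 <= t <= 2 * PI /\ x = radius x y * cos t /\ y = radius x y * sin t.
Proof.
intros Hr. set (r := radius x y) in *. assert (HPI := PI_RGT_0).
assert (Hs : r ^ 2 = x ^ 2 + y ^ 2) by apply radius_sqr.
assert (Hx : -1 <= x / r <= 1).
{ assert (Rabs x <= r) by (apply Rabs_le; generalize (pow2_ge_0 y); nra).
  apply Rabs_le_between in H. split; apply Rmult_le_reg_r with r; auto; unfold Rdiv; rewrite Rmult_assoc, Rinv_l; lra. }
assert (Hb := acos_bound (x / r)).
assert (Hc : r * cos (acos (x / r)) = x) by (rewrite cos_acos by auto; field; lra).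
assert (Hsn : sin (acos (x / r)) = Rabs y / r).
{ rewrite sin_acos by auto. rewrite <- (sqrt_Rsqr (Rabs y / r)).
  - f_equal. unfold Rsqr. replace (Rabs y / r * (Rabs y / r)) with (Rabs y ^ 2 / r ^ 2) by (field; lra).
    rewrite pow2_abs. replace (y ^ 2) with (r ^ 2 - x ^ 2) by lra. field. lra.
  - apply Rmult_le_pos. apply Rabs_pos. left; now apply Rinv_0_lt_compat. }
destruct (Rle_lt_dec 0 y) as [Hy|Hy].
- exists (acos (x / r)). split; [lra|split; [auto|]]. rewrite Hsn, Rabs_pos_eq by auto. field; lra.
- exists (2 * PI - acos (x / r)). split; [lra|split].
  + rewrite cos_minus, cos_2PI, sin_2PI, Rmult_0_l, Rplus_0_r, Rmult_1_l. auto.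
  + rewrite sin_minus, cos_2PI, sin_2PI, Hsn, Rabs_left by auto. field; lra.
Qed.

Lemma trig_nat_period (n : nat) ph :
  cos (INR n * (2 * PI) - ph) = cos ph /\ sin (INR n * (2 * PI) - ph) = - sin ph.
Proof.
replace (INR n * (2 * PI) - ph) with (- ph + 2 * INR n * PI) by ring.
rewrite cos_period, sin_period. split. apply cos_neg. apply sin_neg.
Qed.

Section ToSpectrum.
Variables a b alpha mu lambda : R.
Hypothesis Ha : 0 < a.
Hypothesis Hab : a < b.
Hypothesis Hmu : 0 < mu.
Variables (v : vector_field) (q : scalar_field).
Hypothesis Hreg : regular a b v q.
Hypothesis Hmom : forall x y, annulus a b x y ->
       mu * laplacian (comp1 v) x y - dx q x y = lambda * comp1 v x y /\
       mu * laplacian (comp2 v) x y - dy q x y = lambda * comp2 v x y.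
Hypothesis Hinc : incompressible a b v.
Hypothesis Hbc : boundary_conditions a b alpha mu v q.
Hypothesis Hav : average_condition a b v.

Let u1 := comp1 v.
Let u2 := comp2 v.
Let beta := 2 / a - alpha / mu.

Let Hu1 : Ck_closed a b 2 u1 := proj1 Hreg.
Let Hu2 : Ck_closed a b 2 u2 := proj1 (proj2 Hreg).
Let Hq : Ck_closed a b 1 q := proj2 (proj2 Hreg).

Definition v_rad r t := u1 @[r, t] * cos t + u2 @[r, t] * sin t.
Definition v_ang r t := u1 @[r, t] * (-1 * sin t) + u2 @[r, t] * cos t.

Let near1 f (Hf : Ck_closed a b 1 f) r t (Hr : a <= r <= b) : C1_near f (r * cos t) (r * sin t).
Proof. exact (Hf _ _ (polar_closed a b r t Ha Hr)). Qed.

Lemma circle_cont f r : Ck_closed a b 1 f -> a <= r <= b ->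
  forall t, continuous (fun t => f @[r, t]) t.
Proof. intros Hf Hr. apply polar_continuous. intros t. apply (C1_near_at f). auto. Qed.

Let K1 r (Hr : a <= r <= b) := circle_cont u1 r (Ck_closed_le _ _ _ _ Hu1) Hr.
Let K2 r (Hr : a <= r <= b) := circle_cont u2 r (Ck_closed_le _ _ _ _ Hu2) Hr.

Lemma v_rad_cont r : a <= r <= b -> forall t, continuous (v_rad r) t.
Proof. intros Hr. unfold v_rad. assert (H1 := K1 r Hr). assert (H2 := K2 r Hr). prove_cont. Qed.
Lemma v_ang_cont r : a <= r <= b -> forall t, continuous (v_ang r) t.
Proof. intros Hr. unfold v_ang. assert (H1 := K1 r Hr). assert (H2 := K2 r Hr). prove_cont. Qed.

Lemma v_rad_boundary t : v_rad a t = 0 /\ v_rad b t = 0.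
Proof.
destruct Hbc as [Ba Bb]. split.
- destruct (Ba @[a, t]) as [H _]; [apply polar_radius; lra|].
  unfold dot, normal_inner in H. rewrite polar_radius in H by lra. cbn [fst snd] in H.
  unfold v_rad, u1, u2, comp1, comp2. rewrite <- Ropp_0, <- H. field. lra.
- destruct (Bb @[b, t]) as [H _]; [apply polar_radius; lra|].
  unfold dot, normal_outer in H. rewrite polar_radius in H by lra. cbn [fst snd] in H.
  unfold v_rad, u1, u2, comp1, comp2. rewrite <- H. field. lra.
Qed.

(** Differentiating [v . e_r = 0] along the inner circle turns the slip condition into a condition
    on the vorticity. *)
Lemma inner_vorticity t :
  (dx u2) @[a, t] - (dy u1) @[a, t] = beta * v_ang a t.
Proof.
assert (Hr : a <= a <= b) by lra.
assert (D1 := polar_dt u1 a t (near1 u1 (Ck_closed_le _ _ _ _ Hu1) a t Hr)).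
assert (D2 := polar_dt u2 a t (near1 u2 (Ck_closed_le _ _ _ _ Hu2) a t Hr)).
destruct Hbc as [Ba _].
destruct (Ba @[a, t]) as [_ HT]; [apply polar_radius; lra|].
unfold dot, traction, normal_inner, tau in HT. rewrite polar_radius in HT by lra. cbn [fst snd] in HT.
fold u1 u2 in HT.
change (fst (v @[a, t])) with (u1 @[a, t]) in HT.
change (snd (v @[a, t])) with (u2 @[a, t]) in HT.
unfold v_ang.
assert (HD : ((dx u1) @[a, t] * (- a * sin t) + (dy u1) @[a, t] * (a * cos t)) * cos t
   + u1 @[a, t] * (- sin t) +
   (((dx u2) @[a, t] * (- a * sin t) + (dy u2) @[a, t] * (a * cos t)) * sin t
   + u2 @[a, t] * cos t) = 0).
{ transitivity (Derive (v_rad a) t).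
  - symmetry. apply is_derive_unique. unfold v_rad.
    apply (is_derive_plus (fun t => u1 @[a, t] * cos t) (fun t => u2 @[a, t] * sin t)).
    + apply (is_derive_mult (fun t => u1 @[a, t]) cos); auto.
      auto_derive; auto; ring. intros; apply Rmult_comm.
    + apply (is_derive_mult (fun t => u2 @[a, t]) sin); auto.
      auto_derive; auto; ring. intros; apply Rmult_comm.
  - rewrite (Derive_ext _ (fun _ => 0)). apply Derive_const. intros s. apply v_rad_boundary. }
revert HT HD.
generalize ((dx u1) @[a, t]) ((dy u1) @[a, t]) ((dx u2) @[a, t])
  ((dy u2) @[a, t]) (u1 @[a, t]) (u2 @[a, t]) (q @[a, t]).
intros x1 y1 x2 y2 w1 w2 qq HT HD.
assert (Hsc : sin t ^ 2 = 1 - cos t ^ 2).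
{ generalize (sin2_cos2 t). unfold Rsqr. intros; lra. }
set (S := sin t) in *. set (C := cos t) in *.
assert (HD' : 2 * (S * C * (y2 - x1) + C ^ 2 * y1 - S ^ 2 * x2) = - 2 / a * (w1 * (-1 * S) + w2 * C)).
{ apply (Rmult_eq_reg_l a); [|lra].
  replace (a * (- 2 / a * (w1 * (-1 * S) + w2 * C))) with (- 2 * (w1 * (-1 * S) + w2 * C)) by (field; lra). lra. }
assert (HT' : 2 * S * C * (y2 - x1) + (C ^ 2 - S ^ 2) * (y1 + x2) = - alpha / mu * (w1 * (-1 * S) + w2 * C)).
{ apply (Rmult_eq_reg_l mu); [|lra].
  replace (mu * (- alpha / mu * (w1 * (-1 * S) + w2 * C))) with (- (alpha * (w1 * (-1 * S) + w2 * C))) by (field; lra).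
  transitivity (- (alpha * (w1 * (- (a * S) / a) + w2 * (a * C / a)))); [rewrite <- HT|]; field; lra. }
transitivity ((x2 - y1) * (S ^ 2 + C ^ 2)); [rewrite Hsc; ring|].
replace (beta * (w1 * (-1 * S) + w2 * C)) with (- alpha / mu * (w1 * (-1 * S) + w2 * C) - - 2 / a * (w1 * (-1 * S) + w2 * C))
  by (unfold beta; field; lra).
rewrite <- HD', <- HT'. ring.
Qed.

Lemma rad_coef_v_rad m phi r : a <= r <= b ->
  rad_coef u1 u2 m phi r = circle_int (fun t => v_rad r t * cos (m * t - phi)).
Proof.
intros Hr. unfold rad_coef, fourier. assert (H1 := K1 r Hr). assert (H2 := K2 r Hr).
rewrite <- circle_int_plus by prove_cont. apply circle_int_ext. intros t. unfold v_rad. ring.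
Qed.

Lemma ang_coef_v_ang m phi r : a <= r <= b ->
  ang_coef u1 u2 m phi r = circle_int (fun t => v_ang r t * sin (m * t - phi)).
Proof.
intros Hr. unfold ang_coef, fourier. assert (H1 := K1 r Hr). assert (H2 := K2 r Hr).
rewrite <- circle_int_plus by prove_cont. apply circle_int_ext. intros t. unfold v_ang. ring.
Qed.

Lemma circle_int_zero (f : R -> R) : (forall t, f t = 0) -> circle_int f = 0.
Proof.
intros H. rewrite (circle_int_ext _ (fun _ => 0)) by auto.
unfold circle_int. rewrite RInt_const. apply Rmult_0_r.
Qed.

Lemma coefficient_boundary m phi :
  rad_coef u1 u2 m phi a = 0 /\ rad_coef u1 u2 m phi b = 0 /\ vort_coef u1 u2 m phi b = 0 /\
  vort_coef u1 u2 m phi a = beta * ang_coef u1 u2 m phi a.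
Proof.
assert (Hra : a <= a <= b) by lra. assert (Hrb : a <= b <= b) by lra.
split; [|split; [|split]].
- rewrite rad_coef_v_rad by auto. apply circle_int_zero. intros t. rewrite (proj1 (v_rad_boundary t)). ring.
- rewrite rad_coef_v_rad by auto. apply circle_int_zero. intros t. rewrite (proj2 (v_rad_boundary t)). ring.
- unfold vort_coef, fourier.
  assert (H1 := circle_cont (dx u2) b (Ck_closed_dx _ _ _ _ Hu2) Hrb).
  assert (H2 := circle_cont (dy u1) b (Ck_closed_dy _ _ _ _ Hu1) Hrb).
  rewrite <- circle_int_plus by prove_cont. apply circle_int_zero. intros t.
  destruct Hbc as [_ Bb]. destruct (Bb @[b, t]) as [_ HC]; [apply polar_radius; lra|].
  unfold curl in HC. fold u1 u2 in HC.
  transitivity (((dx u2) @[b, t] - (dy u1) @[b, t]) * sin (m * t - phi)); [ring|].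
  rewrite HC. ring.
- rewrite ang_coef_v_ang by auto. unfold vort_coef, fourier.
  assert (H1 := circle_cont (dx u2) a (Ck_closed_dx _ _ _ _ Hu2) Hra).
  assert (H2 := circle_cont (dy u1) a (Ck_closed_dy _ _ _ _ Hu1) Hra).
  assert (H3 := v_ang_cont a Hra).
  rewrite <- circle_int_plus by prove_cont. rewrite <- circle_int_scal by prove_cont.
  apply circle_int_ext. intros t. rewrite <- (Rmult_assoc beta), <- inner_vorticity. ring.
Qed.

Lemma coefficient_system n phi r : a <= r <= b -> let m := INR n in
  is_derive (rad_coef u1 u2 m phi) r ((- rad_coef u1 u2 m phi r - m * ang_coef u1 u2 m phi r) / r) /\
  is_derive (ang_coef u1 u2 m phi) r ((r * vort_coef u1 u2 m phi r - ang_coef u1 u2 m phi r - m * rad_coef u1 u2 m phi r) / r) /\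
  is_derive (pres_coef q m phi) r ((- lambda * r * rad_coef u1 u2 m phi r - mu * m * vort_coef u1 u2 m phi r) / r) /\
  is_derive (vort_coef u1 u2 m phi) r ((lambda * r * ang_coef u1 u2 m phi r - m * pres_coef q m phi r) / (mu * r)).
Proof.
intros Hr m. apply (fourier_system a b mu lambda u1 u2 q); auto.
intros ph. apply trig_nat_period.
Qed.

Lemma exp_ln_range t : ln a <= t <= ln b -> a <= exp t <= b.
Proof.
intros Ht. assert (H : exp (ln a) <= exp t <= exp (ln b)) by (split; apply exp_le_compat; lra).
now rewrite !exp_ln in H by lra.
Qed.

Lemma is_derive_comp_exp (f : R -> R) (l t : R) : is_derive f (exp t) l ->
  is_derive (fun t => f (exp t)) t (exp t * l).
Proof. intros H. apply (is_derive_comp f exp); auto. apply is_derive_exp. Qed.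

(** The rescaled coefficients solve the mode system. If lambda / mu is not in the spectrum, the
    vorticity coefficient must vanish inside; then f'' = m^2 f with zero values at both ends forces
    f and g to vanish as well. *)
Lemma coefficients_vanish n phi r : (1 <= n)%nat ->
  ~ spectrum a b (slip_coef a alpha mu) (lambda / mu) -> a < r < b ->
  rad_coef u1 u2 (INR n) phi r = 0 /\ ang_coef u1 u2 (INR n) phi r = 0.
Proof.
intros Hn Hns Hr.
assert (Hm : 1 <= INR n) by (apply le_INR in Hn; simpl in Hn; lra).
destruct (coefficient_boundary (INR n) phi) as (BA & BB & BW & BS).
assert (Sys := coefficient_system n phi). cbv zeta in Sys.
set (m := INR n) in *.
set (A := rad_coef u1 u2 m phi) in *. set (B := ang_coef u1 u2 m phi) in *.
set (W := vort_coef u1 u2 m phi) in *. set (Q := pres_coef q m phi) in *.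
(* Since r v_r = - d_theta psi and v_theta = d_r psi, these are - m times the stream function
   coefficient, the vorticity coefficient and their derivatives in t = ln r. *)
set (f := fun t => exp t * A (exp t)). set (g := fun t => - m * (exp t * B (exp t))).
set (w := fun t => - m * W (exp t)).
set (p := fun t => - (m / mu) * (lambda * (exp t * B (exp t)) - m * Q (exp t))).
assert (Hl := ln_a_lt_ln_b a b Ha Hab).
assert (Hode : forall t, ln a <= t <= ln b ->
     is_derive f t (g t) /\ is_derive g t (m ^ 2 * f t + exp (2 * t) * w t) /\
     is_derive w t (p t) /\ is_derive p t (coef m (lambda / mu) t * w t)).
{ intros t Ht. destruct (Sys (exp t) (exp_ln_range t Ht)) as (D1 & D2 & D3 & D4).
  apply is_derive_comp_exp in D1. apply is_derive_comp_exp in D2.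
  apply is_derive_comp_exp in D3. apply is_derive_comp_exp in D4.
  assert (He := exp_pos t).
  assert (E2 : exp (2 * t) = exp t ^ 2) by (simpl; rewrite Rmult_1_r, <- exp_plus; f_equal; ring).
  assert (De := is_derive_exp t).
  assert (PR : forall (F : R -> R) l, is_derive F t l -> is_derive (fun t => exp t * F t) t (exp t * F t + exp t * l)).
  { intros F l HF. apply (is_derive_mult exp F); auto. intros; apply Rmult_comm. }
  split; [|split; [|split]].
  - unfold f, g. evar_last. apply PR, D1. as_real_eq; cbv beta; field; lra.
  - unfold f, g, w. rewrite E2. evar_last. apply is_derive_scal, PR, D2. as_real_eq; cbv beta; field; lra.
  - unfold w, p. evar_last. apply is_derive_scal, D4. as_real_eq; cbv beta; field; lra.
  - unfold w, p, coef. rewrite E2. evar_last.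
    apply is_derive_scal. apply (is_derive_minus (fun t => lambda * (exp t * B (exp t))) (fun t => m * Q (exp t))).
    apply is_derive_scal, PR, D2. apply is_derive_scal, D3.
    as_real_eq. change (minus ?x ?y) with (x - y). cbv beta. field. lra. }
assert (Hfa : f (ln a) = 0) by (unfold f; rewrite exp_ln, BA by lra; ring).
assert (Hfb : f (ln b) = 0) by (unfold f; rewrite exp_ln, BB by lra; ring).
assert (Hwi : forall t, ln a < t < ln b -> w t = 0).
{ intros t Ht. destruct (Req_dec (w t) 0) as [|Hne]; auto. exfalso. apply Hns.
  exists n. split; auto. exists f, g, w, p.
  split; [exact Hode|split; [auto|split; [split|]]].
  - unfold w. rewrite exp_ln, BW by lra. ring.
  - unfold w, g. rewrite exp_ln, BS by lra. unfold slip_coef, beta. field. lra.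
  - exists t. auto. }
assert (Hlr : ln a < ln r < ln b) by (split; apply ln_increasing; lra).
(* The product f g is 0 at both ends, and for w = 0 its derivative is g^2 + m^2 f^2, which therefore
   cannot be positive anywhere inside. *)
assert (Hphi0 : g (ln r) ^ 2 + m ^ 2 * f (ln r) ^ 2 <= 0).
{ apply Rnot_lt_le. intros Hpos.
  assert (HH := antiderivative_pos (fun t => f t * g t)
    (fun t => g t ^ 2 + m ^ 2 * f t ^ 2 + exp (2 * t) * f t * w t) (ln a) (ln b) (ln r)).
  cbv beta in HH. rewrite Hfa, Hfb, (Hwi (ln r) Hlr) in HH.
  assert (0 * g (ln a) < 0 * g (ln b)); [|lra].
  apply HH; auto; [| |lra].
  - intros t Ht. destruct (Hode t Ht) as (D1 & D2 & _).
    evar_last. apply (is_derive_mult f g); eauto. intros; apply Rmult_comm.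
    as_real_eq. unfold plus, mult; simpl. ring.
  - intros t Ht.
    assert (0 <= g t ^ 2 + m ^ 2 * f t ^ 2).
    { generalize (pow2_ge_0 (g t)) (pow2_ge_0 (m * f t)). nra. }
    destruct (Req_dec t (ln a)) as [->|Hta]; [rewrite Hfa in *; lra|].
    destruct (Req_dec t (ln b)) as [->|Htb]; [rewrite Hfb in *; lra|].
    rewrite Hwi by lra. lra. }
assert (Hg2 := pow2_ge_0 (g (ln r))). assert (Hf2 := pow2_ge_0 (f (ln r))).
assert (Hm2 : 1 <= m ^ 2) by nra.
assert (Hg0 : g (ln r) = 0) by nra. assert (Hf0 : f (ln r) = 0) by nra.
unfold f in Hf0. unfold g in Hg0. rewrite exp_ln in Hf0, Hg0 by lra.
apply Rmult_integral in Hf0. apply Rmult_integral in Hg0.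
destruct Hf0 as [Hf0|Hf0]; [lra|]. destruct Hg0 as [Hg0|Hg0]; [lra|].
apply Rmult_integral in Hg0. destruct Hg0 as [Hg0|Hg0]; [lra|]. auto.
Qed.

(** For frequency 0 incompressibility says that r times the mean of v_r is constant, and it is 0 on
    the inner circle. *)
Lemma zero_mode_radial r : a <= r <= b -> circle_int (v_rad r) = 0.
Proof.
intros Hr.
assert (E : forall s, a <= s <= b -> rad_coef u1 u2 (INR 0) 0 s = circle_int (v_rad s)).
{ intros s Hs. rewrite rad_coef_v_rad by auto. apply circle_int_ext. intros t. simpl INR.
  rewrite Rmult_0_l, Rminus_0_r, cos_0. ring. }
destruct (coefficient_boundary (INR 0) 0) as (BA & _).
rewrite <- E by auto.
assert (HX : a * rad_coef u1 u2 (INR 0) 0 a = r * rad_coef u1 u2 (INR 0) 0 r).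
{ apply (is_derive_constant (fun s => s * rad_coef u1 u2 (INR 0) 0 s) (fun s => 0) a r); auto; [lra|].
  intros s Hs. destruct (coefficient_system 0 0 s ltac:(lra)) as (D1 & _).
  evar_last. apply (is_derive_mult (fun s => s) (rad_coef u1 u2 (INR 0) 0)).
  apply is_derive_id. apply D1. intros; apply Rmult_comm.
  as_real_eq. change (plus ?x ?y) with (x + y). change (mult ?x ?y) with (x * y). change one with 1. simpl INR. field. lra. }
rewrite BA in HX. assert (Hz : r * rad_coef u1 u2 (INR 0) 0 r = 0) by lra.
apply Rmult_integral in Hz. destruct Hz; [lra|auto].
Qed.

Lemma zero_mode_angular r : a <= r <= b -> circle_int (v_ang r) = 0.
Proof.
intros Hr. assert (H := Hav r Hr). unfold circulation in H.
change (circle_int (fun t => dot (v @[r, t]) (tau @[r, t]) * r) = 0) in H.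
rewrite (circle_int_ext _ (fun t => r * v_ang r t)) in H.
- rewrite circle_int_scal in H by now apply v_ang_cont.
  apply Rmult_integral in H. destruct H; [lra|auto].
- intros t. unfold dot, tau. rewrite polar_radius by lra. cbn [fst snd].
  unfold v_ang, u1, u2, comp1, comp2. field. lra.
Qed.

Lemma velocity_vanishes r : ~ spectrum a b (slip_coef a alpha mu) (lambda / mu) -> a < r < b ->
  forall t, 0 < t < 2 * PI -> v_rad r t = 0 /\ v_ang r t = 0.
Proof.
intros Hns Hr t Ht. assert (Hr' : a <= r <= b) by lra.
split; apply trig_complete; auto.
- now apply v_rad_cont.
- intros [|n] phi.
  + rewrite (circle_int_ext _ (fun t => cos phi * v_rad r t)).
    * rewrite circle_int_scal by now apply v_rad_cont. rewrite zero_mode_radial by auto. ring.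
    * intros s. simpl INR. rewrite Rmult_0_l, Rminus_0_l, cos_neg. ring.
  + rewrite <- rad_coef_v_rad by auto. refine (proj1 (coefficients_vanish (S n) phi r _ Hns Hr)). lia.
- now apply v_ang_cont.
- intros [|n] phi.
  + rewrite (circle_int_ext _ (fun t => cos phi * v_ang r t)).
    * rewrite circle_int_scal by now apply v_ang_cont. rewrite zero_mode_angular by auto. ring.
    * intros s. simpl INR. rewrite Rmult_0_l, Rminus_0_l, cos_neg. ring.
  (* The angular coefficients are taken against sines; shifting the phase by pi / 2 produces the
     cosine that [trig_orthogonal] asks for. *)
  + rewrite (circle_int_ext _ (fun t => v_ang r t * sin (INR (S n) * t - (phi - PI / 2)))).
    * rewrite <- ang_coef_v_ang by auto. refine (proj2 (coefficients_vanish (S n) _ r _ Hns Hr)). lia.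
    * intros s. f_equal. replace (INR (S n) * s - (phi - PI / 2)) with (PI / 2 + (INR (S n) * s - phi)) by ring.
      apply cos_sin.
Qed.

Lemma velocity_zero x y : ~ spectrum a b (slip_coef a alpha mu) (lambda / mu) -> annulus a b x y -> v x y = (0, 0).
Proof.
intros Hns Hxy.
destruct (polar_coordinates x y) as (t & Ht & Hx & Hy); [destruct Hxy; lra|].
set (r := radius x y) in *. assert (Hr : a < r < b) by exact Hxy. assert (Hr' : a <= r <= b) by lra.
assert (HPI := PI_RGT_0).
assert (H0 : forall s, 0 < s < 2 * PI -> u1 @[r, s] = 0 /\ u2 @[r, s] = 0).
{ intros s Hs. destruct (velocity_vanishes r Hns Hr s Hs) as [E1 E2]. unfold v_rad, v_ang in E1, E2.
  revert E1 E2. generalize (u1 @[r, s]) (u2 @[r, s]). intros w1 w2 E1 E2.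
  assert (Hsc : sin s ^ 2 + cos s ^ 2 = 1) by (generalize (sin2_cos2 s); unfold Rsqr; intros; lra).
  split.
  - transitivity (w1 * (sin s ^ 2 + cos s ^ 2)); [rewrite Hsc; ring|].
    transitivity ((w1 * cos s + w2 * sin s) * cos s - (w1 * (-1 * sin s) + w2 * cos s) * sin s); [ring|].
    rewrite E1, E2. ring.
  - transitivity (w2 * (sin s ^ 2 + cos s ^ 2)); [rewrite Hsc; ring|].
    transitivity ((w1 * cos s + w2 * sin s) * sin s + (w1 * (-1 * sin s) + w2 * cos s) * cos s); [ring|].
    rewrite E1, E2. ring. }
(* Completeness was proved for angles strictly between 0 and 2 pi; continuity along the circle
   supplies the two ends. *)
assert (Hall : forall f, (forall s, continuous (fun s => f @[r, s]) s) ->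
   (forall s, 0 < s < 2 * PI -> f @[r, s] = 0) -> f x y = 0).
{ intros f Hf Hz. rewrite Hx, Hy.
  destruct (Req_dec t 0) as [->|Ht0].
  - apply (continuous_zero_left (fun s => f @[r, s]) 0 (2 * PI)); auto; lra.
  - destruct (Req_dec t (2 * PI)) as [->|Ht1].
    + apply (continuous_zero_right (fun s => f @[r, s]) 0 (2 * PI)); auto; lra.
    + apply Hz. lra. }
assert (F1 := Hall u1 (K1 r Hr') (fun s Hs => proj1 (H0 s Hs))).
assert (F2 := Hall u2 (K2 r Hr') (fun s Hs => proj2 (H0 s Hs))).
unfold u1, comp1 in F1. unfold u2, comp2 in F2.
rewrite (surjective_pairing (v x y)). now rewrite F1, F2.
Qed.
End ToSpectrum.

(** * The largest eigenvalue and the critical viscosity *)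

Lemma rest_eigenvalue_spectrum a b alpha mu lambda : 0 < a -> a < b -> 0 < mu ->
  rest_eigenvalue a b alpha mu lambda -> spectrum a b (slip_coef a alpha mu) (lambda / mu).
Proof.
intros Ha Hab Hmu (v & q & Hreg & Hmom & Hinc & Hbc & Hav & x & y & Hxy & Hne).
destruct (Classical_Prop.classic (spectrum a b (slip_coef a alpha mu) (lambda / mu))) as [|Hns]; auto.
exfalso. apply Hne. apply (velocity_zero a b alpha mu lambda Ha Hab Hmu v q); auto.
Qed.

Lemma largest_from_spectrum a b alpha mu s n : 0 < a -> a < b -> 0 < mu -> s <> 0 ->
  is_lub (spectrum a b (slip_coef a alpha mu)) s -> (1 <= n)%nat ->
  charac a b (INR n) (slip_coef a alpha mu) s = 0 ->
  largest_rest_eigenvalue a b alpha mu (mu * s).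
Proof.
intros Ha Hab Hmu Hs [Hub _] Hn Hc. split.
- destruct n as [|n]; [lia|]. now apply (eigenvalue_of_charac a b alpha mu s Ha Hab Hmu Hs n).
- intros l Hl. apply rest_eigenvalue_spectrum in Hl; auto. apply Hub in Hl.
  apply (Rmult_le_compat_l mu) in Hl; [|lra]. replace (mu * (l / mu)) with l in Hl by (field; lra). auto.
Qed.

(** With H = [harm1_energy], this is the root mu of 1 + (2/a - alpha/mu) H / a = 0. It makes
    positivity evident, while the original quotient has negative numerator and denominator. *)
Lemma mu_crit_harm1_energy a b alpha : 0 < a -> a < b ->
  mu_crit a b alpha = alpha * a * harm1_energy a b / (a ^ 2 + 2 * harm1_energy a b).
Proof.
intros Ha Hab. assert (HH := harm1_energy_pos a b Ha Hab). assert (Hsq := square_gap a b Ha Hab).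
assert (Ha2 : 0 < a ^ 2) by (apply pow_lt; auto).
set (sg := b / a).
assert (Hsg : sg ^ 2 - 1 <> 0).
{ unfold sg. replace ((b / a) ^ 2 - 1) with ((b * b - a * a) / a ^ 2) by (field; lra).
  apply Rgt_not_eq, Rdiv_lt_0_compat; lra. }
assert (HN : 4 * sg ^ 4 * ln sg - 3 * sg ^ 4 + 4 * sg ^ 2 - 1 = 4 * (sg ^ 2 - 1) ^ 2 * (harm1_energy a b / a ^ 2)).
{ unfold harm1_energy, harm1_energy_primitive. unfold sg. rewrite ln_div by lra.
  rewrite !exp_2ln by lra.
  replace (exp (4 * ln b)) with (b ^ 4) by (replace (4 * ln b) with (2 * ln b + 2 * ln b) by ring; rewrite exp_plus, exp_2ln by lra; ring).
  replace (exp (4 * ln a)) with (a ^ 4) by (replace (4 * ln a) with (2 * ln a + 2 * ln a) by ring; rewrite exp_plus, exp_2ln by lra; ring).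
  field. repeat split; lra. }
unfold mu_crit. fold sg.
set (h := harm1_energy a b / a ^ 2) in *.
replace (harm1_energy a b) with (h * a ^ 2) by (unfold h; field; lra).
assert (Hh : 0 < h) by (apply Rdiv_lt_0_compat; auto).
assert (Hs2 : 0 < (sg ^ 2 - 1) ^ 2) by now apply pow2_gt_0.
replace (1 + 3 * sg ^ 4 - 4 * sg ^ 2 - 4 * sg ^ 4 * ln sg) with (- (4 * (sg ^ 2 - 1) ^ 2 * h)) by (rewrite <- HN; ring).
replace (sg ^ 4 - 1 - 4 * sg ^ 4 * ln sg) with (- (2 * (sg ^ 2 - 1) ^ 2 * (1 + 2 * h))).
2:{ replace (- (2 * (sg ^ 2 - 1) ^ 2 * (1 + 2 * h))) with (- 2 * (sg ^ 2 - 1) ^ 2 - 4 * (sg ^ 2 - 1) ^ 2 * h) by ring.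
    rewrite <- HN. ring. }
field. repeat split; try lra. nra.
Qed.

Lemma dx_const (c x y : R) : dx (fun _ _ => c) x y = 0.
Proof. apply (Derive_const c x). Qed.
Lemma dy_const (c x y : R) : dy (fun _ _ => c) x y = 0.
Proof. apply (Derive_const c y). Qed.
Lemma laplacian_const (c x y : R) : laplacian (fun _ _ => c) x y = 0.
Proof.
assert (E1 : dx (dx (fun _ _ => c)) x y = dx (fun _ _ => 0) x y) by (apply Derive_ext; intros t; apply dx_const).
assert (E2 : dy (dy (fun _ _ => c)) x y = dy (fun _ _ => 0) x y) by (apply Derive_ext; intros t; apply dy_const).
unfold laplacian. rewrite E1, E2, dx_const, dy_const. ring.
Qed.

Lemma rest_steady_state a b alpha mu p0 : 0 < a -> steady_state a b alpha mu rest_velocity (constant_pressure p0).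
Proof.
intros Ha.
assert (E1 : comp1 rest_velocity = fun _ _ => 0) by reflexivity.
assert (E2 : comp2 rest_velocity = fun _ _ => 0) by reflexivity.
split; [|split; [|split; [|split]]].
- split; [|split]; apply smooth_Ck_closed; auto.
  + exact (smooth_const 2 0).
  + exact (smooth_const 2 0).
  + exact (smooth_const 1 p0).
- intros x y _. unfold advect, constant_pressure. rewrite E1, E2, !laplacian_const, !dx_const, !dy_const. split; ring.
- intros x y _. unfold divergence. rewrite E1, E2, dx_const, dy_const. ring.
- split; intros x y Hr.
  + unfold dot, traction, rest_velocity. cbn [fst snd]. fold rest_velocity.
    rewrite E1, E2, !dx_const, !dy_const. unfold constant_pressure, normal_inner, tau. cbn [fst snd].
    rewrite Hr. split; field; lra.
  + unfold dot, curl, rest_velocity. cbn [fst snd]. fold rest_velocity.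
    rewrite E1, E2, dx_const, dy_const. split; ring.
- intros r _. apply circle_int_zero. intros t. unfold dot, rest_velocity. cbn [fst snd]. ring.
Qed.

Theorem theorem1p1 (a b alpha mu p0 : R)
    (ha : 0 < a) (hab : a < b) (halpha : 0 < alpha) (hmu : 0 < mu) :
  0 < mu_crit a b alpha /\
  steady_state a b alpha mu rest_velocity (constant_pressure p0) /\
  (mu_crit a b alpha < mu -> rest_linearly_stable a b alpha mu) /\
  (mu < mu_crit a b alpha -> rest_linearly_unstable a b alpha mu).
Proof.
assert (HH := harm1_energy_pos a b ha hab).
assert (Hden : 0 < a ^ 2 + 2 * harm1_energy a b) by (generalize (pow_lt a 2 ha); lra).
(* The stability margin is a positive multiple of mu - [mu_crit], so its sign decides between the
   two cases. *)
assert (Hgam : 1 + slip_coef a alpha mu * harm1_energy a b =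
  (a ^ 2 + 2 * harm1_energy a b) / (a ^ 2 * mu) * (mu - mu_crit a b alpha)).
{ rewrite mu_crit_harm1_energy by auto. unfold slip_coef. field. repeat split; lra. }
assert (Hc : 0 < (a ^ 2 + 2 * harm1_energy a b) / (a ^ 2 * mu)).
{ apply Rdiv_lt_0_compat; auto. apply Rmult_lt_0_compat; auto. apply pow_lt; auto. }
split; [|split; [|split]].
- rewrite mu_crit_harm1_energy by auto. apply Rdiv_lt_0_compat; auto. repeat apply Rmult_lt_0_compat; auto.
- now apply rest_steady_state.
- intros Hs. destruct (stable_spectrum a b ha hab (slip_coef a alpha mu)) as (s & n & Hneg & Hlub & Hn & Hch).
  { rewrite Hgam. apply Rmult_lt_0_compat; lra. }
  exists (mu * s). split; [|nra]. apply (largest_from_spectrum a b alpha mu s n); auto. lra.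
- intros Hs. destruct (unstable_spectrum a b ha hab (slip_coef a alpha mu)) as (s & n & Hpos & Hlub & Hn & Hch).
  { rewrite Hgam. nra. }
  exists (mu * s). split; [|nra]. apply (largest_from_spectrum a b alpha mu s n); auto. lra.
Qed.
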